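(* Suppose one observes a realization of the stochastic process $Y_\epsilon(t)$, $t\in(0,1)$, defined by $dY_\epsilon(t)=S(t)\,dt+\epsilon\,dw(t)$, $\epsilon>0$, where $S\in L_2(0,1)$ is an unknown signal and $dw(t)$ is Gaussian white noise. Consider testing $H_0: S\in\Theta_0\subset L_2(0,1)$ versus $H_1: S\in\Theta_1\subset L_2(0,1)$. All closures are taken in the weak topology of $L_2(0,1)$. (i) Let $\Theta_0$ be a bounded set in $L_2(0,1)$. Then $H_0$ and $H_1$ are distinguishable if the closures of $\Theta_0$ and $\Theta_1$ are disjoint. (ii) The converse holds if $\Theta_1$ is also a bounded set in $L_2(0,1)$: if $\Theta_0$ and $\Theta_1$ are bounded and $H_0$ and $H_1$ are distinguishable, then the closures of $\Theta_0$ and $\Theta_1$ are disjoint.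
   Context: A test $K_\epsilon$ is a measurable function of the observation $Y_\epsilon$ with values in $[0,1]$ (the probability of rejecting the hypothesis). $H_0$ and $H_1$ are distinguishable if there is a family of tests $K_\epsilon$, $\epsilon>0$, with $\sup_{S\in\Theta_0}E_S[K_\epsilon]\to0$ and $\sup_{S\in\Theta_1}E_S[1-K_\epsilon]\to0$ as $\epsilon\to0$. *)

(* Defs.v *)
From HB Require Import structures.
From mathcomp Require Import all_boot all_order all_algebra.
From mathcomp Require Import all_classical all_reals all_analysis.
Set Implicit Arguments.
Unset Strict Implicit.
Unset Printing Implicit Defensive.
Import Order.TTheory GRing.Theory Num.Theory.
Import numFieldNormedType.Exports.
Local Open Scope classical_set_scope.
Local Open Scope ring_scope.

Definition leb01 (R : realType) :=
  mrestr (@lebesgue_measure R) (measurable_itv `]0%R, 1%R[).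
Arguments leb01 : clear implicits.

Definition L2 (R : realType) := LspaceType2 (leb01 R).

HB.instance Definition _ (R : realType) := gen_eqMixin (L2 R).
HB.instance Definition _ (R : realType) := gen_choiceMixin (L2 R).

Definition L2norm (R : realType) (S : L2 R) : R :=
  fine ('N[leb01 R]_2%:E [EFin \o (S : R -> R)]).

Definition L2bounded (R : realType) (Theta : set (L2 R)) :=
  exists M : R, forall S, Theta S -> L2norm S <= M.

(* The library puts no vector space structure on the quotient [LspaceType], so
   linearity is tested on representatives: [h] is the class of [a *: f + g]. *)
Definition bounded_linear_form (R : realType) (l : L2 R -> R) :=
  (forall (a : R) (f g h : L2 R),
     {ae leb01 R, forall x, h x = a * f x + g x} -> l h = a * l f + l g) /\
  (exists C : R, forall f : L2 R, `|l f| <= C * L2norm f).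

Definition L2dual (R : realType) := {l : L2 R -> R | bounded_linear_form l}.

HB.instance Definition _ (R : realType) := gen_eqMixin (L2dual R).
HB.instance Definition _ (R : realType) := gen_choiceMixin (L2dual R).

(* [L2 R] with the coarsest topology making every element of [L2dual R]
   continuous. *)
Definition weakL2 (R : realType) :=
  initial_topology
    (fun S : L2 R => (fun l => sval l S) : {ptws L2dual R -> R}).

Definition weak_closure (R : realType) (Theta : set (L2 R)) : set (L2 R) :=
  closure (Theta : set (weakL2 R)).

(* Taking some of the [B i] to be [setT] gives the product rule for every
   subfamily. *)
Definition mutually_independent (R : realType) (d : measure_display)
    (Omega : measurableType d) (P : probability Omega R) (n : nat)
    (X : 'I_n -> Omega -> R) :=
  forall B : 'I_n -> set R, (forall i, measurable (B i)) ->
    (P (\bigcap_(i in [set: 'I_n]) (X i @^-1` B i)) =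
     \prod_(i < n) P (X i @^-1` B i))%E.

(* The second parameter of [normal_prob] is the standard deviation. *)
Definition wiener_process (R : realType) (d : measure_display)
    (Omega : measurableType d) (P : probability Omega R) (w : R -> Omega -> R) :=
  [/\ forall t, 0 <= t <= 1 -> measurable_fun setT (w t),
      {ae P, forall om, w 0 om = 0},
      forall s t, 0 <= s -> s < t -> t <= 1 ->
        forall B : set R, measurable B ->
          P ((fun om => w t om - w s om) @^-1` B) =
            normal_prob 0 (Num.sqrt (t - s)) B,
      forall (n : nat) (t : nat -> R),
        0 <= t 0%N -> (forall i, (i < n)%N -> t i <= t i.+1) -> t n <= 1 ->
        mutually_independent P
          (fun (i : 'I_n) om => w (t i.+1) om - w (t i) om) &
      {ae P, forall om, {within `[0, 1], continuous (fun t => w t om)}}].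

Definition path01 (R : realType) := {t : R | t \in `]0, 1[} -> R.

Definition cylinders (R : realType) : set (set (path01 R)) :=
  \bigcup_t [set (fun y : path01 R => y t) @^-1` B | B in measurable].

Definition obs_space (R : realType) := g_sigma_algebraType (@cylinders R).

(* dY = S dt + eps dw, Y(0) = 0, in integrated form. *)
Definition observation (R : realType) (d : measure_display)
    (Omega : measurableType d) (w : R -> Omega -> R) (eps : R) (S : L2 R)
    (om : Omega) : obs_space R :=
  fun t => \int[leb01 R]_(x in `]0, val t[) S x + eps * w (val t) om.

Definition is_test (R : realType) (K : obs_space R -> R) :=
  measurable_fun setT K /\ forall y, 0 <= K y <= 1.

(* The suprema are those of subsets of [0, 1]; in particular [sup set0 = 0]. *)
Definition distinguishable (R : realType) (d : measure_display)
    (Omega : measurableType d) (P : probability Omega R) (w : R -> Omega -> R)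
    (Theta0 Theta1 : set (L2 R)) :=
  exists K : R -> obs_space R -> R,
    [/\ forall eps, 0 < eps -> is_test (K eps),
        sup [set fine 'E_P[fun om => K eps (observation w eps S om)]
              | S in Theta0] @[eps --> 0^'+] --> (0 : R) &
        sup [set fine 'E_P[fun om => 1 - K eps (observation w eps S om)]
              | S in Theta1] @[eps --> 0^'+] --> (0 : R)].

(* Main.v *)
Require Import Defs.
From HB Require Import structures.
From mathcomp Require Import all_boot all_order all_algebra.
From mathcomp Require Import all_classical all_reals all_analysis.
From mathcomp Require Import measurable_realfun ring lra.
Set Implicit Arguments.
Unset Strict Implicit.
Unset Printing Implicit Defensive.
Import Order.TTheory GRing.Theory Num.Theory.
Import numFieldNormedType.Exports.
Local Open Scope classical_set_scope.
Local Open Scope ring_scope.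

(** Weak closures are separated by finitely many continuous linear functionals
    of the signal, and finitely many such functionals are both all that a
    bounded hypothesis needs and all that a test can use.

    Suppose first that the closures are disjoint and [Theta0] is bounded.  Then
    some finite family of functionals takes values at distance at least [delta]
    on the two hypotheses ([separating_functionals]): otherwise pairs of
    signals, one from each hypothesis, with closer and closer values would have
    a common weak limit, because bounded sets are weakly relatively compact
    ([weak_ultra_limit]).  A functional [l] is known from its values on the
    indicators of the intervals from 0 to [t], which form its
    [dual_primitive]; and [l S] is the limit of the sums, called energies, of
    [N] times the products of the increments of this function and of the
    primitive of [S] along the grids of step [1/N], [N = 2^n]
    ([dual_energy_cvg]).  Putting the observed path in place of the primitive
    adds a Gaussian error, of variance [eps^2] times the energy of the dual
    primitive, which stays bounded in [n].  Along a sparse sequence of grids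
    these errors converge almost surely, so that [l S] is estimated with a mean
    error at most [eps * C], uniformly in [S] ([linear_functional_estimator]).
    The test accepts the hypothesis when the estimates are compatible with some
    signal in [Theta0].

    Suppose now that both hypotheses are bounded and distinguishable, and that
    [S] is in both closures; fix [eps] such that both errors are below 1/4.
    Adding a signal of norm at most [M] to the noise multiplies its law by a
    density whose second moment is at most [exp (M^2 / eps^2)]
    (Cameron-Martin).  Hence an event that is improbable under pure noise is
    improbable under all these signals at once ([shift_domination]), and a
    function that is close to the test for the law of the noise is close to it
    for all of them.  Such a function can be chosen to depend on finitely many
    values of the path in a uniformly continuous way
    ([approximation_by_cylinder_fun]), and its mean is then a weakly continuous
    function of the signal, since the values of the primitive are.  So the
    power of the test is nearly the same at all signals of bounded norm in
    some weak neighbourhood of [S] ([power_weakly_close]); this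
    neighbourhood meets both hypotheses, which is absurd.

    Energies of finitely many increments stand for stochastic integrals, and
    the domination [E_S h <= a/2 E_0 h + exp (M^2/eps^2) / (2a)], which is
    linear in [h], for the density on the path space: everything is proved for
    finitely many independent Gaussian increments and passes to the limit. *)

(** * Expectations of products of independent variables *)

Section transfer.
Import HBNNSimple.
Context d1 d2 (T1 : measurableType d1) (T2 : measurableType d2) (R : realType).
Variables (mu : {measure set T1 -> \bar R}) (m : {measure set T2 -> \bar R}).
Variables (Z : T1 -> T2) (D : T1 -> R).
Hypotheses (mZ : measurable_fun setT Z) (mD : measurable_fun setT D).
Hypothesis D0 : forall x, 0 <= D x.
Hypothesis mE : forall A, measurable A ->
  (m A = \int[mu]_(x in Z @^-1` A) (D x)%:E)%E.

Let indic_case (A : set T2) : measurable A ->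
  (\int[m]_y (\1_A y)%:E = \int[mu]_x (\1_A (Z x) * D x)%:E)%E.
Proof.
move=> mA; rewrite integral_indic// setIT mE// integral_mkcond.
apply: eq_integral => x _; rewrite patchE/= indicE.
have -> : (x \in Z @^-1` A) = (Z x \in A) by apply/idP/idP; rewrite !inE.
by case: ifPn => _; rewrite ?mul1r ?mul0r.
Qed.

(** The image by [Z] of the measure of density [D]: with [D = 1] this computes
    expectations from laws, with [Z] the identity it removes a density. *)
Lemma ge0_integral_density (f : T2 -> R) : measurable_fun setT f ->
  (forall y, 0 <= f y) ->
  (\int[m]_y (f y)%:E = \int[mu]_x (f (Z x) * D x)%:E)%E.
Proof.
move=> mf f0.
have mfe : measurable_fun setT (EFin \o f) by exact/measurable_EFinP.
pose g := nnsfun_approx measurableT mfe.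
have gcvg y : (EFin \o (g ^~ y)) n @[n --> \oo] --> (f y)%:E.
  by apply: cvg_nnsfun_approx => // z _; rewrite lee_fin.
have gnd' y : {homo (fun n => (g n y)%:E) : n k / (n <= k)%N >-> (n <= k)%E}.
    move=> n k nk; rewrite lee_fin.
  by have /lefP := @nd_nnsfun_approx _ _ _ _ measurableT _ mfe _ _ nk; exact.
have simple n :
    (\int[m]_y (g n y)%:E = \int[mu]_x (g n (Z x) * D x)%:E)%E.
  have gE y : g n y = \sum_(r \in range (g n)) r * \1_(g n @^-1` [set r]) y.
    exact: fimfunE.
  under eq_integral do rewrite gE -fsumEFin//.
  rewrite ge0_integral_fsum//; first last.
  - by move=> r y _; rewrite EFinM nnfun_muleindic_ge0.
  - by move=> r; apply/measurable_EFinP; apply: measurable_funM => //; exact: measurable_indic.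
  have mgZ r : measurable_fun setT (fun x => \1_(g n @^-1` [set r]) (Z x) : R).
    have mi : measurable_fun setT (\1_(g n @^-1` [set r]) : T2 -> R).
      exact: measurable_indic.
    exact: measurableT_comp mi mZ.
  have -> : (\int[mu]_x (g n (Z x) * D x)%:E =
     \int[mu]_x (\sum_(r \in range (g n)) (r * \1_(g n @^-1` [set r]) (Z x) * D x)%:E))%E.
    apply: eq_integral => x _; rewrite gE fsumEFin//.
    congr EFin; rewrite !fsbig_finite//= mulr_suml //.
  rewrite ge0_integral_fsum//; first last.
  - move=> r x _; rewrite EFinM mule_ge0 ?lee_fin//.
    by have := nnfun_muleindic_ge0 (g n) r (Z x); rewrite -EFinM lee_fin.
  - move=> r; apply/measurable_EFinP; apply: measurable_funM => //.
    exact: measurable_funM.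
  apply: eq_fsbigr => r; rewrite inE => -[y _ yr].
  have r0 : 0 <= r by rewrite -yr.
  under eq_integral do rewrite EFinM.
  rewrite ge0_integralZl_EFin//; last first.
    by apply/measurable_EFinP; exact: measurable_indic.
  under [in RHS]eq_integral do rewrite -mulrA EFinM.
  rewrite ge0_integralZl_EFin//; first last.
  - by apply/measurable_EFinP/measurable_funM.
  - by move=> *; rewrite lee_fin mulr_ge0// indicE.
  by rewrite indic_case.
have L : ((\int[m]_y (g n y)%:E)%E @[n --> \oo] --> (\int[m]_y (f y)%:E)%E).
  have -> : (\int[m]_y (f y)%:E = \int[m]_y limn (fun n => (g n y)%:E))%E.
    by apply: eq_integral => y _; rewrite (cvg_lim _ (gcvg y)).
  apply: cvg_monotone_convergence => //.
  - by move=> n; exact/measurable_EFinP.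
  - by move=> n y _; rewrite lee_fin.
have RR : ((\int[mu]_x (g n (Z x) * D x)%:E)%E @[n --> \oo] -->
     (\int[mu]_x (f (Z x) * D x)%:E)%E).
  have cv x : ((g n (Z x) * D x)%:E) @[n --> \oo] --> (f (Z x) * D x)%:E.
    under eq_fun do rewrite EFinM.
    by rewrite EFinM; apply: cvgeZr => //; exact: gcvg.
  have -> : (\int[mu]_x (f (Z x) * D x)%:E =
      \int[mu]_x limn (fun n => (g n (Z x) * D x)%:E))%E.
    by apply: eq_integral => x _; rewrite (cvg_lim _ (cv x)).
  apply: cvg_monotone_convergence => //.
  - move=> n; apply/measurable_EFinP/measurable_funM => //.
    exact: measurableT_comp.
  - by move=> n x _; rewrite lee_fin mulr_ge0.
  - move=> x _ n k nk; rewrite lee_fin ler_wpM2r//.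
    by have := gnd' (Z x) _ _ nk; rewrite lee_fin.
have E : (fun n => \int[m]_y (g n y)%:E)%E =
    (fun n => \int[mu]_x (g n (Z x) * D x)%:E)%E.
  by apply/funext => n; exact: simple.
by move: L; rewrite E => L; exact: (cvg_unique _ L RR).
Qed.

End transfer.

Section independence.
Context d (Omega : measurableType d) (R : realType) (P : probability Omega R).
Variables (n : nat) (X : 'I_n -> Omega -> R).
Hypothesis mX : forall i, measurable_fun setT (X i).
Hypothesis iX : mutually_independent P X.

Let mfX i (f : R -> R) : measurable_fun setT f ->
  measurable_fun setT (fun om => f (X i om)).
Proof. by move=> mf; exact: measurableT_comp. Qed.

(** The induction variable [k] counts the factors that need no longer be
    indicators. *)
Let product_rule (k : nat) := forall (f : 'I_n -> R -> R) (e : 'I_n -> R),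
  (forall i, measurable_fun setT (f i)) -> (forall i x, 0 <= f i x) ->
  (forall i, (\int[P]_om (f i (X i om))%:E = (e i)%:E)%E) ->
  (forall i : 'I_n, (k <= i)%N -> exists2 B, measurable B & f i = \1_B) ->
  (\int[P]_om (\prod_i f i (X i om))%:E = (\prod_i e i)%:E)%E.

Let product_rule0 : product_rule 0.
Proof.
move=> f e mf f0 fe fB.
have /choice[B BP] : forall i, exists B, measurable B /\ f i = \1_B.
  by move=> i; have [B mB fB'] := fB i isT; exists B.
have eE i : (e i)%:E = P (X i @^-1` B i).
  rewrite -fe (BP i).2.
  have -> : (fun om => (\1_(B i) (X i om))%:E) = (fun om => (\1_(X i @^-1` B i) om)%:E :> \bar R).
    by [].
  rewrite integral_indic// ?setIT//.
  by rewrite -[X in measurable X]setTI; apply: mX => //; exact: (BP i).1.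
have -> : ((\prod_i e i)%:E = \prod_i P (X i @^-1` B i))%E.
  by rewrite -prodEFin; apply: eq_bigr => i _; rewrite eE.
rewrite -iX; last by move=> i; exact: (BP i).1.
have -> : (fun om => (\prod_i f i (X i om))%:E) =
   (fun om => (\1_(\bigcap_(i in [set: 'I_n]) (X i @^-1` B i)) om)%:E :> \bar R).
  apply/funext => om; rewrite indicE; congr EFin.
  have [H|H] := pselect (forall i, B i (X i om)).
    rewrite mem_set; last by move=> i _; exact: H.
    by rewrite big1// => i _; rewrite (BP i).2 indicE mem_set.
  move/existsNP : H => [i Bi].
  rewrite memNset; last by move=> /(_ i I).
  by rewrite (bigD1 i)//= (BP i).2 indicE memNset// mul0r.
rewrite integral_indic// ?setIT//.
apply: fin_bigcap_measurable => // i _.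
by rewrite -[X in measurable X]setTI; apply: mX => //; exact: (BP i).1.
Qed.

Let product_ruleS k : product_rule k -> product_rule k.+1.
Proof.
move=> IH f e mf f0 fe fB.
have [kn|nk] := ltnP k n; last first.
  by apply: IH => // i ki; have := leq_trans nk ki; rewrite leqNgt ltn_ord.
pose i0 := Ordinal kn.
pose G om := \prod_(i | i != i0) f i (X i om).
have mG : measurable_fun setT G.
  have -> : G = fun om => \prod_(i <- [seq i <- index_enum 'I_n | i != i0]) f i (X i om).
    by apply/funext => om; rewrite /G big_filter.
  by apply: measurable_prod => i _; exact: mfX.
have G0 om : 0 <= G om by exact: prodr_ge0.
have e0 i : 0 <= e i by rewrite -lee_fin -fe integral_ge0// => om _; rewrite lee_fin.
pose c := \prod_(i | i != i0) e i.
have c0 : 0 <= c by exact: prodr_ge0.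
have split_i0 (h : 'I_n -> R) : \prod_i h i = h i0 * \prod_(i | i != i0) h i.
  by rewrite (bigD1 i0).
pose mXp : {mfun Omega >-> R} :=
  HB.pack (X i0) (isMeasurableFun.Build _ _ _ _ _ (mX i0)).
pose m := mscale (NngNum c0) (distribution P mXp).
have mE (A : set R) : measurable A ->
    (m A = \int[P]_(x in X i0 @^-1` A) (G x)%:E)%E.
  move=> mA; have mXA : measurable (X i0 @^-1` A).
    by rewrite -[Y in measurable Y]setTI; exact: mX.
  pose f' i := if i == i0 then \1_A else f i : R -> R.
  pose e' i := if i == i0 then fine (P (X i0 @^-1` A)) else e i.
  have := IH f' e'.
  have -> : (fun om => (\prod_i f' i (X i om))%:E) =
      (fun om => (G om * \1_(X i0 @^-1` A) om)%:E).
    apply/funext => om; rewrite split_i0 mulrC /f' eqxx; congr (_ * _)%:E.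
    by apply: eq_bigr => i /negbTE ->.
  move=> H; rewrite integral_mkcond.
  have -> : ((fun x => (G x)%:E) \_ (X i0 @^-1` A)) =
      (fun om => (G om * \1_(X i0 @^-1` A) om)%:E).
    apply/funext => om; rewrite patchE indicE.
    by case: ifPn => _; rewrite ?mulr1 ?mulr0.
  rewrite H; first last.
  - move=> i; rewrite leq_eqVlt => /predU1P[ki|ki].
      have -> : i = i0 by apply/val_inj; rewrite /= -ki.
      by rewrite /f' eqxx; exists A.
    have /negbTE ii0 : i != i0 by apply/eqP => ii0; move: ki; rewrite ii0 ltnn.
    by rewrite /f' ii0; exact: fB.
  - move=> i; rewrite /f' /e'; case: ifPn => // /eqP ->.
    have -> : (fun om => (\1_A (X i0 om))%:E) = (fun om => (\1_(X i0 @^-1` A) om)%:E :> \bar R).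
      by [].
    by rewrite integral_indic// setIT fineK// fin_num_measure.
  - by move=> i x; rewrite /f'; case: ifPn => // _; rewrite indicE.
  - by move=> i; rewrite /f'; case: ifPn => // _; exact: measurable_indic.
  rewrite split_i0 /e' eqxx mulrC EFinM fineK ?fin_num_measure//.
  by congr (_%:E * _)%E; apply: eq_bigr => i /negbTE ->.
have := @ge0_integral_density _ _ _ _ R P m (X i0) G (mX i0) mG G0 mE (f i0) (mf i0) (f0 i0).
rewrite ge0_integral_mscale//=; last 2 first.
- by apply/measurable_EFinP; exact: mf.
- by move=> x _; rewrite lee_fin.
rewrite ge0_integral_distribution//; last 2 first.
- by apply/measurable_EFinP; exact: mf.
- by move=> x; rewrite lee_fin.
rewrite /comp/= fe => H.
under eq_integral do rewrite split_i0.
by rewrite -H split_i0 mulrC EFinM.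
Qed.

(** Independence extends from events to nonnegative functions, one factor at a
    time: when the indicator of the [k]-th variable varies, both sides are
    measures of the corresponding set. *)
Lemma ge0_expectation_prod (f : 'I_n -> R -> R) (e : 'I_n -> R) :
  (forall i, measurable_fun setT (f i)) -> (forall i x, 0 <= f i x) ->
  (forall i, (\int[P]_om (f i (X i om))%:E = (e i)%:E)%E) ->
  (\int[P]_om (\prod_i f i (X i om))%:E = (\prod_i e i)%:E)%E.
Proof.
move=> mf f0 fe.
have H : forall k, product_rule k by elim=> [|k]; [exact: product_rule0|exact: product_ruleS].
by apply: (H n) => // i; rewrite leqNgt ltn_ord.
Qed.

End independence.

(** * Approximation by functions of finitely many coordinates *)

Section approximation.
Context d (T : measurableType d) (R : realType) (I : eqType).
Variables (pi : I -> T -> R) (mu : {finite_measure set T -> \bar R}).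
Hypothesis mpi : forall i, measurable_fun setT (pi i).
Hypothesis gen_pi : forall A : set T, measurable A ->
  <<s \bigcup_i [set pi i @^-1` B | B in measurable] >> A.

(** The quantifiers make [F] depend on the coordinates in [s] only. *)
Definition cylinder_ucont (F : T -> R) := exists s : seq I,
  forall delta : R, 0 < delta -> exists2 eta : R, 0 < eta & forall x y,
    (forall i, i \in s -> `|pi i x - pi i y| < eta) -> `|F x - F y| < delta.

Definition cylinder_fun (F : T -> R) :=
  [/\ measurable_fun setT F, forall x, 0 <= F x <= 1 & cylinder_ucont F].

Let approximable (h : T -> R) := forall delta : R, 0 < delta ->
  exists2 F, cylinder_fun F & (\int[mu]_x (`|h x - F x|)%:E <= delta%:E)%E.

Let unit_fun (h : T -> R) :=
  measurable_fun setT h /\ forall x, 0 <= h x <= 1.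

Let unit_fun_cyl F : cylinder_fun F -> unit_fun F.
Proof. by case. Qed.

Let mL1 (h F : T -> R) : measurable_fun setT h -> measurable_fun setT F ->
  measurable_fun setT (fun x => (`|h x - F x|)%:E).
Proof.
move=> mh mF; apply/measurable_EFinP; apply: measurableT_comp => //.
exact: measurable_funB.
Qed.

Let L1_le (h F a b a' b' : T -> R) (c u v : R) :
  measurable_fun setT h -> measurable_fun setT F ->
  measurable_fun setT a -> measurable_fun setT b ->
  measurable_fun setT a' -> measurable_fun setT b' -> 0 <= c ->
  (forall x, `|h x - F x| <= c * (`|a x - b x| + `|a' x - b' x|)) ->
  (\int[mu]_x (`|a x - b x|)%:E <= u%:E)%E ->
  (\int[mu]_x (`|a' x - b' x|)%:E <= v%:E)%E ->
  (\int[mu]_x (`|h x - F x|)%:E <= (c * (u + v))%:E)%E.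
Proof.
move=> mh mF ma mb ma' mb' c0 H Hu Hv.
apply: (@le_trans _ _ (\int[mu]_x (c%:E * ((`|a x - b x|)%:E + (`|a' x - b' x|)%:E)))%E).
  apply: ge0_le_integral => //.
  - exact: mL1.
  - by apply: emeasurable_funM => //; apply: emeasurable_funD; exact: mL1.
  - by move=> x _; rewrite -EFinD -EFinM lee_fin.
rewrite ge0_integralZl_EFin//; try by [move=> x _; rewrite adde_ge0|apply: emeasurable_funD; exact: mL1].
rewrite ge0_integralD//; try exact: mL1.
by rewrite EFinM EFinD lee_wpmul2l// leeD.
Qed.

Let cyl_cst0 : cylinder_fun (cst 0).
Proof.
split => //; first by move=> x; rewrite lexx ler01.
exists [::] => delta d0; exists 1 => // x y _.
by rewrite subrr normr0.
Qed.

Let cyl_compl F : cylinder_fun F -> cylinder_fun (fun x => 1 - F x).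
Proof.
move=> [mF F01 [s Hs]]; split.
- exact: measurable_funB.
- by move=> x; have := F01 x; lra.
- exists s => delta /Hs[eta e0 H]; exists eta => // x y /H.
  by rewrite -[in X in _ -> X]normrN; congr (`|_| < _); ring.
Qed.

(** The common pattern of the product and of the mean of two such functions. *)
Let cyl_op2 (op : R -> R -> R) F G :
  measurable_fun setT (fun x => op (F x) (G x)) ->
  (forall a b, 0 <= a <= 1 -> 0 <= b <= 1 -> 0 <= op a b <= 1) ->
  (forall a b a' b', 0 <= a <= 1 -> 0 <= b <= 1 -> 0 <= a' <= 1 -> 0 <= b' <= 1 ->
    `|op a b - op a' b'| <= `|a - a'| + `|b - b'|) ->
  cylinder_fun F -> cylinder_fun G -> cylinder_fun (fun x => op (F x) (G x)).
Proof.
move=> mop op01 opl [mF F01 [s Hs]] [mG G01 [t Ht]]; split => //.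
  by move=> x; exact: op01.
exists (s ++ t) => delta d0.
have d20 : 0 < delta / 2 by rewrite divr_gt0.
have [e1 e10 H1] := Hs _ d20; have [e2 e20 H2] := Ht _ d20.
exists (Num.min e1 e2); first by rewrite lt_min e10.
move=> x y H.
have lF : `|F x - F y| < delta / 2.
  apply: H1 => i si; have := H i; rewrite mem_cat si/= => /(_ isT).
  by rewrite lt_min => /andP[].
have lG : `|G x - G y| < delta / 2.
  apply: H2 => i si; have := H i; rewrite mem_cat si orbT/= => /(_ isT).
  by rewrite lt_min => /andP[].
apply: le_lt_trans (opl _ _ _ _ _ _ _ _) _ => //.
by rewrite [delta]splitr ltrD.
Qed.

Let mul_lip (a b a' b' : R) : 0 <= a <= 1 -> 0 <= b <= 1 -> 0 <= a' <= 1 ->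
  0 <= b' <= 1 -> `|a * b - a' * b'| <= `|a - a'| + `|b - b'|.
Proof.
move=> /andP[a0 a1] /andP[b0 b1] /andP[a'0 a'1] /andP[b'0 b'1].
have -> : a * b - a' * b' = (a - a') * b + a' * (b - b') by ring.
apply: le_trans (ler_normD _ _) _; rewrite !normrM.
by rewrite lerD// ?ler_piMr// ?ler_piMl// ger0_norm.
Qed.

Let cyl_mul F G : cylinder_fun F -> cylinder_fun G ->
  cylinder_fun (fun x => F x * G x).
Proof.
move=> cF cG; apply: (@cyl_op2 *%R) => //.
- by case: cF cG => [mF _ _] [mG _ _]; exact: measurable_funM.
- by move=> a b /andP[a0 a1] /andP[b0 b1]; rewrite mulr_ge0//= mulr_ile1.
Qed.

Let cyl_half F G : cylinder_fun F -> cylinder_fun G ->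
  cylinder_fun (fun x => (F x + G x) / 2).
Proof.
move=> cF cG; apply: (@cyl_op2 (fun a b => (a + b) / 2)) => //.
- case: cF cG => [mF _ _] [mG _ _].
  by apply: measurable_funM => //; exact: measurable_funD.
- by move=> a b; lra.
- move=> a b a' b' _ _ _ _.
  have -> : (a + b) / 2 - (a' + b') / 2 = ((a - a') + (b - b')) / 2 by lra.
  rewrite normrM (ger0_norm (_ : 0 <= 2^-1))//.
  apply: le_trans (_ : `|a - a' + (b - b')| <= _); last exact: ler_normD.
  by rewrite ler_piMr// invf_le1// ler1n.
Qed.

Let approx_cyl F : cylinder_fun F -> approximable F.
Proof.
move=> cF delta d0; exists F => //.
under eq_integral do rewrite subrr normr0.
by rewrite integral0 lee_fin ltW.
Qed.

Let approx_compl h : approximable h -> approximable (fun x => 1 - h x).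
Proof.
move=> ah delta /ah[F cF HF]; exists (fun x => 1 - F x); first exact: cyl_compl.
under eq_integral => x _.
  have -> : 1 - h x - (1 - F x) = - (h x - F x) by ring.
  rewrite normrN; over.
by [].
Qed.

Let approx_mul h k : unit_fun h -> unit_fun k ->
  approximable h -> approximable k -> approximable (fun x => h x * k x).
Proof.
move=> [mh h01] [mk k01] ah ak delta d0.
have d20 : 0 < delta / 2 by rewrite divr_gt0.
have [F cF HF] := ah _ d20; have [G cG HG] := ak _ d20.
exists (fun x => F x * G x); first exact: cyl_mul.
case: (cF) (cG) => [mF F01 _] [mG G01 _].
have -> : delta = 1 * (delta / 2 + delta / 2) by field.
apply: (@L1_le _ _ h F k G) => //; [exact: measurable_funM..|].
by move=> x; rewrite mul1r; exact: mul_lip.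
Qed.

Let approx_lim (h_ : nat -> T -> R) h : (forall n, unit_fun (h_ n)) -> unit_fun h ->
  (forall x, h_ n x @[n --> \oo] --> h x) ->
  (forall n, approximable (h_ n)) -> approximable h.
Proof.
move=> uh_ [mh h01] cv ah_ delta d0.
have d20 : 0 < delta / 2 by rewrite divr_gt0.
have [] := @dominated_convergence _ _ _ mu setT measurableT
  (fun n x => (h_ n x)%:E) (fun x => (h x)%:E) (cst 1%E).
- by move=> n; apply/measurable_EFinP; exact: (uh_ n).1.
- exact/measurable_EFinP.
- apply: aeW => x _; apply: cvg_EFin; first exact: nearW.
  exact: cv.
- exact: (finite_measure_integrable_cst mu 1 measurableT).
- apply: aeW => x n _; rewrite lee_fin.
  by have /andP[a b] := (uh_ n).2 x; rewrite ger0_norm.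
move=> _ L _.
have [n Hn] : exists n, (\int[mu]_x (`|h x - h_ n x|)%:E <= (delta / 2)%:E)%E.
  have : \forall n \near \oo, (\int[mu]_x `|(h_ n x)%:E - (h x)%:E| < (delta / 2)%:E)%E.
    have : nbhs (0%E : \bar R) [set x | (x < (delta / 2)%:E)%E].
      by apply: open_nbhs_nbhs; split; [exact: open_ereal_lt_ereal|rewrite /= lte_fin].
    by move=> /L.
  case => n _ /(_ n (leqnn _)) Hn; exists n.
  apply: le_trans (ltW Hn); rewrite le_eqVlt; apply/orP; left; apply/eqP.
  by apply: eq_integral => x _; rewrite -EFinB/= distrC.
have [F cF HF] := ah_ n _ d20.
exists F => //; case: (cF) => mF F01 _.
have -> : delta = 1 * (delta / 2 + delta / 2) by field.
apply: (@L1_le _ _ h (h_ n) (h_ n) F) => //; [exact: (uh_ n).1..|].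
by move=> x; rewrite mul1r; exact: ler_distD.
Qed.

(** Steeper and steeper clipped ramps of a coordinate converge to the
    indicators of open rays, which generate the Borel sets. *)
Let clip (u : R) := Num.max 0 (Num.min 1 u).

Let clipP u : [\/ u <= 0 /\ clip u = 0, 0 <= u <= 1 /\ clip u = u |
  1 <= u /\ clip u = 1].
Proof.
rewrite /clip; have [u1|u1] := leP 1 u; first by apply: Or33; rewrite max_r.
have [u0|u0] := leP u 0; first by apply: Or31; split.
by apply: Or32; rewrite !ltW.
Qed.

Let clip01 u : 0 <= clip u <= 1.
Proof. by case: (clipP u) => -[] ? ->; lra. Qed.

Let clip_lip u v : `|clip u - clip v| <= `|u - v|.
Proof.
rewrite ler_norml; have := ler_norm (u - v); have := ler_norm (v - u).
by rewrite (distrC v u); case: (clipP u) => -[] ? ->; case: (clipP v) => -[] ? ->; lra.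
Qed.

Let cyl_ramp (i : I) (a : R) n : cylinder_fun (fun x => clip (n%:R * (pi i x - a))).
Proof.
split.
- apply: measurable_maxr => //; apply: measurable_minr => //.
  by apply: measurable_funM => //; exact: measurable_funB.
- by move=> x; exact: clip01.
- exists [:: i] => delta d0; exists (delta / n.+1%:R); first by rewrite divr_gt0.
  move=> x y /(_ i); rewrite inE eqxx => /(_ isT) H.
  apply: le_lt_trans (clip_lip _ _) _.
  rewrite -mulrBr (_ : pi i x - a - (pi i y - a) = pi i x - pi i y); last by ring.
  rewrite normrM ger0_norm//; rewrite ltr_pdivlMr// mulrC in H.
  by apply: le_lt_trans H; rewrite ler_wpM2r// ler_nat.
Qed.

Let approx_ray i (a : R) : approximable \1_(pi i @^-1` `]a, +oo[).
Proof.
apply: (@approx_lim (fun n x => clip (n%:R * (pi i x - a)))).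
- by move=> n; exact/unit_fun_cyl/cyl_ramp.
- split; last by move=> x; rewrite indicE; case: (_ \in _); rewrite ?lexx ?ler01.
  apply: measurable_indic; rewrite -[X in measurable X]setTI; exact: mpi.
- move=> x; rewrite indicE.
  have [ax|xa] := ltP a (pi i x); last first.
    rewrite memNset; last by rewrite /= in_itv/= andbT; apply/negP; rewrite -leNgt.
    apply: cvg_near_cst; apply: nearW => n.
    have : n%:R * (pi i x - a) <= 0 by rewrite mulr_ge0_le0// subr_le0.
    by case: (clipP (n%:R * (pi i x - a))) => -[] ? ->; rewrite /=; lra.
  rewrite mem_set; last by rewrite /= in_itv/= andbT.
  apply: cvg_near_cst; near=> n; rewrite /clip min_l ?max_r//.
  have pa : 0 < pi i x - a by rewrite subr_gt0.
  rewrite -ler_pdivrMr// mul1r; near: n; exact: nbhs_infty_ger.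
- by move=> n; exact/approx_cyl/cyl_ramp.
Unshelve. all: by end_near. Qed.

Let approx_setC (A : set T) : approximable \1_A -> approximable \1_(~` A).
Proof.
move=> /approx_compl; congr approximable.
apply/funext => x; rewrite !indicE in_setC.
by case: (x \in A); rewrite ?subrr ?subr0.
Qed.

Let approx_bigcup (A : (set T)^nat) : (forall k, measurable (A k)) ->
  (forall k, approximable \1_(A k)) -> approximable \1_(\bigcup_k A k).
Proof.
move=> mA aA.
pose h n x : R := \prod_(k < n) (1 - \1_(A k) x).
have uC k : unit_fun (fun x => 1 - \1_(A k) x).
  split; first by apply: measurable_funB => //; exact: measurable_indic.
  by move=> x; rewrite indicE; case: (_ \in _); rewrite ?subrr ?subr0 ?lexx ?ler01.
have h_rec n : h n.+1 = (fun x => h n x * (1 - \1_(A n) x)).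
  by apply/funext => x; rewrite /h big_ord_recr.
have uh n : unit_fun (h n).
  split; first by apply: measurable_prod => i _; exact: (uC _).1.
  move=> x; elim: n => [|n /andP[h0 h1]]; first by rewrite /h big_ord0 ler01 lexx.
  by rewrite h_rec; have /andP[c0 c1] := (uC n).2 x; rewrite mulr_ge0//= mulr_ile1.
have ah n : approximable (h n).
  elim: n => [|n IH].
    have -> : h 0 = (fun x => 1 - cst 0 x).
      by apply/funext => x; rewrite /h big_ord0/= subr0.
    exact/approx_cyl/cyl_compl/cyl_cst0.
  by rewrite h_rec; apply: approx_mul => //; exact: approx_compl.
apply: (@approx_lim (fun n x => 1 - h n x)).
- move=> n; split; first by apply: measurable_funB => //; exact: (uh n).1.
  by move=> x; have := (uh n).2 x; lra.
- split; last by move=> x; rewrite indicE; case: (_ \in _); rewrite ?lexx ?ler01.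
  by apply: measurable_indic; exact: bigcup_measurable.
- move=> x; rewrite indicE.
  have [[k _ Akx]|nA] := pselect ((\bigcup_k A k) x).
    rewrite mem_set; last by exists k.
    apply: cvg_near_cst; exists k.+1 => // n /= kn.
    rewrite /h (bigD1 (Ordinal kn))//= indicE mem_set// subrr mul0r.
    by rewrite subr0.
  rewrite memNset//; apply: cvg_near_cst; apply: nearW => n.
  rewrite /h big1 ?subrr// => i _; rewrite indicE memNset ?subr0// => Ai.
  by apply: nA; exists i.
- by move=> n; exact: approx_compl.
Qed.

Let approx_measurable (A : set T) : measurable A -> approximable \1_A.
Proof.
move=> mA; suff : [set A | measurable A /\ approximable \1_A] A by case.
have S0 : approximable \1_set0.
  rewrite (_ : \1_set0 = cst 0 :> (T -> R)); first exact/approx_cyl/cyl_cst0.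
  by apply/funext => x; rewrite indicE in_set0.
have sigA : sigma_algebra setT [set A | measurable A /\ approximable \1_A].
  split.
  - by split.
  - move=> B [mB aB]; rewrite setTD; split; first exact: measurableC.
    exact: approx_setC.
  - move=> F HF; split; first by apply: bigcup_measurable => k _; exact: (HF k).1.
    by apply: approx_bigcup => k; [exact: (HF k).1|exact: (HF k).2].
apply: (smallest_sub sigA _ (gen_pi mA)) => B [i _ [C mC <-]].
suff : [set C | measurable C /\ approximable \1_(pi i @^-1` C)] C.
  case=> _ aC; split => //.
  by rewrite -[X in measurable X]setTI; exact: mpi.
have sigB : sigma_algebra setT [set C | measurable C /\ approximable \1_(pi i @^-1` C)].
  split.
  - by split => //; rewrite preimage_set0.
  - move=> D [mD aD]; rewrite setTD; split; first exact: measurableC.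
    rewrite preimage_setC; exact: approx_setC.
  - move=> F HF; split; first by apply: bigcup_measurable => k _; exact: (HF k).1.
    rewrite preimage_bigcup; apply: approx_bigcup => k; last exact: (HF k).2.
    by rewrite -[X in measurable X]setTI; apply: mpi => //; exact: (HF k).1.
have mC' : (@RGenOInfty.G R).-sigma.-measurable C.
  by rewrite -RGenOInfty.measurableE; exact: mC.
apply: (smallest_sub sigB _ mC') => D [a ->]; split; first exact: measurable_itv.
exact: approx_ray.
Qed.

(** Up to a small error in mean, a measurable function with values in the unit interval
    depends on finitely many coordinates only, and does so uniformly
    continuously.  The sets whose indicators can be so approximated form a
    sigma-algebra; functions follow by binary digits, [h = (1_A + h') / 2] with
    [A = {h >= 1/2}]. *)
Lemma approximation_by_cylinder_fun (h : T -> R) : measurable_fun setT h ->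
  (forall x, 0 <= h x <= 1) -> forall delta : R, 0 < delta ->
  exists2 F, cylinder_fun F & (\int[mu]_x (`|h x - F x|)%:E <= delta%:E)%E.
Proof.
move=> mh h01 delta d0.
have d20 : 0 < delta / 2 by rewrite divr_gt0.
pose M := fine (mu setT).
have muM : mu setT = M%:E by rewrite fineK// fin_num_measure.
have M0 : 0 <= M by rewrite fine_ge0.
suff H n : forall h, unit_fun h -> exists2 F, cylinder_fun F &
    (\int[mu]_x (`|h x - F x|)%:E <= (delta / 2 + 2^-1 ^+ n * M)%:E)%E.
  have [n Hn] : exists n, 2^-1 ^+ n * M <= delta / 2.
    have : (fun n => (2^-1 : R) ^+ n * M) @ \oo --> 0 * M.
      apply: cvgMl; apply: cvg_expr; rewrite ger0_norm// invf_lt1// ltr1n//.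
    rewrite mul0r => /cvgr_lt /(_ _ d20) [n _ /(_ n (leqnn _))] Hn.
    by exists n; exact: ltW.
  have [F cF HF] := H n h (conj mh h01).
  exists F => //; apply: le_trans HF _.
  by rewrite lee_fin [leRHS]splitr lerD2l.
elim: n => [|n IH] {mh h01}h [mh h01].
  exists (cst 0); first exact: cyl_cst0.
  apply: (@le_trans _ _ (\int[mu]_x (cst 1%:E x))%E).
    apply: ge0_le_integral => //; first exact: mL1.
    by move=> x _; rewrite lee_fin subr0; have /andP[a b] := h01 x; rewrite ger0_norm.
  rewrite integral_cst// mul1e [leLHS]muM lee_fin expr0 mul1r lerDr; exact: ltW.
pose A := [set x | 2^-1 <= h x].
have mA : measurable A.
  have := mh measurableT `[2^-1, +oo[%classic (measurable_itv _); rewrite setTI.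
  by congr measurable; apply/seteqP; split => x /=; rewrite in_itv/= andbT.
pose h' x := 2 * h x - \1_A x.
have uh' : unit_fun h'.
  split.
    by apply: measurable_funB; [exact: measurable_funM|exact: measurable_indic].
  move=> x; rewrite /h' indicE; have := h01 x.
  have [xA|xA] := pselect (A x); [rewrite mem_set//=|rewrite memNset//=].
    by move: xA; rewrite /A/=; lra.
  by move: xA => /negP; rewrite -ltNge; lra.
have [F' cF' HF'] := IH _ uh'.
have [FA cFA HFA] := approx_measurable mA d20.
exists (fun x => (FA x + F' x) / 2); first exact: cyl_half.
have -> : delta / 2 + 2^-1 ^+ n.+1 * M =
    2^-1 * (delta / 2 + (delta / 2 + 2^-1 ^+ n * M)) by rewrite exprS; lra.
have mIA : measurable_fun setT (\1_A : T -> R) by exact: measurable_indic.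
apply: (@L1_le _ _ \1_A FA h' F') => //.
- by have [] := cyl_half cFA cF'.
- by case: cFA.
- exact: uh'.1.
- by case: cF'.
- move=> x; rewrite (_ : h x - _ = 2^-1 * ((\1_A x - FA x) + (h' x - F' x))); last first.
    by rewrite /h'; lra.
  rewrite normrM ger0_norm// ler_wpM2l//; exact: ler_normD.
Qed.

End approximation.

(** * Translations of Gaussian vectors *)

Section gaussian.
Context (R : realType).
Local Notation leb := (@lebesgue_measure R).

Lemma normal_prob_shift (mu s : R) (B : set R) : s != 0 -> measurable B ->
  normal_prob 0 s ((fun x => x + mu) @^-1` B) = normal_prob mu s B.
Proof.
move=> s0 mB; rewrite /normal_prob.
have shift_leb (A : set R) : measurable A ->
    pushforward leb ((fun x => x + mu) : R -> measurableTypeR R) A = leb A.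
  move=> mA; apply/esym/lebesgue_measure_unique => //=.
    exact: measurable_funD.
  move=> mf _ [[a b]] _ <-; rewrite /pushforward.
  rewrite (_ : _ @^-1` _ = `]a - mu, b - mu]%classic); last first.
    by apply/seteqP; split => x /=; rewrite !in_itv/= ltrBlDr lerBrDr.
  by rewrite !lebesgue_measure_itv/= !lte_fin ltrD2r -!EFinB opprB addrA subrK.
have := @ge0_integral_density _ _ _ _ R leb leb (fun x => x + mu) (cst 1)
  (measurable_funD (@measurable_id _ _ _) (measurable_cst _)) (measurable_cst _)
  (fun=> ler01) _ (fun x => \1_B x * normal_pdf mu s x).
have mf : measurable_fun setT (fun x => \1_B x * normal_pdf mu s x).
  by apply: measurable_funM; [exact: measurable_indic|exact: measurable_normal_pdf].
move=> /(_ _ mf _) H.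
rewrite integral_mkcond [RHS]integral_mkcond.
transitivity (\int[leb]_x (\1_B (x + mu) * normal_pdf mu s (x + mu) * cst 1 x)%:E)%E.
  apply: eq_integral => x _; rewrite patchE indicE.
  rewrite (_ : normal_pdf mu s (x + mu) = normal_pdf 0 s x); last first.
    by rewrite !normal_pdfE// /normal_fun subr0 addrK.
  rewrite (_ : (x \in _) = (x + mu \in B)); last by apply/idP/idP; rewrite !inE.
  rewrite /cst mulr1.
  by case: ifPn => _; rewrite /= ?mul1r ?mul0r.
rewrite -H.
- apply: eq_integral => x _; rewrite patchE indicE.
  by case: ifPn => _; rewrite ?mul1r ?mul0r.
- move=> A mA; rewrite -[LHS]shift_leb// /pushforward.
  have -> : (fun x => (cst 1 x : R)%:E) = cst 1%E by [].
  rewrite integral_cst ?mul1e// -[X in measurable X]setTI.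
  exact: (measurable_funD (@measurable_id _ _ _) (measurable_cst _)).
- by move=> x; rewrite mulr_ge0 ?normal_pdf_ge0// indicE.
Qed.

Definition shift_density (s mu x : R) := expR (mu * x / s ^+ 2 - mu ^+ 2 / (s ^+ 2 *+ 2)).

Lemma shift_density_pdf (s mu x : R) : s != 0 ->
  shift_density s mu x * normal_pdf 0 s x = normal_pdf mu s x.
Proof.
move=> s0; rewrite !normal_pdfE// mulrCA; congr (_ * _).
by rewrite /normal_fun -expRD; congr expR; rewrite -(mulr_natr (s ^+ 2) 2); field.
Qed.

(** The square of a density is, up to a factor, the density of the double
    translation: this gives its second moment. *)
Lemma shift_density_sqr (s mu x : R) : s != 0 ->
  shift_density s mu x ^+ 2 = expR (mu ^+ 2 / s ^+ 2) * shift_density s (mu *+ 2) x.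
Proof.
move=> s0; rewrite /shift_density -expRM_natl -expRD; congr expR.
by rewrite -(mulr_natr (s ^+ 2) 2) -(mulr_natr mu 2); field.
Qed.

Context d (Omega : measurableType d) (P : probability Omega R).
Variables (X : Omega -> R) (s : R).
Hypotheses (mX : measurable_fun setT X) (s0 : s != 0).
Hypothesis lawX : forall B, measurable B -> P (X @^-1` B) = normal_prob 0 s B.

Lemma gaussian_expectation (f : R -> R) : measurable_fun setT f ->
  (forall x, 0 <= f x) ->
  (\int[P]_om (f (X om))%:E = \int[leb]_x (f x * normal_pdf 0 s x)%:E)%E.
Proof.
move=> mf f0.
have := @ge0_integral_density _ _ _ _ R leb (normal_prob 0 s) id (normal_pdf 0 s)
  (@measurable_id _ _ _) (measurable_normal_pdf _ _) (normal_pdf_ge0 _ _) _ f mf f0.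
move=> <-; last by move=> A mA; rewrite /normal_prob.
have := @ge0_integral_density _ _ _ _ R P (normal_prob 0 s) X (cst 1)
  mX (measurable_cst _) _ _ f mf f0.
move=> ->.
- by apply: eq_integral => x _; rewrite /= mulr1.
- by move=> x; exact: ler01.
- move=> A mA; have -> : (fun x : Omega => (cst 1 x : R)%:E) = cst 1%E by [].
  rewrite integral_cst//; last by rewrite -[Y in measurable Y]setTI; exact: mX.
  by rewrite mul1e; exact/esym/lawX.
Qed.

Lemma measurable_shift_density mu : measurable_fun setT (shift_density s mu).
Proof.
apply: measurableT_comp => //; apply: measurable_funB => //.
by apply: measurable_funM => //; exact: measurable_funM.
Qed.

Lemma expectation_shift_density mu : (\int[P]_om (shift_density s mu (X om))%:E = 1)%E.
Proof.
rewrite gaussian_expectation//; last 2 first.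
- exact: measurable_shift_density.
- by move=> x; exact: expR_ge0.
by under eq_integral do rewrite shift_density_pdf//; rewrite integral_normal_pdf.
Qed.

(** One-dimensional case, by completing the square in the Gaussian density. *)
Lemma gaussian_shift (mu : R) (B : set R) : measurable B ->
  (P ((fun om => (X om + mu)%R) @^-1` B) =
    \int[P]_om (\1_B (X om) * shift_density s mu (X om))%:E)%E.
Proof.
move=> mB.
rewrite -[LHS]/(P (X @^-1` ((fun x => x + mu) @^-1` B))) lawX; last first.
  by rewrite -[Y in measurable Y]setTI; apply: measurable_funD.
rewrite normal_prob_shift//.
rewrite (@gaussian_expectation (fun x => \1_B x * shift_density s mu x)); last 2 first.
- by apply: measurable_funM; [exact: measurable_indic|exact: measurable_shift_density].
- by move=> x; rewrite mulr_ge0 ?expR_ge0// indicE.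
rewrite /normal_prob integral_mkcond; apply: eq_integral => x _.
rewrite patchE indicE -mulrA shift_density_pdf//.
by case: ifPn => _; rewrite ?mul1r ?mul0r.
Qed.

Lemma gaussian_mgf (t : R) :
  (\int[P]_om (expR (t * X om))%:E = (expR (t ^+ 2 * s ^+ 2 / 2))%:E)%E.
Proof.
have -> : (fun om => (expR (t * X om))%:E) =
    (fun om => (expR (t ^+ 2 * s ^+ 2 / 2))%:E * (shift_density s (t * s ^+ 2) (X om))%:E)%E.
  apply/funext => om; rewrite -EFinM /shift_density -expRD; congr (expR _)%:E.
  by rewrite -(mulr_natr (s ^+ 2) 2); field.
rewrite ge0_integralZl_EFin//; try exact: expR_ge0.
- by rewrite expectation_shift_density mule1.
- by move=> om _; rewrite lee_fin expR_ge0.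
- apply/measurable_EFinP; apply: measurableT_comp mX; exact: measurable_shift_density.
Qed.

Lemma expectation_shift_density_sqr mu :
  (\int[P]_om (shift_density s mu (X om) ^+ 2)%:E = (expR (mu ^+ 2 / s ^+ 2))%:E)%E.
Proof.
under eq_integral do rewrite shift_density_sqr// EFinM.
rewrite ge0_integralZl_EFin//; try exact: expR_ge0.
- by rewrite expectation_shift_density mule1.
- by move=> om _; rewrite lee_fin expR_ge0.
- apply/measurable_EFinP; apply: measurableT_comp mX; exact: measurable_shift_density.
Qed.

End gaussian.

(** Only the product sigma-algebra matters on vectors, hence this presentation
    by measurable boxes. *)
Definition boxes (R : realType) (n : nat) : set (set ('I_n -> R)) :=
  [set A | exists2 B : 'I_n -> set R, (forall i, measurable (B i)) &
     A = [set v | forall i, B i (v i)]].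

Definition vec_space (R : realType) n := g_sigma_algebraType (@boxes R n).

Section cameron_martin.
Context (R : realType) d (Omega : measurableType d) (P : probability Omega R).
Variables (n : nat) (X : 'I_n -> Omega -> R) (s mu : 'I_n -> R).
Hypotheses (mX : forall i, measurable_fun setT (X i)) (s0 : forall i, s i != 0).
Hypothesis iX : mutually_independent P X.
Hypothesis lawX : forall i B, measurable B ->
  P (X i @^-1` B) = normal_prob 0 (s i) B.

Let V := vec_space R n.

Lemma measurable_vec (Y : 'I_n -> Omega -> R) : (forall i, measurable_fun setT (Y i)) ->
  measurable_fun setT (fun om => (fun i => Y i om) : V).
Proof.
move=> mY; apply: (@measurability _ _ Omega (g_sigma_algebraType (@boxes R n)) setT _ (@boxes R n)) => //.
move=> _ [_ [B mB ->] <-]; rewrite setTI.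
rewrite (_ : _ @^-1` _ = \bigcap_(i in [set: 'I_n]) (Y i @^-1` B i)); last first.
  by apply/seteqP; split => [om /= H i _|om H i]; [exact: H|exact: (H i I)].
apply: fin_bigcap_measurable => // i _.
by rewrite -[Z in measurable Z]setTI; exact: mY.
Qed.

Lemma measurable_coord i : measurable_fun setT (fun v : V => v i).
Proof.
move=> _ B mB; rewrite setTI; apply: sub_sigma_algebra.
exists (fun j => if j == i then B else setT).
  by move=> j; case: ifP.
apply/seteqP; split => v /=.
  by move=> Bv j; case: ifPn => // /eqP ->.
by move=> /(_ i); rewrite eqxx.
Qed.

Definition joint_density om := \prod_i shift_density (s i) (mu i) (X i om).

Let L := joint_density.

Let L0 om : 0 <= L om.
Proof. by apply: prodr_ge0 => i _; exact: expR_ge0. Qed.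

Let mL : measurable_fun setT L.
Proof.
apply: measurable_prod => i _; apply: measurableT_comp (mX i).
exact: measurable_shift_density.
Qed.

Let Z om : V := fun i => X i om.
Let Zmu om : V := fun i => X i om + mu i.

Let mZ : measurable_fun setT Z.
Proof. exact: measurable_vec. Qed.

Let mZmu : measurable_fun setT Zmu.
Proof.
by apply: (@measurable_vec (fun i om => X i om + mu i)) => i; exact: measurable_funD.
Qed.

Let ZmuM : {mfun Omega >-> V} :=
  HB.pack Zmu (isMeasurableFun.Build _ _ _ _ _ mZmu).

Let indicE_int (A : set V) :
  (\int[P]_(om in Z @^-1` A) (L om)%:E = \int[P]_om (\1_A (Z om) * L om)%:E)%E.
Proof.
rewrite integral_mkcond; apply: eq_integral => om _; rewrite patchE indicE.
have -> : (om \in Z @^-1` A) = (Z om \in A) by apply/idP/idP; rewrite !inE.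
by case: ifPn => _; rewrite /= ?mul1r ?mul0r.
Qed.

Let box_case (A : set V) : @boxes R n A ->
  distribution P ZmuM A = (\int[P]_(om in Z @^-1` A) (L om)%:E)%E.
Proof.
move=> [B mB ->]; rewrite indicE_int.
pose f i x : R := \1_(B i) x * shift_density (s i) (mu i) x.
have -> : (fun om => (\1_[set v : V | forall i, B i (v i)] (Z om) * L om)%:E) =
    (fun om => (\prod_i f i (X i om))%:E : \bar R).
  apply/funext => om; rewrite big_split/=; congr (_ * _)%:E; rewrite indicE.
  have [H|H] := pselect (forall i, B i (X i om)).
    by rewrite mem_set// big1// => i _; rewrite indicE mem_set//; exact: H.
  rewrite memNset//; move/existsNP : H => [i Bi].
  by rewrite (bigD1 i)//= indicE memNset// mul0r.
rewrite (ge0_expectation_prod mX iX (e := fun i => fine (P ((fun om => X i om + mu i)%R @^-1` B i)))).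
- have iY := @iX (fun i => (fun x => x + mu i) @^-1` B i).
  rewrite -prodEFin.
  under eq_bigr => i _.
    rewrite fineK; last first.
      apply: fin_num_measure; rewrite -[Y in measurable Y]setTI.
      by apply: measurable_funD.
    over.
  rewrite -iY; last first.
    by move=> i; rewrite -[Y in measurable Y]setTI; apply: measurable_funD.
  rewrite /distribution /pushforward; congr (P _).
  by apply/seteqP; split => [om H i _|om H i]; [exact: (H i)|exact: (H i I)].
- move=> i; apply: measurable_funM; first exact: measurable_indic.
  exact: measurable_shift_density.
- by move=> i x; rewrite mulr_ge0 ?expR_ge0// indicE.
- move=> i; rewrite fineK.
    by rewrite (gaussian_shift (mX i) (s0 i))// => C; exact: lawX.
  apply: fin_num_measure; rewrite -[Y in measurable Y]setTI.
  by apply: measurable_funD.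
Qed.

Let boxI : setI_closed (@boxes R n).
Proof.
move=> _ _ [B mB ->] [C mC ->]; exists (fun i => B i `&` C i).
  by move=> i; exact: measurableI.
apply/seteqP; split => [v [H K] i|v H]; first by split.
by split => i; have [] := H i.
Qed.

Let boxT : @boxes R n setT.
Proof. by exists (fun=> setT) => //; apply/seteqP; split. Qed.

Lemma expectation_joint_density : (\int[P]_om (L om)%:E = 1)%E.
Proof.
have := box_case boxT; rewrite preimage_setT => <-.
exact: (probability_setT (distribution P ZmuM)).
Qed.

(** Finite-dimensional Cameron-Martin formula: both sides are finite measures of
    [A], and on boxes independence reduces the equality to dimension one. *)
Lemma cameron_martin (A : set V) : measurable A ->
  distribution P ZmuM A = (\int[P]_(om in Z @^-1` A) (L om)%:E)%E.
Proof.
have mZA (B : set V) : measurable B -> measurable (Z @^-1` B).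
  by move=> mB; rewrite -[Y in measurable Y]setTI; exact: mZ.
have mLe B : measurable_fun B (fun om => (L om)%:E).
  by apply/measurable_EFinP/measurable_funTS.
apply: (@dynkin_induction _ V (@boxes R n)
  (fun A => distribution P ZmuM A = (\int[P]_(om in Z @^-1` A) (L om)%:E)%E)) => //.
- exact: box_case boxT.
- move=> B mB HB.
  have -> : (distribution P ZmuM (~` B) = 1 - distribution P ZmuM B)%E.
    exact: probability_setC.
  rewrite HB.
  have : (\int[P]_(om in Z @^-1` B `|` ~` (Z @^-1` B)) (L om)%:E = 1)%E.
    by rewrite setUv expectation_joint_density.
  rewrite ge0_integral_setU//; last 4 first.
  + exact: mZA.
  + by apply: measurableC; exact: mZA.
  + by move=> om _; rewrite lee_fin.
  + by apply/disj_setPS => om [].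
  move=> <-; rewrite addeC addeK// ?preimage_setC//.
  rewrite ge0_fin_numE; last by apply: integral_ge0 => om _; rewrite lee_fin.
  apply: (@le_lt_trans _ _ 1%E); last by rewrite ltry.
  rewrite -expectation_joint_density; apply: ge0_subset_integral => //.
  + exact: mZA.
  + by move=> om _; rewrite lee_fin.
- move=> F mF tF HF; rewrite measure_bigcup//= preimage_bigcup ge0_integral_bigcup//.
  + by rewrite eseries_mkcond; apply: eq_eseriesr => k _; rewrite in_setT; exact: HF.
  + by move=> k; exact: mZA.
  + by move=> om _; rewrite lee_fin.
  + by apply/trivIsetP => i j _ _ ij; rewrite -preimage_setI; move/trivIsetP : tF => ->//; rewrite preimage_set0.
Qed.

Lemma expectation_joint_density_sqr :
  (\int[P]_om (L om ^+ 2)%:E = (expR (\sum_i mu i ^+ 2 / s i ^+ 2))%:E)%E.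
Proof.
have -> : (fun om => (L om ^+ 2)%:E) =
    (fun om => (\prod_i (fun i x => shift_density (s i) (mu i) x ^+ 2) i (X i om))%:E : \bar R).
  by apply/funext => om; rewrite /L /joint_density -prodrXl.
have := ge0_expectation_prod mX iX (f := fun i x => shift_density (s i) (mu i) x ^+ 2)
  (e := fun i => expR (mu i ^+ 2 / s i ^+ 2)).
move=> ->.
- by rewrite expR_sum.
- by move=> i; apply: measurable_funX; exact: measurable_shift_density.
- by move=> i x; exact: sqr_ge0.
- by move=> i; apply: expectation_shift_density_sqr => // B; exact: lawX.
Qed.

(** The Cauchy-Schwarz bound on the integral of [G] against the density, in
    arithmetic-geometric form with a parameter [a]: being linear in [G], it
    passes to limits. *)
Lemma translation_domination (G : V -> R) (a : R) : measurable_fun setT G ->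
  (forall v, 0 <= G v <= 1) -> 0 < a ->
  (\int[P]_om (G (Zmu om))%:E <=
    (a / 2)%:E * \int[P]_om (G (Z om))%:E +
    (expR (\sum_i mu i ^+ 2 / s i ^+ 2) / (2 * a))%:E)%E.
Proof.
move=> mG G01 a0.
have G0 v : 0 <= G v by have /andP[] := G01 v.
have mZe (B : set V) : measurable B -> distribution P ZmuM B = (\int[P]_(om in Z @^-1` B) (L om)%:E)%E.
  exact: cameron_martin.
have := ge0_integral_density mZ mL L0 mZe mG G0.
rewrite ge0_integral_distribution//; last by apply/measurable_EFinP.
move=> H; rewrite /comp/= in H; rewrite H.
have mGZ : measurable_fun setT (fun om => G (Z om)) by exact: measurableT_comp mG mZ.
have -> : (expR (\sum_i mu i ^+ 2 / s i ^+ 2) / (2 * a))%:E =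
    ((2 * a)^-1%:E * \int[P]_om (L om ^+ 2)%:E)%E.
  by rewrite expectation_joint_density_sqr mulrC EFinM.
have mL2 : measurable_fun setT (fun om => (L om ^+ 2)%:E).
  by apply/measurable_EFinP; exact: measurable_funX.
have mGZe : measurable_fun setT (fun om => (G (Z om))%:E) by exact/measurable_EFinP.
have a20 : 0 <= a / 2 by rewrite divr_ge0// ltW.
have a20' : 0 <= (2 * a)^-1 by rewrite invr_ge0 mulr_ge0// ltW.
rewrite -ge0_integralZl_EFin// -?ge0_integralZl_EFin//; last 2 first.
- by move=> om _; rewrite lee_fin sqr_ge0.
- by move=> om _; rewrite lee_fin.
rewrite -ge0_integralD//; last 4 first.
- by move=> om _; rewrite -EFinM lee_fin mulr_ge0.
- by apply/measurable_EFinP/measurable_funM.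
- by move=> om _; rewrite -EFinM lee_fin mulr_ge0// sqr_ge0.
- by apply/measurable_EFinP/measurable_funM => //; exact: measurable_funX.
apply: ge0_le_integral => //.
- by move=> om _; rewrite lee_fin mulr_ge0.
- by apply/measurable_EFinP/measurable_funM.
- by apply: emeasurable_funD; apply: emeasurable_funM.
- move=> om _; rewrite -!EFinM -EFinD lee_fin.
  have /andP[g0 g1] := G01 (Z om).
  (* [2 G L <= a G^2 + L^2 / a] and [G^2 <= G] *)
  have h : 0 <= (a * G (Z om) - L om) ^+ 2 / (2 * a).
    by rewrite mulr_ge0// sqr_ge0.
  have e : (a * G (Z om) - L om) ^+ 2 / (2 * a) =
      a / 2 * (G (Z om) ^+ 2) + (2 * a)^-1 * L om ^+ 2 - G (Z om) * L om.
    by field; rewrite gt_eqF.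
  have g2 : a / 2 * (G (Z om) ^+ 2) <= a / 2 * G (Z om).
    by rewrite ler_wpM2l// expr2 ler_piMl.
  lra.
Qed.

End cameron_martin.

(** * Square-integrable functions and their primitives *)

Section square_integrable.
Context (R : realType).
Local Notation mu := (leb01 R).

Lemma leb01_setT : mu setT = 1%E.
Proof.
by rewrite /leb01 /mrestr setTI lebesgue_measure_itv/= lte_fin ltr01 oppr0 adde0.
Qed.

Definition square_integrable (f : R -> R) := measurable_fun setT f /\
  mu.-integrable setT (fun x => (f x ^+ 2)%:E).

Definition ip (f g : R -> R) : R := \int[mu]_x (f x * g x).

Lemma sqint_mul f g : square_integrable f -> square_integrable g ->
  mu.-integrable setT (fun x => (f x * g x)%:E).
Proof.
move=> [mf f2] [mg g2].
have i : mu.-integrable setT (fun x => (f x ^+ 2)%:E + (g x ^+ 2)%:E)%E.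
  exact: integrableD.
apply: (le_integrable measurableT _ _ i).
  by apply/measurable_EFinP; exact: measurable_funM.
move=> x _; rewrite -EFinD/= lee_fin normrM.
rewrite (ger0_norm (addr_ge0 (sqr_ge0 (f x)) (sqr_ge0 (g x)))).
rewrite -(real_normK (num_real (f x))) -(real_normK (num_real (g x))).
have := sqr_ge0 (`|f x| - `|g x|).
by have := mulr_ge0 (normr_ge0 (f x)) (normr_ge0 (g x)); nra.
Qed.

Lemma sqintD f g : square_integrable f -> square_integrable g ->
  square_integrable (fun x => f x + g x).
Proof.
move=> sf sg; split; first by apply: measurable_funD; [exact: sf.1|exact: sg.1].
have i : mu.-integrable setT (fun x => ((f x ^+ 2)%:E + (g x ^+ 2)%:E) + ((f x * g x)%:E + (f x * g x)%:E))%E.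
  apply: integrableD => //; first by apply: integrableD => //; [exact: sf.2|exact: sg.2].
  by apply: integrableD => //; exact: sqint_mul.
apply: eq_integrable i => // x _; rewrite -!EFinD; congr EFin; ring.
Qed.

Lemma sqintZ a f : square_integrable f -> square_integrable (fun x => a * f x).
Proof.
move=> sf; split; first by apply: measurable_funM => //; exact: sf.1.
have i : mu.-integrable setT (fun x => (a ^+ 2)%:E * (f x ^+ 2)%:E)%E.
  by apply: integrableZl => //; exact: sf.2.
by apply: eq_integrable i => // x _; rewrite -EFinM exprMn.
Qed.

Lemma sqintB f g : square_integrable f -> square_integrable g ->
  square_integrable (fun x => f x - g x).
Proof.
move=> sf sg; have := sqintD sf (sqintZ (-1) sg).
by congr square_integrable; apply/funext => x; rewrite mulN1r.
Qed.

Lemma leb01_integrable_cst (c : R) : mu.-integrable setT (fun=> c%:E).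
Proof.
apply/integrableP; split => //.
have -> : (fun x : R => `|c%:E|)%E = cst `|c|%:E by [].
by rewrite integral_cst//= [X in (_ * X)%E]leb01_setT mule1 ltry.
Qed.

Lemma sqint_bounded (f : R -> R) (M : R) : measurable_fun setT f -> (forall x, `|f x| <= M) ->
  square_integrable f.
Proof.
move=> mf fM; split => //.
apply: (le_integrable measurableT _ _ (leb01_integrable_cst (M ^+ 2))).
  by apply/measurable_EFinP; exact: measurable_funX.
move=> x _; rewrite /= lee_fin !normrX ler_pXn2r// ?nnegrE//.
exact: le_trans (fM x) (ler_norm M).
Qed.

Lemma sqint_sum (I : Type) (r : seq I) (P : pred I) (f : I -> R -> R) :
  (forall i, square_integrable (f i)) ->
  square_integrable (fun x => \sum_(i <- r | P i) f i x).
Proof.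
move=> sf; elim: r => [|i r IH].
  under eq_fun do rewrite big_nil.
  by apply: (@sqint_bounded _ 0) => // x; rewrite normr0.
under eq_fun do rewrite big_cons.
by case: (P i) => //; exact: sqintD.
Qed.

Lemma ipC f g : ip f g = ip g f.
Proof. by apply: eq_Rintegral => x _; rewrite mulrC. Qed.

Lemma ipDl f g h : square_integrable f -> square_integrable g -> square_integrable h ->
  ip (fun x => f x + g x) h = ip f h + ip g h.
Proof.
move=> sf sg sh; rewrite /ip -RintegralD//; [|exact: sqint_mul..].
by apply: eq_Rintegral => x _; rewrite mulrDl.
Qed.

Lemma ipZl a f h : square_integrable f -> square_integrable h ->
  ip (fun x => a * f x) h = a * ip f h.
Proof.
move=> sf sh; rewrite /ip -RintegralZl//; last exact: sqint_mul.
by apply: eq_Rintegral => x _; rewrite mulrA.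
Qed.

Lemma ipBl f g h : square_integrable f -> square_integrable g -> square_integrable h ->
  ip (fun x => f x - g x) h = ip f h - ip g h.
Proof.
move=> sf sg sh; rewrite -mulN1r -ipZl// -ipDl//; last exact: sqintZ.
by congr ip; apply/funext => x; rewrite mulN1r.
Qed.

Lemma ipDr f g h : square_integrable f -> square_integrable g -> square_integrable h ->
  ip h (fun x => f x + g x) = ip h f + ip h g.
Proof. by move=> *; rewrite ipC ipDl// ![ip h _]ipC. Qed.

Lemma ipZr a f h : square_integrable f -> square_integrable h ->
  ip h (fun x => a * f x) = a * ip h f.
Proof. by move=> *; rewrite ipC ipZl// [ip h _]ipC. Qed.

Lemma ipBr f g h : square_integrable f -> square_integrable g -> square_integrable h ->
  ip h (fun x => f x - g x) = ip h f - ip h g.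
Proof. by move=> *; rewrite ipC ipBl// ![ip h _]ipC. Qed.

Lemma ip_sumr (I : Type) (r : seq I) (P : pred I) (f : I -> R -> R) h :
  (forall i, square_integrable (f i)) -> square_integrable h ->
  ip h (fun x => \sum_(i <- r | P i) f i x) = \sum_(i <- r | P i) ip h (f i).
Proof.
move=> sf sh; elim: r => [|i r IH].
  rewrite big_nil (_ : (fun x => _) = fun=> 0); last by apply/funext => x; rewrite big_nil.
  rewrite /ip; under eq_Rintegral do rewrite mulr0.
  by rewrite Rintegral_cst// mul0r.
rewrite big_cons -IH; case: ifPn => Pi.
  rewrite -ipDr//; last exact: sqint_sum.
  by congr ip; apply/funext => x; rewrite big_cons Pi.
by congr ip; apply/funext => x; rewrite big_cons (negbTE Pi).
Qed.

Lemma ip_ge0 f : 0 <= ip f f.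
Proof. by apply: Rintegral_ge0 => x _; rewrite -expr2 sqr_ge0. Qed.

Lemma ip_sqrB f g : square_integrable f -> square_integrable g ->
  ip (fun x => f x - g x) (fun x => f x - g x) = ip f f - 2 * ip f g + ip g g.
Proof.
move=> sf sg; have sfg := sqintB sf sg.
by rewrite ipBl// !ipBr// (ipC g f); ring.
Qed.

Lemma ip_cauchy_schwarz f g : square_integrable f -> square_integrable g ->
  ip f g ^+ 2 <= ip f f * ip g g.
Proof.
move=> sf sg.
have H t : 0 <= ip f f - 2 * t * ip f g + t ^+ 2 * ip g g.
  have := ip_ge0 (fun x => f x - t * g x).
  have stg := sqintZ t sg.
  by rewrite ip_sqrB// ipZr// ipZl// ipZr//; congr (0 <= _); ring.
have := ip_ge0 g; rewrite le_eqVlt => /predU1P[g0|g0].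
  have [->|fg0] := eqVneq (ip f g) 0; first by rewrite expr0n/= -g0 mulr0.
  have := H ((ip f f + 1) / (2 * ip f g)); rewrite -g0 mulr0 addr0.
  have -> : 2 * ((ip f f + 1) / (2 * ip f g)) * ip f g = ip f f + 1 by field.
  by lra.
have := H (ip f g / ip g g).
have -> : ip f f - 2 * (ip f g / ip g g) * ip f g + (ip f g / ip g g) ^+ 2 * ip g g =
    ip f f - ip f g ^+ 2 / ip g g by field; rewrite gt_eqF.
by rewrite subr_ge0 ler_pdivrMr.
Qed.

Lemma ipE f g : square_integrable f -> square_integrable g ->
  (\int[mu]_x (f x * g x)%:E = (ip f g)%:E)%E.
Proof.
by move=> sf sg; rewrite /ip /Rintegral fineK//; apply: integrable_fin_num => //; exact: sqint_mul.
Qed.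

Lemma ip_sqrE f : square_integrable f -> (\int[mu]_x (f x ^+ 2)%:E = (ip f f)%:E)%E.
Proof. by move=> sf; rewrite -ipE. Qed.

Lemma ip_le_cst (f : R -> R) (c : R) : measurable_fun setT f ->
  (\int[mu]_x (f x ^+ 2)%:E <= c%:E)%E -> square_integrable f /\ ip f f <= c.
Proof.
move=> mf H; have sf : square_integrable f.
  split => //; apply/integrableP; split; first by apply/measurable_EFinP; exact: measurable_funX.
  under eq_integral => x _ do rewrite gee0_abs ?lee_fin ?sqr_ge0//.
  by apply: le_lt_trans H _; rewrite ltry.
by split => //; rewrite -lee_fin -ip_sqrE.
Qed.

(** Through these indicators the increments of a primitive become inner
    products. *)
Definition heav (t : R) : R -> R := \1_`]0, t[.

Definition primitive (f : R -> R) (t : R) := ip f (heav t).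

Lemma primitiveE f t : primitive f t = \int[mu]_(x in `]0, t[) f x.
Proof.
rewrite Rintegral_mkcond; apply: eq_Rintegral => x _.
by rewrite patchE /heav indicE; case: ifPn => _; rewrite /= ?mulr1 ?mulr0.
Qed.

Lemma sqint_indic (A : set R) : measurable A -> square_integrable (\1_A : R -> R).
Proof.
move=> mA; apply: (@sqint_bounded _ 1); first exact: measurable_indic.
by move=> x; rewrite indicE; case: (_ \in _); rewrite ?normr1 ?normr0.
Qed.

Lemma sqint_heav t : square_integrable (heav t).
Proof. exact: sqint_indic. Qed.

Lemma ip_heav s t : 0 <= s <= 1 -> 0 <= t <= 1 -> ip (heav s) (heav t) = Num.min s t.
Proof.
wlog st : s t / s <= t.
  move=> H s01 t01; have [st|/ltW ts] := leP s t; first by rewrite H// min_l.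
  by rewrite ipC H// min_l.
move=> /andP[s0 s1] /andP[t0 t1]; rewrite min_l//.
have -> : ip (heav s) (heav t) = \int[mu]_x heav s x.
  apply: eq_Rintegral => x _; rewrite /heav !indicE.
  have [xs|xs] := boolP (x \in `]0, s[%classic); last by rewrite mul0r.
  rewrite mem_set ?mulr1//; move: xs; rewrite inE /= !in_itv/= => /andP[-> xs].
  exact: lt_le_trans st.
rewrite /Rintegral integral_indic// setIT.
transitivity (fine (@lebesgue_measure R (`]0, s[ `&` `]0, 1[))) => //.
rewrite (_ : _ `&` _ = `]0, s[%classic); last first.
  apply/seteqP; split => x /=; rewrite !in_itv/=; first by case.
  by move=> /andP[x0 xs]; rewrite x0 xs (lt_le_trans xs).
rewrite lebesgue_measure_itv/= lte_fin.
by case: ifPn => [_|]; rewrite ?oppr0 ?adde0// -leNgt => s0'; apply/eqP; rewrite eq_le s0.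
Qed.

(** * Step functions *)

Section partition.
Variables (t : nat -> R) (n : nat).
Hypotheses (t0 : 0 <= t 0) (tn : t n <= 1) (tS : forall i, (i < n)%N -> t i < t i.+1).

Definition cell (i : nat) : R -> R := fun x => heav (t i.+1) x - heav (t i) x.

Lemma partition_le i j : (i <= j <= n)%N -> t i <= t j.
Proof.
move=> /andP[ij jn]; elim: j ij jn => [|j IH].
  by rewrite leqn0 => /eqP ->.
rewrite leq_eqVlt => /predU1P[-> //|ij] jn.
by apply: le_trans (ltW (tS jn)); apply: IH => //; exact: ltnW.
Qed.

Lemma partition01 i : (i <= n)%N -> 0 <= t i <= 1.
Proof.
move=> i_n; apply/andP; split; first by apply: le_trans t0 _; apply: partition_le.
by apply: le_trans tn; apply: partition_le; rewrite i_n leqnn.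
Qed.

Lemma sqint_cell i : square_integrable (cell i).
Proof. by apply: sqintB; exact: sqint_heav. Qed.

Lemma ip_cell f i : square_integrable f ->
  ip f (cell i) = primitive f (t i.+1) - primitive f (t i).
Proof. by move=> sf; rewrite /cell ipBr//; exact: sqint_heav. Qed.

Lemma primitive_cell i j : (i < n)%N -> (j <= n)%N ->
  primitive (cell i) (t j) = if (i < j)%N then t i.+1 - t i else 0.
Proof.
move=> i_n jn; rewrite /primitive /cell ipBl//; try exact: sqint_heav.
rewrite !ip_heav//; try exact: partition01; try exact/partition01/ltnW.
case: ifPn => ij.
  rewrite !min_l//; apply: partition_le; rewrite ?ij ?jn//.
  by rewrite (ltnW ij).
rewrite -leqNgt in ij.
rewrite !min_r ?subrr//; apply: partition_le; first by rewrite ij ltnW.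
by rewrite (leqW ij).
Qed.

Definition step (c : nat -> R) : R -> R := fun x => \sum_(i < n) c i * cell i x.

Lemma sqint_step c : square_integrable (step c).
Proof. by apply: sqint_sum => i; exact/sqintZ/sqint_cell. Qed.

Lemma ip_step f c : square_integrable f ->
  ip f (step c) = \sum_(i < n) c i * (primitive f (t i.+1) - primitive f (t i)).
Proof.
move=> sf; rewrite /step ip_sumr//; last by move=> i; exact/sqintZ/sqint_cell.
by apply: eq_bigr => i _; rewrite ipZr ?ip_cell//; exact: sqint_cell.
Qed.

Lemma primitive_step c j : (j <= n)%N ->
  primitive (step c) (t j) = \sum_(i < j) c i * (t i.+1 - t i).
Proof.
move=> jn; rewrite /primitive ipC /step ip_sumr; last 2 first.
- by move=> i; exact/sqintZ/sqint_cell.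
- exact: sqint_heav.
rewrite (eq_bigr (fun i : 'I_n => if (i < j)%N then c i * (t i.+1 - t i) else 0)).
  rewrite -big_mkcond/= (big_ord_widen_cond _ predT (fun i => c i * (t i.+1 - t i)) jn).
  by apply: eq_bigl.
move=> i _; rewrite ipZr//; [|exact: sqint_cell|exact: sqint_heav].
rewrite ipC -[ip _ _]/(primitive _ _) primitive_cell//.
by case: ifPn => // _; rewrite mulr0.
Qed.

Lemma ip_step_step c f : ip (step f) (step c) = \sum_(i < n) c i * f i * (t i.+1 - t i).
Proof.
rewrite ip_step; last exact: sqint_step.
apply: eq_bigr => i _; rewrite !primitive_step//; last exact: ltnW.
by rewrite big_ord_recr/= [X in X - _]addrC addrK mulrA.
Qed.

(** The coefficients of the orthogonal projection on step functions. *)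
Definition cell_mean f (i : nat) := (primitive f (t i.+1) - primitive f (t i)) / (t i.+1 - t i).

Lemma ip_sub_mean f c : square_integrable f ->
  ip (fun x => f x - step (cell_mean f) x) (step c) = 0.
Proof.
move=> sf; rewrite ipBl//; try exact: sqint_step.
rewrite ip_step// ip_step_step -sumrB big1// => i _.
rewrite -mulrA /cell_mean divfK ?subrr// gt_eqF// subr_gt0; exact: tS.
Qed.

Lemma sqr_sub_mean f : square_integrable f ->
  ip (fun x => f x - step (cell_mean f) x) (fun x => f x - step (cell_mean f) x) =
  ip f f - ip f (step (cell_mean f)).
Proof.
move=> sf; have ss := sqint_step (cell_mean f); have := ip_sub_mean (cell_mean f) sf.
rewrite ipBl// => /eqP; rewrite subr_eq0 => /eqP e.
by rewrite ip_sqrB// -e; ring.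
Qed.

Lemma bessel f : square_integrable f ->
  \sum_(i < n) (primitive f (t i.+1) - primitive f (t i)) ^+ 2 / (t i.+1 - t i) <= ip f f.
Proof.
move=> sf; rewrite -subr_ge0; have := ip_ge0 (fun x => f x - step (cell_mean f) x).
rewrite sqr_sub_mean// ip_step//; congr (_ <= _ - _).
by apply: eq_bigr => i _; rewrite /cell_mean; ring.
Qed.

Lemma mean_optimal f c : square_integrable f ->
  ip (fun x => f x - step (cell_mean f) x) (fun x => f x - step (cell_mean f) x) <=
  ip (fun x => f x - step c x) (fun x => f x - step c x).
Proof.
move=> sf; set m := cell_mean f.
have sm := sqint_step m; have sc := sqint_step c.
pose g x := f x - step m x; pose h x := step c x - step m x.
have sg : square_integrable g by exact: sqintB.
have sh : square_integrable h by exact: sqintB.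
have -> : (fun x => f x - step c x) = (fun x => g x - h x).
  by apply/funext => x; rewrite /g /h; ring.
have gh : ip g h = 0 by rewrite /h ipBr// !ip_sub_mean// subrr.
by rewrite [leRHS]ip_sqrB// gh mulr0 subr0 lerDl ip_ge0.
Qed.

End partition.

End square_integrable.

(** * Limits in parameters and fast convergence *)

HB.instance Definition _ (R : realType) := Measure.on (leb01 R).

Lemma leb01_fin (R : realType) : fin_num_fun (leb01 R).
Proof. by apply: lty_fin_num_fun; rewrite [ltLHS]leb01_setT ltry. Qed.
HB.instance Definition _ (R : realType) :=
  @Measure_isFinite.Build _ _ _ (leb01 R) (@leb01_fin R).

Section limits.
Context (R : realType).

(** A total limit operation that preserves measurability in a parameter, even
    if the sequences converge only almost everywhere. *)
Definition rlim (u : nat -> R) : R := fine (limn_esup (fun n => (u n)%:E)).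

Lemma rlim_cvg (u : nat -> R) (l : R) : u n @[n --> \oo] --> l -> rlim u = l.
Proof.
move=> ul; rewrite /rlim; have h : (fun n => (u n)%:E) @ \oo --> l%:E.
  by apply: cvg_EFin; [exact: nearW|exact: ul].
by have [_ ->] := cvg_limn_einf_sup h.
Qed.

Lemma measurable_rlim d (T : measurableType d) (f : nat -> T -> R) :
  (forall n, measurable_fun setT (f n)) -> measurable_fun setT (fun x => rlim (f ^~ x)).
Proof.
move=> mf; apply: measurableT_comp; first exact: fine_measurable.
by apply: measurable_fun_limn_esup => n; exact/measurable_EFinP.
Qed.

Lemma limn_einf_le_cst (u : nat -> \bar R) (c : \bar R) :
  (forall n, u n <= c)%E -> (limn_einf u <= c)%E.
Proof.
move=> uc; rewrite limn_einf_lim; apply: lime_le; first exact: is_cvg_einfs.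
apply: nearW => n; apply: le_trans (uc n).
by apply: ereal_inf_lbound; exists n => /=.
Qed.

Lemma limn_einf_ge0 (u : nat -> \bar R) : (forall n, 0 <= u n)%E -> (0 <= limn_einf u)%E.
Proof.
move=> u0; rewrite limn_einf_lim; apply: lime_ge; first exact: is_cvg_einfs.
by apply: nearW => n; apply/ereal_infP => _ [k _ <-].
Qed.

Lemma measurable_limn_einf d (T : measurableType d) (f : nat -> T -> \bar R) :
  (forall n, measurable_fun setT (f n)) -> measurable_fun setT (fun x => limn_einf (f ^~ x)).
Proof.
move=> mf; have -> : (fun x => limn_einf (f ^~ x)) =
    (fun x => - limn_esup (fun n => - f n x))%E.
  by apply/funext => x; rewrite -[in RHS]/(limn_esup (-%E \o (f ^~ x))) limn_esupN oppeK.
apply: measurableT_comp => //; apply: (measurable_fun_limn_esup (f := fun n x => - f n x)%E) => n.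
exact: measurableT_comp.
Qed.

Lemma abs_summable_series (u : nat -> R) (M : R) :
  (\sum_(0 <= k <oo) `|u k|%:E <= M%:E)%E ->
  cvgn (series u) /\ `|limn (series u)| <= M.
Proof.
move=> uM.
have part n : \sum_(0 <= k < n) `|u k| <= M.
  rewrite -lee_fin -sumEFin; apply: le_trans uM.
  by apply: nneseries_lim_ge => k _ _; rewrite lee_fin.
have cn : cvgn [normed series u].
  apply: nondecreasing_is_cvgn.
    by apply: nondecreasing_series => k _ _; exact: normr_ge0.
  by exists M => _ [n _ <-]; exact: part.
have cu : cvgn (series u) by exact: normed_cvg.
split => //.
have cun : (fun n => `|series u n|) @ \oo --> `|limn (series u)|.
  exact: cvg_norm cu.
rewrite -(cvg_lim _ cun)//; apply: limr_le; first by apply/cvg_ex; exists (`|limn (series u)|).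
by apply: nearW => n; apply: le_trans (part n); exact: ler_norm_sum.
Qed.

(** A bounded nondecreasing sequence is Cauchy; a subsequence has gaps below any
    prescribed positive bounds, for instance summable ones. *)
Lemma fast_subsequence (e : nat -> R) (A : R) (g : nat -> R) :
  {homo e : m n / (m <= n)%N >-> m <= n} -> (forall n, e n <= A) ->
  (forall k, 0 < g k) ->
  exists nk : nat -> nat, [/\ forall k, (k <= nk k)%N,
    {homo nk : k l / (k <= l)%N} & forall k m, (nk k <= m)%N -> e m - e (nk k) <= g k].
Proof.
move=> ne eA g0.
have ce : cvgn e by apply: nondecreasing_is_cvgn => //; exists A => _ [n _ <-].
have /choice[N HN] : forall k, exists N, forall n, (N <= n)%N -> limn e - g k < e n.
  move=> k; have : \forall n \near \oo, limn e - g k < e n.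
    by apply: (cvgr_gt _ ce); rewrite ltrBlDr ltrDl.
  by case=> N _ HN; exists N.
exists (fun k => \max_(j < k.+1) maxn (N j) j); split.
- move=> k; apply: leq_trans (leq_bigmax (ord_max : 'I_k.+1)).
  exact: leq_maxr.
- move=> k l kl; apply/bigmax_leqP => i _.
  have il : (i < l.+1)%N by apply: leq_trans (ltn_ord i) _.
  by apply: leq_trans (leq_bigmax (Ordinal il)).
- move=> k m km.
  have h1 := nondecreasing_cvgn_le ne ce m.
  have Nk : (N k <= \max_(j < k.+1) maxn (N j) j)%N.
    by apply: leq_trans (leq_bigmax (ord_max : 'I_k.+1)); exact: leq_maxl.
  have h2 := HN k _ Nk; lra.
Qed.

End limits.

Section summable.
Context (R : realType) d (T : measurableType d) (m : {measure set T -> \bar R}).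
Variables (Z : nat -> T -> R) (c : R).
Hypotheses (mZ : forall k, measurable_fun setT (Z k)) (c0 : 0 <= c).
Hypothesis Zc : forall k, (\int[m]_x `|Z k x|%:E <= (c / (2 ^ k.+1)%:R)%:E)%E.

Let V x := (\sum_(0 <= k <oo) `|Z k x|%:E)%E.

Let mZe k : measurable_fun setT (fun x => `|Z k x|%:E).
Proof. by apply/measurable_EFinP; exact: measurableT_comp. Qed.

Lemma measurable_abs_sum : measurable_fun setT V.
Proof. by apply: ge0_emeasurable_sum => // k _ _. Qed.

Lemma integral_abs_sum : (\int[m]_x V x <= c%:E)%E.
Proof.
rewrite integral_nneseries//.
apply: le_trans (epsilon_trick0 xpredT c0).
by apply: lee_nneseries => // k _ _; apply: integral_ge0 => x _; rewrite lee_fin.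
Qed.

Lemma abs_sum_ae_fin : {ae m, forall x, V x \is a fin_num}.
Proof.
have V0 x : (0 <= V x)%E by apply: nneseries_ge0 => k _ _; rewrite lee_fin.
have iV : m.-integrable setT V.
  apply/integrableP; split; first exact: measurable_abs_sum.
  under eq_integral do rewrite gee0_abs//.
  by apply: le_lt_trans integral_abs_sum _; rewrite ltry.
by apply: filterS (integrable_ae measurableT iV) => x; exact.
Qed.

Lemma series_ae_cvg : {ae m, forall x, cvgn (series (Z ^~ x))}.
Proof.
apply: filterS abs_sum_ae_fin => x fV.
by have [] := @abs_summable_series R (Z ^~ x) (fine (V x)) _; rewrite ?fineK.
Qed.

End summable.

(** * The energy form of increments on a regular grid *)

Section grid.
Context (R : realType).
Local Notation mu := (leb01 R).
Local Notation square_integrable := (@square_integrable R).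

Definition grid (N i : nat) : R := i%:R / N%:R.

Definition incr (N : nat) (f : R -> R) (i : nat) := f (grid N i.+1) - f (grid N i).

(** For primitives this is the inner product of the projections of the signals
    on step functions, yet it makes sense for any pair of functions, in
    particular when one of them is an observed path. *)
Definition energy (N : nat) (f g : R -> R) := N%:R * \sum_(i < N) incr N f i * incr N g i.

(** The slope of the broken line that interpolates [f] on the grid. *)
Definition incr_step (N : nat) (f : R -> R) := step (grid N) N (fun i => N%:R * incr N f i).

Lemma grid0 N : grid N 0 = 0. Proof. by rewrite /grid mul0r. Qed.

Lemma gridN N : (0 < N)%N -> grid N N = 1.
Proof. by move=> N0; rewrite /grid divff// pnatr_eq0 -lt0n. Qed.

Lemma gridS N i : grid N i.+1 - grid N i = N%:R^-1.
Proof. by rewrite /grid -mulrBl -natrB// subSnn mul1r. Qed.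

Lemma grid_refine N q i : (0 < q)%N -> grid (N * q) (i * q) = grid N i.
Proof.
move=> q0; rewrite /grid !natrM invfM mulrACA divff ?mulr1//.
by rewrite pnatr_eq0 -lt0n.
Qed.

Lemma grid01 N i : (0 < N)%N -> (i <= N)%N -> 0 <= grid N i <= 1.
Proof.
move=> N0 iN; rewrite /grid divr_ge0//= ler_pdivrMr ?ltr0n// mul1r ler_nat//.
Qed.

Lemma grid_lt N : (0 < N)%N -> forall i, (i < N)%N -> grid N i < grid N i.+1.
Proof. by move=> N0 i _; rewrite -subr_gt0 gridS invr_gt0 ltr0n. Qed.

Lemma energyC N f g : energy N f g = energy N g f.
Proof. by congr (_ * _); apply: eq_bigr => i _; rewrite mulrC. Qed.

Section fixed_grid.
Variable N : nat.
Hypothesis N0 : (0 < N)%N.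

Let g0 : 0 <= grid N 0. Proof. by rewrite grid0. Qed.
Let gN : grid N N <= 1. Proof. by rewrite gridN. Qed.
Lemma sqint_incr_step f : square_integrable (incr_step N f).
Proof. exact: sqint_step. Qed.

Lemma ip_incr_step f g : square_integrable f ->
  ip f (incr_step N g) = energy N (primitive f) g.
Proof.
move=> sf; rewrite ip_step// /energy mulr_sumr; apply: eq_bigr => i _.
by rewrite /incr; ring.
Qed.

Lemma incr_step_mean f : step (grid N) N (cell_mean (grid N) f) = incr_step N (primitive f).
Proof.
apply/funext => x; apply: eq_bigr => i _; congr (_ * _).
by rewrite /cell_mean gridS invrK mulrC.
Qed.

Lemma sqr_sub_incr_step f : square_integrable f ->
  ip (fun x => f x - incr_step N (primitive f) x) (fun x => f x - incr_step N (primitive f) x) =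
  ip f f - energy N (primitive f) (primitive f).
Proof.
move=> sf; rewrite -incr_step_mean sqr_sub_mean//; last exact: grid_lt.
by rewrite incr_step_mean ip_incr_step.
Qed.

Lemma energy_primitive_le f : square_integrable f ->
  energy N (primitive f) (primitive f) <= ip f f.
Proof. by move=> sf; rewrite -subr_ge0 -sqr_sub_incr_step// ip_ge0. Qed.

(** Projecting on a coarser grid after a finer one is projecting on the
    coarser one. *)
Lemma ip_incr_step_refine q f g : (0 < q)%N ->
  ip (incr_step (N * q) f) (incr_step N g) = energy N f g.
Proof.
move=> q0; rewrite ip_incr_step; last exact: sqint_step.
congr (_ * _); apply: eq_bigr => i _; congr (_ * _).
have Nq0 : (0 < N * q)%N by rewrite muln_gt0 N0.
have pr j : (j <= N)%N -> primitive (incr_step (N * q) f) (grid N j) = f (grid N j) - f 0.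
  move=> jN; rewrite -(grid_refine _ _ q0) /incr_step primitive_step; last 4 first.
  - by rewrite grid0.
  - by rewrite gridN.
  - exact: grid_lt.
  - by rewrite leq_mul2r jN orbT.
  rewrite -[X in _ - f X](grid0 (N * q)) -(telescope_sumr (fun i => f (grid (N * q) i)))// big_mkord.
  apply: eq_bigr => k _; rewrite gridS /incr mulrAC divff ?mul1r//.
  by rewrite pnatr_eq0 -lt0n.
have p1 := pr _ (ltn_ord i); have p0 := pr _ (ltnW (ltn_ord i)).
by clear pr; rewrite /incr p1 p0; ring.
Qed.

Lemma ip_incr_step_same f g : ip (incr_step N f) (incr_step N g) = energy N f g.
Proof. by have := @ip_incr_step_refine 1 f g isT; rewrite muln1. Qed.

End fixed_grid.

Lemma sqr_incr_step_refine N q f : (0 < N)%N -> (0 < q)%N ->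
  ip (fun x => incr_step (N * q) f x - incr_step N f x)
     (fun x => incr_step (N * q) f x - incr_step N f x) =
  energy (N * q) f f - energy N f f.
Proof.
move=> N0 q0; have Nq0 : (0 < N * q)%N by rewrite muln_gt0 N0.
rewrite ip_sqrB; try exact: sqint_incr_step.
by rewrite ip_incr_step_refine// !ip_incr_step_same//; ring.
Qed.

Lemma energy_refine_le N q f : (0 < N)%N -> (0 < q)%N ->
  energy N f f <= energy (N * q) f f.
Proof. by move=> N0 q0; rewrite -subr_ge0 -sqr_incr_step_refine// ip_ge0. Qed.

(** Cauchy-Schwarz for the difference of two projections: refining the grid
    changes the form by little as soon as it changes the energy of one
    argument by little. *)
Lemma energy_refine_close N q f g : (0 < N)%N -> (0 < q)%N ->
  (energy (N * q) f g - energy N f g) ^+ 2 <=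
  (energy (N * q) f f - energy N f f) * energy (N * q) g g.
Proof.
move=> N0 q0; have Nq0 : (0 < N * q)%N by rewrite muln_gt0 N0.
rewrite -sqr_incr_step_refine// -[energy (N * q) g g]ip_incr_step_same//.
apply: le_trans (ip_cauchy_schwarz _ _); last 2 first.
- by apply: sqintB; exact: sqint_incr_step.
- exact: sqint_incr_step.
rewrite ipBl; try exact: sqint_incr_step.
by rewrite ip_incr_step_same// (ipC (incr_step N f)) ip_incr_step_refine// (energyC N g).
Qed.

(** The difference of two projections of [f] as a single step function on the
    finer grid: this expresses the noise it picks up as one sum of increments. *)
Lemma energy_refine_sub N q f : (0 < N)%N -> (0 < q)%N -> exists h,
  (forall g, energy (N * q) f g - energy N f g = energy (N * q) h g) /\
  energy (N * q) h h = energy (N * q) f f - energy N f f.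
Proof.
move=> N0 q0; have Nq0 : (0 < N * q)%N by rewrite muln_gt0 N0.
pose D x := incr_step (N * q) f x - incr_step N f x.
have sD : square_integrable D by apply: sqintB; exact: sqint_incr_step.
exists (primitive D).
have H g : energy (N * q) f g - energy N f g = energy (N * q) (primitive D) g.
  rewrite -ip_incr_step// ipBl; try exact: sqint_incr_step.
  by rewrite ip_incr_step_same// (ipC (incr_step N f)) ip_incr_step_refine// (energyC N g).
split => //; rewrite -[LHS]H (energyC (N * q) f (primitive D)) -H.
have -> : energy N f (primitive D) = 0.
  rewrite energyC -ip_incr_step// ipBl; try exact: sqint_incr_step.
  by rewrite ip_incr_step_refine// ip_incr_step_same// subrr.
by rewrite subr0.
Qed.

End grid.

(** * Density of dyadic step functions *)

Section density.
Context (R : realType).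
Local Notation mu := (leb01 R).
Local Notation square_integrable := (@square_integrable R).

Lemma ae_leb01_sub (A B : R -> Prop) : (forall x, A x -> B x) ->
  {ae mu, forall x, A x} -> {ae mu, forall x, B x}.
Proof.
by move=> AB [N [mN N0 AN]]; exists N; split => // x nB; apply: AN => /AB.
Qed.

Lemma leb01_ae : {ae mu, forall x, 0 < x < 1}.
Proof.
exists (~` `]0, 1[%classic); split; first exact: measurableC.
  transitivity (@lebesgue_measure R (~` `]0, 1[ `&` `]0, 1[)) => //.
  by rewrite setICl measure0.
by move=> x /=; rewrite in_itv.
Qed.

Lemma ip_sub_trans (f g h : R -> R) :
  square_integrable f -> square_integrable g -> square_integrable h ->
  ip (fun x => f x - g x) (fun x => f x - g x) <=
  2 * ip (fun x => f x - h x) (fun x => f x - h x) +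
  2 * ip (fun x => h x - g x) (fun x => h x - g x).
Proof.
move=> sf sg sh.
have := ip_ge0 (fun x => (f x - h x) - (h x - g x)).
have e : ip (fun x => f x - h x) (fun x => h x - g x) =
    ip f h - ip f g - (ip h h - ip h g).
  by rewrite ipBl//; [rewrite !ipBr|exact: sqintB].
by rewrite !ip_sqrB//; try exact: sqintB; rewrite e; lra.
Qed.

Let trunc (K : R) (y : R) := Num.max (- K) (Num.min K y).

Let truncP K y : 0 <= K -> [/\ `|trunc K y| <= K, `|y - trunc K y| <= `|y| &
  `|y| <= K -> trunc K y = y].
Proof.
move=> K0; rewrite /trunc.
have [Ky|yK] := leP K y.
  rewrite max_r; last by lra.
  split; first by rewrite ger0_norm.
    by rewrite !ger0_norm//; lra.
  by move=> /ler_normlP[_ h]; apply/eqP; rewrite eq_le Ky h.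
have [yk|Ky] := leP y (- K).
  split; first by rewrite normrN ger0_norm.
    by rewrite !ler0_norm//; lra.
  by move=> /ler_normlP[h _]; apply/eqP; rewrite eq_le yk andbT lerNl.
split; first by rewrite ler_norml !ltW.
  by rewrite subrr normr0.
by [].
Qed.

Let mtrunc K (f : R -> R) : measurable_fun setT f ->
  measurable_fun setT (fun x => trunc K (f x)).
Proof. by move=> mf; apply: measurable_maxr => //; exact: measurable_minr. Qed.

(** Dominated convergence, the difference being bounded by [f]. *)
Let truncation_approx f (delta : R) : square_integrable f -> 0 < delta ->
  exists2 K, 0 < K & ip (fun x => f x - trunc K (f x)) (fun x => f x - trunc K (f x)) <= delta.
Proof.
move=> sf d0.
have mh n : measurable_fun setT (fun x => f x - trunc n%:R (f x)).
  by apply: measurable_funB; [exact: sf.1|apply: mtrunc; exact: sf.1].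
have [] := @dominated_convergence _ _ _ mu setT measurableT
  (fun n x => ((f x - trunc n%:R (f x)) ^+ 2)%:E) (cst 0%E) (fun x => (f x ^+ 2)%:E).
- by move=> n; apply/measurable_EFinP; apply: measurable_funX; exact: mh.
- exact: measurable_cst.
- apply: aeW => x _; apply: cvg_near_cst; near=> n.
  have [_ _ ->] := @truncP n%:R (f x) (ler0n _ _); first by rewrite subrr expr0n.
  near: n; exact: nbhs_infty_ger.
- exact: sf.2.
- apply: aeW => x n _; have [_ h _] := @truncP n%:R (f x) (ler0n _ _).
  rewrite gee0_abs ?lee_fin ?sqr_ge0//.
  by rewrite -(real_normK (num_real (f x))) -(real_normK (num_real (f x - _))) ler_pXn2r ?nnegrE.
move=> _ _ L; rewrite integral0 in L.
have : nbhs (0%E : \bar R) [set x | (x < delta%:E)%E].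
  by apply: open_nbhs_nbhs; split; [exact: open_ereal_lt_ereal|rewrite /= lte_fin].
move=> /L [n _ /(_ n.+1 (leqnSn _))] /= Hn.
exists n.+1%:R => //.
have [] // := @ip_le_cst R _ delta (mh n.+1).
exact: ltW.
Unshelve. all: by end_near. Qed.

Let uniformly_approx (h : R -> R) (delta : R) : measurable_fun setT h -> (forall x, 0 <= h x <= 1) ->
  0 < delta -> exists F : R -> R, [/\ measurable_fun setT F, forall x, 0 <= F x <= 1,
    forall rho : R, 0 < rho -> exists2 eta : R, 0 < eta &
      forall x y, `|x - y| < eta -> `|F x - F y| < rho &
    (\int[mu]_x (`|h x - F x|)%:E <= delta%:E)%E].
Proof.
move=> mh h01 d0.
have [] := @approximation_by_cylinder_fun _ (measurableTypeR R) R unit (fun _ => id) mu _ _ h mh h01 delta d0.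
- by move=> _; exact: measurable_id.
- by move=> A mA; apply: sub_sigma_algebra; exists tt => //; exists A.
move=> F [mF F01 [s Hs]] HF; exists F; split => // rho /Hs[eta e0 H].
by exists eta => // x y xy; apply: H.
Qed.

(** A truncation of [f], rescaled to the unit interval, is approximated in mean
    as a function of the single coordinate [x]; since everything is bounded,
    closeness in mean gives closeness in mean square. *)
Lemma dense_uniformly_continuous f (delta : R) : square_integrable f -> 0 < delta ->
  exists G : R -> R, [/\ square_integrable G,
    forall rho : R, 0 < rho -> exists2 eta : R, 0 < eta &
      forall x y, `|x - y| < eta -> `|G x - G y| < rho &
    ip (fun x => f x - G x) (fun x => f x - G x) <= delta].
Proof.
move=> sf d0.
have d40 : 0 < delta / 4 by rewrite divr_gt0.
have [K K0 HK] := truncation_approx sf d40.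
pose T x := trunc K (f x).
have mT : measurable_fun setT T by apply: mtrunc; exact: sf.1.
have TK x : `|T x| <= K by have [] := truncP (f x) (ltW K0).
have sT : square_integrable T := sqint_bounded mT TK.
have K20 : 0 < 2 * K by rewrite mulr_gt0.
pose h x := (T x + K) / (2 * K).
have mh : measurable_fun setT h by apply: measurable_funM => //; exact: measurable_funD.
have h01 x : 0 <= h x <= 1.
  by have /ler_normlP[] := TK x; rewrite /h ler_pdivrMr// ler_pdivlMr//; lra.
have e0 : 0 < delta / 4 / (2 * K) ^+ 2 by rewrite divr_gt0// exprn_gt0.
have [F [mF F01 cF HF]] := uniformly_approx mh h01 e0.
pose G x := 2 * K * F x - K.
have mG : measurable_fun setT G by apply: measurable_funB => //; exact: measurable_funM.
have GK x : `|G x| <= K.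
  by have /andP[a b] := F01 x; rewrite ler_norml /G; apply/andP; split; nra.
have sG : square_integrable G := sqint_bounded mG GK.
exists G; split => //.
  move=> rho r0; have [|eta e1 H] := cF (rho / (2 * K)); first by rewrite divr_gt0.
  exists eta => // x y /H; rewrite ltr_pdivlMr// mulrC; apply: le_lt_trans.
  rewrite (_ : G x - G y = 2 * K * (F x - F y)); last by rewrite /G; ring.
  by rewrite normrM (ger0_norm (ltW K20)).
apply: le_trans (ip_sub_trans sf sG sT) _.
have TG : ip (fun x => T x - G x) (fun x => T x - G x) <= delta / 4.
  have mTG : measurable_fun setT (fun x => T x - G x) by exact: measurable_funB.
  have [] // := @ip_le_cst R _ (delta / 4) mTG.
  apply: (@le_trans _ _ (\int[mu]_x (((2 * K) ^+ 2)%:E * (`|h x - F x|)%:E))%E).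
    apply: ge0_le_integral => //.
    - by move=> x _; rewrite lee_fin sqr_ge0.
    - by apply/measurable_EFinP; exact: measurable_funX.
    - apply: emeasurable_funM => //; apply/measurable_EFinP.
      by apply: measurableT_comp => //; exact: measurable_funB.
    - move=> x _; rewrite -EFinM lee_fin.
      have -> : T x - G x = 2 * K * (h x - F x).
        by rewrite /G /h; field; rewrite gt_eqF.
      rewrite exprMn ler_wpM2l ?sqr_ge0//.
      have hF : `|h x - F x| <= 1.
        by have := h01 x; have := F01 x; rewrite ler_norml; lra.
      by rewrite -(real_normK (num_real (h x - F x))) expr2 ler_piMl.
  rewrite ge0_integralZl_EFin ?sqr_ge0//; last first.
    apply/measurable_EFinP; apply: measurableT_comp => //; exact: measurable_funB.
  apply: le_trans (lee_wpmul2l _ HF) _; first by rewrite lee_fin sqr_ge0.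
  by rewrite -EFinM lee_fin mulrC divfK// gt_eqF// exprn_gt0.
by lra.
Qed.

Let cell_ge0 (t : nat -> R) i x : t i <= t i.+1 -> 0 <= cell t i x.
Proof.
move=> tt; rewrite /cell /heav !indicE.
have [xi|_] := boolP (x \in `]0, t i[%classic); last by rewrite subr0.
rewrite mem_set ?subrr//; move: xi; rewrite inE /= !in_itv/= => /andP[-> xi].
exact: lt_le_trans tt.
Qed.

Let cell_supp (t : nat -> R) i x : 0 < x -> t i <= t i.+1 -> cell t i x != 0 -> t i <= x < t i.+1.
Proof.
move=> x0 tt; rewrite /cell /heav !indicE.
have [xi|xi] := boolP (x \in `]0, t i.+1[%classic); last first.
  rewrite (_ : (x \in _) = false) ?subrr ?eqxx//; apply/negP => xi'.
  move/negP : xi; apply; move: xi'; rewrite !inE /= !in_itv/= x0/= => xi'.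
  exact: lt_le_trans tt.
have [xi'|xi'] := boolP (x \in `]0, t i[%classic); first by rewrite subrr eqxx.
move=> _; move: xi xi'; rewrite inE notin_setE /= !in_itv/= x0/= => -> /negP.
by rewrite -leNgt => ->.
Qed.

(** The projection on step functions is at least as close to [f] as the step
    function interpolating a uniformly continuous approximation of [f]. *)
Lemma incr_step_approx f (delta : R) : square_integrable f -> 0 < delta ->
  exists n0, forall n, (n0 <= n)%N ->
    ip (fun x => f x - incr_step (2 ^ n) (primitive f) x)
       (fun x => f x - incr_step (2 ^ n) (primitive f) x) <= delta.
Proof.
move=> sf d0; have d40 : 0 < delta / 4 by rewrite divr_gt0.
have [G [sG cG HG]] := dense_uniformly_continuous sf d40.
pose rho := Num.min 1 (delta / 4).
have r0 : 0 < rho by rewrite lt_min ltr01.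
have [eta e0 H] := cG _ r0.
have [n0 Hn0] : exists n0, forall n, (n0 <= n)%N -> (2 ^ n)%:R^-1 < eta.
  have : (fun n => (2^-1 : R) ^+ n) @ \oo --> 0.
    by apply: cvg_expr; rewrite ger0_norm// invf_lt1// ltr1n.
  move=> /cvgr_lt /(_ _ e0) [n0 _ Hn0]; exists n0 => n /Hn0 /=.
  by rewrite natrX exprVn.
exists n0 => n /Hn0 {}Hn0; set N := (2 ^ n)%N.
have N0 : (0 < N)%N by rewrite expn_gt0.
pose c i := G (grid R N i).
have sc : square_integrable (step (grid R N) N c) by exact: sqint_step.
rewrite -incr_step_mean; apply: le_trans (mean_optimal _ _ _ c sf) _.
- by rewrite grid0.
- by rewrite gridN.
- exact: grid_lt.
apply: le_trans (ip_sub_trans sf sc sG) _.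
suff : ip (fun x => G x - step (grid R N) N c x) (fun x => G x - step (grid R N) N c x) <= delta / 4.
  by lra.
have mGc : measurable_fun setT (fun x => G x - step (grid R N) N c x).
  by apply: measurable_funB; [exact: sG.1|exact: sc.1].
have [] // := @ip_le_cst R _ (delta / 4) mGc.
apply: (@le_trans _ _ (\int[mu]_x (cst (delta / 4)%:E x))%E); last first.
  by rewrite integral_cst// [X in (_ * X)%E]leb01_setT mule1.
apply: ae_ge0_le_integral => //.
- by move=> x _; rewrite lee_fin sqr_ge0.
- by apply/measurable_EFinP; exact: measurable_funX.
- by move=> x _; rewrite lee_fin ltW.
apply: ae_leb01_sub leb01_ae => x x01 _; rewrite lee_fin.
have /andP[x0 x1] := x01.
have t_le i : grid R N i <= grid R N i.+1 by rewrite -subr_ge0 gridS invr_ge0.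
have sum1 : \sum_(i < N) cell (grid R N) i x = 1.
  rewrite -(big_mkord xpredT (fun i => cell (grid R N) i x)) telescope_sumr//.
  rewrite grid0 gridN// /heav !indicE mem_set ?memNset ?subr0//=.
    by rewrite in_itv/= x0/=; apply/negP; rewrite -leNgt ltW.
have hr : `|G x - step (grid R N) N c x| <= rho.
  have -> : G x - step (grid R N) N c x = \sum_(i < N) (G x - c i) * cell (grid R N) i x.
    under eq_bigr do rewrite mulrBl.
    by rewrite sumrB -mulr_sumr sum1 mulr1.
  apply: le_trans (ler_norm_sum _ _ _) _.
  rewrite -[leRHS]mulr1 -sum1 mulr_sumr; apply: ler_sum => i _.
  rewrite normrM (ger0_norm (cell_ge0 _ (t_le i))).
  have [->|ci] := eqVneq (cell (grid R N) i x) 0; first by rewrite !mulr0.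
  rewrite ler_wpM2r ?cell_ge0//; apply/ltW/H.
  have /andP[g1 g2] := cell_supp x0 (t_le i) ci.
  rewrite ger0_norm ?subr_ge0//; apply: lt_trans Hn0.
  by rewrite -(gridS R N i) ltrD2r.
have r1 : rho <= 1 by rewrite ge_min lexx.
have r2 : rho <= delta / 4 by rewrite ge_min lexx orbT.
rewrite -(real_normK (num_real _)) expr2.
have := normr_ge0 (G x - step (grid R N) N c x); nra.
Qed.

End density.

(** * Functions of bounded energy *)

Section energy_limit.
Context (R : realType).
Local Notation mu := (leb01 R).
Local Notation square_integrable := (@square_integrable R).
Variables (f : R -> R) (A : R).
Hypothesis fA : forall n, energy (2 ^ n) f f <= A.

Lemma dyadic_split m n : (m <= n)%N -> (2 ^ n = 2 ^ m * 2 ^ (n - m))%N.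
Proof. by move=> mn; rewrite -expnD subnKC. Qed.

Lemma energy_dyadic_nondecreasing :
  {homo (fun n => energy (2 ^ n) f f) : m n / (m <= n)%N >-> m <= n}.
Proof.
move=> m n mn; rewrite (dyadic_split mn).
by apply: energy_refine_le; rewrite expn_gt0.
Qed.

Lemma sqr_incr_step_dyadic m n : (m <= n)%N ->
  ip (fun x => incr_step (2 ^ n) f x - incr_step (2 ^ m) f x)
     (fun x => incr_step (2 ^ n) f x - incr_step (2 ^ m) f x) =
  energy (2 ^ n) f f - energy (2 ^ m) f f.
Proof.
move=> mn; rewrite (dyadic_split mn).
by apply: sqr_incr_step_refine; rewrite expn_gt0.
Qed.

(** A function whose increments have bounded energy is, on dyadic points and up
    to a constant, the primitive of a square-integrable function: along a fast subsequence its
    slopes converge almost everywhere and, by Fatou's lemma, in mean square. *)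
Lemma bounded_energy_limit : exists (S : R -> R) (nk : nat -> nat),
  [/\ square_integrable S, forall k, (k <= nk k)%N &
    forall k, ip (fun x => S x - incr_step (2 ^ nk k) f x)
       (fun x => S x - incr_step (2 ^ nk k) f x) <= 4^-1 ^+ k.+1].
Proof.
have g0 k : 0 < (4^-1 : R) ^+ k.+1 by rewrite exprn_gt0.
have [nk [knk nk_homo nkg]] := fast_subsequence energy_dyadic_nondecreasing fA g0.
pose s k := incr_step (2 ^ nk k) f.
pose D k x := s k.+1 x - s k x.
have ss k : square_integrable (s k) by apply: sqint_incr_step; rewrite expn_gt0.
have sD k : square_integrable (D k) by exact: sqintB.
have sgap k m : (k <= m)%N -> ip (fun x => s m x - s k x) (fun x => s m x - s k x) <= 4^-1 ^+ k.+1.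
  by move=> km; rewrite /s sqr_incr_step_dyadic ?nk_homo//; apply: nkg; exact: nk_homo.
have mD k : measurable_fun setT (D k) := (sD k).1.
have Dc k : (\int[mu]_x `|D k x|%:E <= (1 / (2 ^ k.+1)%:R)%:E)%E.
  set b : R := 1 / (2 ^ k.+1)%:R.
  have b0 : 0 < b by rewrite divr_gt0// ltr0n expn_gt0.
  (* [|D| <= b / 2 + D ^ 2 / (2 * b)], and [b ^ 2] bounds the mean square of [D] *)
  apply: (@le_trans _ _ (\int[mu]_x ((b / 2)%:E + (2 * b)^-1%:E * (D k x ^+ 2)%:E))%E).
    apply: ge0_le_integral => //.
    - by apply/measurable_EFinP; apply: measurableT_comp => //; exact: mD.
    - apply: emeasurable_funD => //; apply: emeasurable_funM => //.
      by apply/measurable_EFinP; apply: measurable_funX; exact: mD.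
    - move=> x _; rewrite -EFinM -EFinD lee_fin.
      have h : 0 <= (`|D k x| - b) ^+ 2 / (2 * b) by rewrite divr_ge0 ?sqr_ge0// mulr_ge0// ltW.
      have e : (`|D k x| - b) ^+ 2 / (2 * b) = b / 2 + (2 * b)^-1 * `|D k x| ^+ 2 - `|D k x|.
        by field; rewrite gt_eqF.
      by rewrite -(real_normK (num_real (D k x))); lra.
  have b20 : 0 <= (2 * b)^-1 by rewrite invr_ge0 mulr_ge0// ltW.
  rewrite ge0_integralD//; last 3 first.
  - by move=> x _; rewrite lee_fin divr_ge0// ltW.
  - by move=> x _; rewrite -EFinM lee_fin mulr_ge0// sqr_ge0.
  - by apply: emeasurable_funM => //; apply/measurable_EFinP; apply: measurable_funX; exact: mD.
  rewrite (_ : (\int[mu]_x (b / 2)%:E = (b / 2)%:E)%E); last first.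
    have -> : (fun x : R => (b / 2)%:E) = cst (b / 2)%:E by [].
    by rewrite integral_cst// [X in (_ * X)%E]leb01_setT mule1.
  rewrite ge0_integralZl_EFin//; last 2 first.
  - by move=> x _; rewrite lee_fin sqr_ge0.
  - by apply/measurable_EFinP; apply: measurable_funX; exact: mD.
  rewrite ip_sqrE// -EFinM -EFinD lee_fin.
  have h := sgap _ _ (leqnSn k).
  have b2 : (4^-1 : R) ^+ k.+1 = b * b.
    by rewrite /b div1r natrX -exprVn -exprMn; congr (_ ^+ _); lra.
  rewrite b2 in h.
  have : (2 * b)^-1 * ip (D k) (D k) <= (2 * b)^-1 * (b * b) by rewrite ler_wpM2l.
  have -> : (2 * b)^-1 * (b * b) = b / 2 by field; rewrite gt_eqF.
  by lra.
pose S x := rlim (fun k => s k x).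
have mS : measurable_fun setT S by apply: measurable_rlim => k; exact: (ss k).1.
have s_series k x : s k x = s 0 x + series (D ^~ x) k.
  by rewrite /series/= /D telescope_sumr//; ring.
have s_cvg : {ae mu, forall x, s k x @[k --> \oo] --> S x}.
  have Hae := @series_ae_cvg R _ (measurableTypeR R) mu D 1 mD ler01 Dc.
  have sub x : cvgn (series (D ^~ x)) -> s k x @[k --> \oo] --> S x; last first.
    exact: (ae_leb01_sub sub Hae).
  move=> cx.
  have h : s k x @[k --> \oo] --> s 0 x + limn (series (D ^~ x)).
    under eq_fun do rewrite s_series.
    by apply: cvgD => //; exact: cvg_cst.
  by rewrite /S (rlim_cvg h).
have main k : (\int[mu]_x ((S x - s k x) ^+ 2)%:E <= (4^-1 ^+ k.+1)%:E)%E.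
  pose F m x := ((s (m + k)%N x - s k x) ^+ 2)%:E.
  have mF m : measurable_fun setT (F m).
    by apply/measurable_EFinP; apply: measurable_funX; apply: measurable_funB; exact: (ss _).1.
  have F0 m x : (0 <= F m x)%E by rewrite lee_fin sqr_ge0.
  have -> : (\int[mu]_x ((S x - s k x) ^+ 2)%:E = \int[mu]_x limn_einf (F ^~ x))%E.
    have mSs : measurable_fun setT (fun x => ((S x - s k x) ^+ 2)%:E).
      by apply/measurable_EFinP; apply: measurable_funX; apply: measurable_funB => //; exact: (ss _).1.
    have E : {ae mu, forall x, [set: R] x -> ((S x - s k x) ^+ 2)%:E = limn_einf (F ^~ x)}.
      apply: ae_leb01_sub s_cvg => x cx _; apply/esym.
      have : F m x @[m --> \oo] --> ((S x - s k x) ^+ 2)%:E.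
        apply: cvg_EFin; first exact: nearW.
        have h1 : (fun m => s (m + k)%N x) @ \oo --> S x.
          by rewrite (cvg_shiftn k (fun j => s j x)).
        rewrite expr2 /=; have h : s (m + k)%N x - s k x @[m --> \oo] --> S x - s k x.
          by apply: cvgB => //; exact: cvg_cst.
        by apply: cvgM.
      by move=> /cvg_limn_einf_sup[].
    apply: ge0_ae_eq_integral => //.
    - exact: measurable_limn_einf.
    - by move=> x _; rewrite lee_fin sqr_ge0.
    - by move=> x _; apply: limn_einf_ge0 => m; exact: F0.
  apply: le_trans (fatou mu measurableT mF _) _ => //.
  apply: limn_einf_le_cst => m.
  rewrite /F ip_sqrE; last exact: sqintB.
  by rewrite lee_fin; apply: sgap; rewrite leq_addl.
have sS : square_integrable S.
  have mSs0 : measurable_fun setT (fun x => S x - s 0 x).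
    by apply: measurable_funB => //; exact: (ss 0).1.
  have [h _] := ip_le_cst mSs0 (main 0).
  have := sqintD h (ss 0); congr square_integrable; apply/funext => x; ring.
exists S, nk; split => // k.
have [] // := ip_le_cst _ (main k).
by apply: measurable_funB => //; exact: (ss k).1.
Qed.

End energy_limit.

(** * Bounded linear forms and the weak topology *)

Section signals.
Context (R : realType).
Local Notation mu := (leb01 R).
Local Notation square_integrable := (@square_integrable R).
Local Notation ip := (@ip R).

Let norm_sqr (f : R -> R) : measurable_fun setT f ->
  ('N[mu]_2%:E [EFin \o f] `^ 2 = \int[mu]_x (f x ^+ 2)%:E)%E.
Proof.
move=> mf; rewrite poweR_Lnorm//; apply: eq_integral => x _.
by rewrite /= powR_mulrn// real_normK// num_real.
Qed.

Lemma finite_norm_sqint (f : R -> R) : square_integrable f -> finite_norm mu 2%:E f.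
Proof.
move=> sf; apply: (@lty_poweRy _ _ 2) => //.
by rewrite norm_sqr ?ip_sqrE ?ltry//; exact: sf.1.
Qed.

Lemma sqint_L2 (S : L2 R) : square_integrable S.
Proof.
have mS : measurable_fun setT (S : R -> R) by exact: (@measurable_funPT _ _ (measurableTypeR R) (measurableTypeR R) (repr (LebesgueSpace.sort S))).
split => //; apply: Lfun2_integrable_sqr.
rewrite inE; apply/andP; split; rewrite inE//=.
exact: Lebesgue_finite.
Qed.

Lemma L2normE (S : L2 R) : L2norm S = Num.sqrt (ip S S).
Proof.
have sS := sqint_L2 S; rewrite /L2norm.
set N := Lnorm _ _ _.
have N0 : (0 <= N)%E by exact: Lnorm_ge0.
have Nfin : N \is a fin_num by rewrite ge0_fin_numE//; exact: finite_norm_sqint.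
have : (fine N ^+ 2)%:E = (ip S S)%:E.
  rewrite -ip_sqrE// -norm_sqr; last exact: sS.1.
  transitivity ((fine N)%:E `^ 2)%E; last by rewrite fineK.
  by rewrite poweR_EFin powR_mulrn// fine_ge0.
by move=> [<-]; rewrite sqrtr_sqr ger0_norm// fine_ge0.
Qed.

Lemma L2_repr (f : R -> R) : square_integrable f ->
  exists S : L2 R, {ae mu, forall x, S x = f x}.
Proof.
move=> sf; have mf : measurable_fun setT f := sf.1.
pose F : {mfun (measurableTypeR R) >-> (measurableTypeR R)} :=
  HB.pack f (@isMeasurableFun.Build _ _ (measurableTypeR R) (measurableTypeR R) f mf).
pose q : {mfun_ mu, measurableTypeR R >-> measurableTypeR R} := (\pi F)%qT.
have qF : {ae mu, forall x, q x = F x}.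
  have : (repr q == F %[mod {mfun_ mu, measurableTypeR R >-> measurableTypeR R}])%qT.
    by rewrite reprK.
  rewrite eqmodE => /asboolP.
  by apply: ae_leb01_sub => x /=; exact.
have mq : measurable_fun setT (q : R -> R) by exact: (@measurable_funPT _ _ (measurableTypeR R) (measurableTypeR R) (repr q)).
have sq : square_integrable q.
  split => //; apply/integrableP; split.
    by apply/measurable_EFinP; apply: measurable_funX.
  rewrite (_ : (\int[mu]_x `|(q x ^+ 2)%:E| = \int[mu]_x (f x ^+ 2)%:E)%E).
    by rewrite ip_sqrE// ltry.
  apply: ge0_ae_eq_integral => //.
  - apply/measurable_EFinP; apply: measurableT_comp => //.
    by apply: measurable_funX; exact: mq.
  - by apply/measurable_EFinP; apply: measurable_funX.
  - by move=> x _; rewrite lee_fin sqr_ge0.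
  - apply: ae_leb01_sub qF => x -> _; rewrite gee0_abs// lee_fin sqr_ge0//.
have fq := finite_norm_sqint sq.
pose S : L2 R := HB.pack q (isFinLebesgue.Build _ _ _ _ _ (lee1n 2) q fq).
by exists S.
Qed.

Lemma ae_leb01_sub2 (A B C : R -> Prop) : (forall x, A x -> B x -> C x) ->
  {ae mu, forall x, A x} -> {ae mu, forall x, B x} -> {ae mu, forall x, C x}.
Proof.
move=> ABC [N [mN N0 AN]] [M [mM M0 BM]]; exists (N `|` M); split.
- exact: measurableU.
- by rewrite measureU0.
- move=> x /= nC; have [Nx|nN] := pselect (N x); [by left|right].
  apply: BM => /= Bx; apply: nC; apply: ABC => //.
  by apply: contrapT => nA; apply: nN; exact: AN.
Qed.

Lemma ip_eq_ae (f g h k : R -> R) : square_integrable f -> square_integrable g ->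
  square_integrable h -> square_integrable k ->
  {ae mu, forall x, f x = h x} -> {ae mu, forall x, g x = k x} -> ip f g = ip h k.
Proof.
move=> sf sg sh sk fh gk.
have zero u : square_integrable u -> {ae mu, forall x, u x = 0} -> ip u u = 0.
  move=> su u0; apply/eqP; rewrite -eqe -ip_sqrE//; apply/eqP.
  rewrite (@ge0_ae_eq_integral _ _ _ _ setT _ (cst 0%E))// ?integral0//.
  - by apply/measurable_EFinP; apply: measurable_funX; exact: su.1.
  - by move=> x _; rewrite lee_fin sqr_ge0.
  - by apply: ae_leb01_sub u0 => x -> _; rewrite expr0n.
have zip u v : square_integrable u -> square_integrable v ->
    {ae mu, forall x, u x = 0} -> ip u v = 0.
  move=> su sv u0; have := ip_cauchy_schwarz su sv; rewrite zero// mul0r => h0.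
  by apply/eqP; rewrite -sqrf_eq0 eq_le h0 sqr_ge0.
have e1 : ip (fun x => f x - h x) g = 0.
  apply: zip => //; first exact: sqintB.
  by apply: ae_leb01_sub fh => x ->; rewrite subrr.
have e2 : ip (fun x => g x - k x) h = 0.
  apply: zip => //; first exact: sqintB.
  by apply: ae_leb01_sub gk => x ->; rewrite subrr.
move: e1 e2; rewrite !ipBl// => /eqP; rewrite subr_eq0 => /eqP -> /eqP.
by rewrite subr_eq0 => /eqP e; rewrite ipC e ipC.
Qed.

Definition toL2 (f : R -> R) : L2 R :=
  match pselect (square_integrable f) with
  | left sf => projT1 (cid (L2_repr sf))
  | right _ => projT1 (cid (L2_repr (sqint_heav 0)))
  end.

Lemma toL2_ae f : square_integrable f -> {ae mu, forall x, toL2 f x = f x}.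
Proof. by move=> sf; rewrite /toL2; case: pselect => // sf'; case: cid. Qed.

Lemma L2norm_toL2 f : square_integrable f -> L2norm (toL2 f) = Num.sqrt (ip f f).
Proof.
move=> sf; rewrite L2normE; congr Num.sqrt.
by apply: ip_eq_ae => //; by [exact: sqint_L2|exact: toL2_ae].
Qed.

Lemma L2norm_ge0 (S : L2 R) : 0 <= L2norm S.
Proof. by rewrite L2normE sqrtr_ge0. Qed.

Lemma L2norm_sqr (S : L2 R) : L2norm S ^+ 2 = ip S S.
Proof. by rewrite L2normE sqr_sqrtr// ip_ge0. Qed.

Lemma ip_le_L2norm (S : L2 R) f : square_integrable f ->
  `|ip S f| <= Num.sqrt (ip f f) * L2norm S.
Proof.
move=> sf; rewrite L2normE -sqrtrM ?ip_ge0// -sqrtr_sqr ler_wsqrtr// mulrC.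
by apply: ip_cauchy_schwarz => //; exact: sqint_L2.
Qed.

Lemma ip_is_bounded_linear_form f : square_integrable f ->
  bounded_linear_form (fun S : L2 R => ip S f).
Proof.
move=> sf; split.
  move=> a g h k E; have sg := sqint_L2 g; have sh := sqint_L2 h; have sk := sqint_L2 k.
  rewrite -ipZl// -ipDl//; last exact: sqintZ.
  by apply: ip_eq_ae => //; [apply: sqintD => //; exact: sqintZ|exact: aeW].
by exists (Num.sqrt (ip f f)) => S; exact: ip_le_L2norm.
Qed.

Definition primitive_dual (t : R) : L2dual R :=
  exist _ _ (ip_is_bounded_linear_form (sqint_heav t)).

Section dual.
Variable l : L2dual R.

(** A linear form as a function of representatives, where sums and multiples
    are those of functions. *)
Definition ext (f : R -> R) : R := sval l (toL2 f).

Lemma ext_linear a f g : square_integrable f -> square_integrable g ->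
  ext (fun x => a * f x + g x) = a * ext f + ext g.
Proof.
move=> sf sg; have [H _] := svalP l; apply: H.
have sfg : square_integrable (fun x => a * f x + g x) by apply: sqintD => //; exact: sqintZ.
have h1 := toL2_ae sfg; have h2 := toL2_ae sf; have h3 := toL2_ae sg.
apply: (ae_leb01_sub2 (A := fun x => toL2 f x = f x /\ toL2 g x = g x)) h1.
  by move=> x [-> ->] ->.
by apply: ae_leb01_sub2 h2 h3.
Qed.

Lemma ext_self (S : L2 R) : ext S = sval l S.
Proof.
have [H _] := svalP l; rewrite /ext (H 0 S S (toL2 S)) ?mul0r ?add0r//.
by have := toL2_ae (sqint_L2 S); apply: ae_leb01_sub => x ->; rewrite mul0r add0r.
Qed.

Lemma ext0 : ext (fun=> 0) = 0.
Proof.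
have s0 : square_integrable (fun=> 0) by apply: (@sqint_bounded _ _ 0) => // x; rewrite normr0.
have := ext_linear 1 s0 s0; rewrite (_ : (fun x => _) = fun=> 0) ?mul1r.
  by move/eqP; rewrite -subr_eq0 opprD addrA subrr sub0r oppr_eq0 => /eqP.
by apply/funext => x; rewrite addr0.
Qed.

Lemma ext_sub f g : square_integrable f -> square_integrable g ->
  ext (fun x => f x - g x) = ext f - ext g.
Proof.
move=> sf sg; rewrite addrC -mulN1r -ext_linear//.
by congr ext; apply/funext => x; rewrite mulN1r addrC.
Qed.

Lemma ext_sum (n : nat) (c : nat -> R) (f : nat -> R -> R) :
  (forall i, square_integrable (f i)) ->
  ext (fun x => \sum_(i < n) c i * f i x) = \sum_(i < n) c i * ext (f i).
Proof.
move=> sf; elim: n => [|n IH].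
  by rewrite big_ord0 -[RHS]ext0; congr ext; apply/funext => x; rewrite big_ord0.
rewrite big_ord_recr/= -IH addrC -ext_linear//; last first.
  by apply: sqint_sum => i; exact: sqintZ.
by congr ext; apply/funext => x; rewrite big_ord_recr/= addrC.
Qed.

Lemma ext_bound : exists2 C, 0 <= C & forall f, square_integrable f ->
  `|ext f| <= C * Num.sqrt (ip f f).
Proof.
have [_ [C HC]] := svalP l; exists (Num.max C 0); first by rewrite le_max lexx orbT.
move=> f sf; apply: le_trans (HC _) _; rewrite L2norm_toL2//.
by rewrite ler_wpM2r ?sqrtr_ge0// le_max lexx.
Qed.

(** The analogue for [l] of the distribution function of a measure. *)
Definition dual_primitive (t : R) : R := ext (heav t).

Let lam := dual_primitive.

Lemma ext_incr_step N f : ext (incr_step N f) = energy N f lam.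
Proof.
transitivity (\sum_(i < N) N%:R * incr N f i * ext (cell (grid R N) i)).
  exact: (ext_sum N (fun i => N%:R * incr N f i) (sqint_cell (grid R N))).
rewrite /energy mulr_sumr; apply: eq_bigr => i _; rewrite -mulrA; congr (_ * (_ * _)).
by rewrite /cell ext_sub//; exact: sqint_heav.
Qed.

(** The energy of the dual primitive is the value of [l] at a step function
    whose squared norm is that same energy. *)
Lemma energy_dual_bounded : exists A, forall n, energy (2 ^ n) lam lam <= A.
Proof.
have [C C0 HC] := ext_bound; exists (C ^+ 2) => n.
have N0 : (0 < 2 ^ n)%N by rewrite expn_gt0.
have := HC _ (sqint_incr_step (2 ^ n) lam).
rewrite ext_incr_step ip_incr_step_same// -/lam; set e := energy _ _ _ => h.
have e0 : 0 <= e by rewrite /e -ip_incr_step_same// ip_ge0.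
rewrite ger0_norm// in h.
have := sqr_sqrtr e0; set r := Num.sqrt e in h * => re.
have r0 : 0 <= r by exact: sqrtr_ge0.
rewrite -re; rewrite -re in h.
have [r0'|rn0] := eqVneq r 0; first by rewrite r0' expr0n/= sqr_ge0.
have rp : 0 < r by rewrite lt_def rn0.
rewrite ler_pXn2r// ?nnegrE//.
by rewrite -(ler_pM2r rp) -expr2.
Qed.

Lemma dual_energy_cvg (S : L2 R) :
  energy (2 ^ n) lam (primitive S) @[n --> \oo] --> sval l S.
Proof.
have [C C0 HC] := ext_bound; have sS := sqint_L2 S.
apply/cvgrPdist_le => eps e0.
have C1 : 0 < C + 1 by rewrite ltr_wpDl.
have d0 : 0 < (eps / (C + 1)) ^+ 2 by rewrite exprn_gt0// divr_gt0.
have [n0 Hn0] := incr_step_approx sS d0.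
exists n0 => // n /= /Hn0 hn.
have ss : square_integrable (incr_step (2 ^ n) (primitive S)).
  by apply: sqint_incr_step; rewrite expn_gt0.
rewrite -ext_self energyC -ext_incr_step -ext_sub//.
apply: le_trans (HC _ (sqintB sS ss)) _.
have : Num.sqrt (ip (fun x => S x - incr_step (2 ^ n) (primitive S) x)
    (fun x => S x - incr_step (2 ^ n) (primitive S) x)) <= eps / (C + 1).
  by rewrite -(ger0_norm (ltW (divr_gt0 e0 C1))) -sqrtr_sqr ler_wsqrtr.
rewrite ler_pdivlMr// => h.
by apply: le_trans h; rewrite mulrC ler_wpM2l ?sqrtr_ge0// lerDl.
Qed.

(** The error is controlled by the energy that the dual primitive still gains
    beyond level [n], a quantity independent of the signal. *)
Lemma dual_energy_cvg_unif : exists2 r : nat -> R,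
  (forall n, 0 <= r n) /\ r n @[n --> \oo] --> 0 &
  forall (S : L2 R) n, `|sval l S - energy (2 ^ n) lam (primitive S)| <= r n * L2norm S.
Proof.
have [A HA] := energy_dual_bounded.
pose e n := energy (2 ^ n) lam lam.
have ne := energy_dyadic_nondecreasing lam.
have ce : cvgn e.
  by apply: nondecreasing_is_cvgn => //; exists A => _ [n _ <-]; exact: HA.
exists (fun n => Num.sqrt (limn e - e n)).
  split; first by move=> n; rewrite sqrtr_ge0.
  have -> : 0 = Num.sqrt (limn e - limn e) :> R by rewrite subrr sqrtr0.
  by apply: continuous_cvg; [exact: sqrt_continuous|apply: cvgB => //; exact: cvg_cst].
move=> S n; have sS := sqint_L2 S.
have h : (fun m => `|energy (2 ^ m) lam (primitive S) - energy (2 ^ n) lam (primitive S)|) @ \oo -->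
    `|sval l S - energy (2 ^ n) lam (primitive S)|.
  by apply: cvg_norm; apply: cvgB; [exact: dual_energy_cvg|exact: cvg_cst].
rewrite -(cvg_lim _ h)//; apply: limr_le; first by apply/cvg_ex; eexists; exact: h.
exists n => // m /= nm.
have := @energy_refine_close R (2 ^ n) (2 ^ (m - n)) lam (primitive S).
rewrite !expn_gt0 -dyadic_split// => /(_ isT isT) h1.
have N0 : (0 < 2 ^ m)%N by rewrite expn_gt0.
have h2 := energy_primitive_le N0 sS.
have e0 : 0 <= limn e - e n by rewrite subr_ge0; exact: nondecreasing_cvgn_le.
rewrite L2normE -sqrtrM// -sqrtr_sqr ler_wsqrtr//; apply: le_trans h1 _.
apply: ler_pM => //.
- by rewrite subr_ge0; exact: ne.
- by rewrite -ip_incr_step_same// ip_ge0.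
- by rewrite lerD2r; exact: nondecreasing_cvgn_le.
Qed.

End dual.

Lemma bounded_ultra_cvg (T : Type) (U : set_system T) (UU : UltraFilter U) (f : T -> R) (M : R) :
  (forall x, `|f x| <= M) -> exists b : R, f x @[x --> U] --> b.
Proof.
move=> fM.
have cM : compact `[- M, M]%classic by exact: segment_compact.
have fUM : U (f @^-1` `[- M, M]).
  by apply: filterS (@filterT _ U _) => x _ /=; rewrite in_itv/= -ler_norml.
have [b [_ bU]] := cM (f @ U) _ fUM.
exists b => B nB.
have [//|nfB] := in_ultra_setVsetC (f @^-1` B) UU.
have fnB : (f @ U) (~` B) by exact: nfB.
by have [x []] := bU _ _ fnB nB.
Qed.

(** Bounded sets of signals are weakly relatively compact.  The limit is found
    through its primitive, the pointwise limit of the primitives, whose energy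
    is bounded. *)
Lemma weak_ultra_limit (T : Type) (U : set_system T) (UU : UltraFilter U)
    (S_ : T -> L2 R) (M : R) : (forall x, L2norm (S_ x) <= M) ->
  exists S : L2 R, forall l : L2dual R, sval l (S_ x) @[x --> U] --> sval l S.
Proof.
move=> SM.
have [x0 _] := filter_ex (filterT : U setT).
have M0 : 0 <= M := le_trans (L2norm_ge0 _) (SM x0).
have /choice[beta Hbeta] : forall t, exists b : R, primitive (S_ x) t @[x --> U] --> b.
  move=> t; apply: (@bounded_ultra_cvg _ U UU _ (Num.sqrt (ip (heav t) (heav t)) * M)) => x.
  apply: le_trans (ip_le_L2norm _ (sqint_heav t)) _.
  by rewrite ler_wpM2l ?sqrtr_ge0.
have csum n (u : nat -> T -> R) (v : nat -> R) : (forall i, u i x @[x --> U] --> v i) ->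
    \sum_(i < n) u i x @[x --> U] --> \sum_(i < n) v i.
  move=> uv; elim: n => [|n IH].
    by under eq_fun do rewrite big_ord0; rewrite big_ord0; exact: cvg_cst.
  by under eq_fun do rewrite big_ord_recr; rewrite big_ord_recr; exact: cvgD.
have energy_cvg N (f g : T -> R -> R) (f0 g0 : R -> R) : (forall t, f x t @[x --> U] --> f0 t) ->
    (forall t, g x t @[x --> U] --> g0 t) -> energy N (f x) (g x) @[x --> U] --> energy N f0 g0.
  move=> cf cg; apply: cvgM; first exact: cvg_cst.
  apply: (csum N (fun i x => incr N (f x) i * incr N (g x) i)
    (fun i => incr N f0 i * incr N g0 i)) => i.
  by apply: cvgM; apply: cvgB.
have bA n : energy (2 ^ n) beta beta <= M ^+ 2.
  have c := energy_cvg (2 ^ n)%N _ _ _ _ Hbeta Hbeta.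
  rewrite -(cvg_lim _ c)//; apply: limr_le; first by apply/cvg_ex; eexists; exact: c.
  apply: nearW => x; have N0 : (0 < 2 ^ n)%N by rewrite expn_gt0.
  apply: le_trans (energy_primitive_le N0 (sqint_L2 _)) _.
  by rewrite -L2norm_sqr ler_pXn2r// ?nnegrE// L2norm_ge0.
have [S0 [nk [sS0 nkk HS0]]] := bounded_energy_limit bA.
exists (toL2 S0) => l.
have [C C0 HC] := ext_bound l.
have [r [r0 cr] Hr] := dual_energy_cvg_unif l.
apply/cvgrPdist_le => eps e0.
have e40 : 0 < eps / 3 by rewrite divr_gt0.
have [k [k1 k2]] : exists k, r (nk k) * M <= eps / 3 /\ C * 2^-1 ^+ k.+1 <= eps / 3.
  have c1 : r n * M @[n --> \oo] --> 0 * M by exact: cvgMl.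
  rewrite mul0r in c1; have /cvgr_le /(_ _ e40) [n1 _ h1] := c1.
  have c2 : C * (2^-1 : R) ^+ n @[n --> \oo] --> C * 0.
    by apply: cvgMr; apply: cvg_expr; rewrite ger0_norm// invf_lt1// ltr1n.
  rewrite mulr0 in c2; have /cvgr_le /(_ _ e40) [n2 _ h2] := c2.
  exists (maxn n1 n2); split.
    by apply: h1; apply: leq_trans (nkk _); exact: leq_maxl.
  by apply: h2; rewrite /= leqW// leq_maxr.
have h1 : `|ext l S0 - energy (2 ^ nk k) beta (dual_primitive l)| <= eps / 3.
  have ss : square_integrable (incr_step (2 ^ nk k) beta).
    by apply: sqint_incr_step; rewrite expn_gt0.
  rewrite -ext_incr_step -ext_sub//; apply: le_trans (HC _ (sqintB sS0 ss)) _.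
  apply: le_trans k2; rewrite ler_wpM2l//.
  have -> : (2^-1 : R) ^+ k.+1 = Num.sqrt (4^-1 ^+ k.+1).
    rewrite -[LHS]ger0_norm ?exprn_ge0// -sqrtr_sqr; congr Num.sqrt.
    by rewrite -!exprM mulnC exprM; congr (_ ^+ _); lra.
  by rewrite ler_wsqrtr.
have cc t : (fun=> dual_primitive l t) @ U --> dual_primitive l t by exact: cvg_cst.
have := energy_cvg (2 ^ nk k)%N (fun x => primitive (S_ x)) (fun=> dual_primitive l) beta
  (dual_primitive l) Hbeta cc.
move=> /cvgrPdist_le /(_ _ e40); apply: filterS => x h3.
have h2 : `|sval l (S_ x) - energy (2 ^ nk k) (dual_primitive l) (primitive (S_ x))| <= eps / 3.
  apply: le_trans (Hr _ _) _; apply: le_trans k1.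
  by rewrite ler_wpM2l.
rewrite -/(ext l S0); move: h1 h2 h3; rewrite (energyC _ (dual_primitive l)).
rewrite !ler_norml; lra.
Qed.

Lemma cvg_initial (X : choiceType) (Y : topologicalType) (f : X -> Y)
    (F : set_system X) (FF : Filter F) (s : X) :
  f @ F --> f s -> F --> (s : initial_topology f).
Proof.
move=> cf B; rewrite nbhsE => -[_ [[A oA <-] As] AB].
apply: filterS AB _; apply: (cf A).
by apply: open_nbhs_nbhs.
Qed.

Let pairing (S : L2 R) : {ptws L2dual R -> R} := fun l => sval l S.

Lemma weak_cvg (U : set_system (L2 R)) (FU : Filter U) (S : L2 R) :
  (forall l : L2dual R, sval l S' @[S' --> U] --> sval l S) -> U --> (S : weakL2 R).
Proof.
move=> cl; apply: (@cvg_initial _ _ pairing); apply/cvg_sup => l.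
apply: (@cvg_initial _ _ (fun g : L2dual R -> R => g l) (pairing @ U) _ (pairing S)).
exact: cl.
Qed.

Lemma weak_closure_cvg (T : Type) (U : set_system T) (UU : ProperFilter U)
    (S_ : T -> L2 R) (Theta : set (L2 R)) (S : L2 R) :
  (forall x, Theta (S_ x)) ->
  (forall l : L2dual R, sval l (S_ x) @[x --> U] --> sval l S) ->
  weak_closure Theta S.
Proof.
move=> TS cl B nB.
have c : S_ @ U --> (S : weakL2 R) by exact: weak_cvg.
have [x Bx] := filter_ex (c _ nB : U (S_ @^-1` B)).
by exists (S_ x); split.
Qed.

(** The value of the primitive at a time is a bounded linear form. *)
Lemma weak_nbhs_primitive (S : L2 R) (t eta : R) : 0 < eta ->
  nbhs (S : weakL2 R) [set S' : L2 R | `|primitive S' t - primitive S t| < eta].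
Proof.
move=> e0.
have c1 : {for (S : weakL2 R), continuous (pairing : weakL2 R -> {ptws L2dual R -> R})}.
  exact: initial_continuous.
have c2 := @proj_continuous (L2dual R) (fun=> R) (primitive_dual t) (pairing S).
have c : (fun S' : weakL2 R => primitive S' t) @ (S : weakL2 R) --> primitive S t.
  exact: (cvg_comp _ _ c1 c2).
move/cvgrPdist_lt : c => /(_ _ e0); apply: filterS => S' /=.
by rewrite distrC.
Qed.

End signals.

(** * Estimation of a linear form from an observation *)

Section observation.
Context (R : realType) d (Omega : measurableType d) (P : probability Omega R).
Variable w : R -> Omega -> R.
Hypothesis hw : wiener_process P w.
Local Notation square_integrable := (@square_integrable R).

Let mw t : 0 <= t <= 1 -> measurable_fun setT (w t).
Proof. by have [H _ _ _ _] := hw; exact: H. Qed.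

Section grid_noise.
Variable N : nat.
Hypothesis N0 : (0 < N)%N.

Let X (i : 'I_N) om := w (grid R N i.+1) om - w (grid R N i) om.

Let mX i : measurable_fun setT (X i).
Proof.
by apply: measurable_funB; apply: mw; apply: grid01 => //; exact: ltnW.
Qed.

Lemma measurable_energy_noise h : measurable_fun setT (fun om => energy N h (w ^~ om)).
Proof.
apply: measurable_funM => //; apply: measurable_sum => i.
by apply: measurable_funM => //; exact: mX.
Qed.

Lemma energy_noise_mgf h (s : R) :
  (\int[P]_om (expR (s * energy N h (w ^~ om)))%:E =
   (expR (s ^+ 2 * energy N h h / 2))%:E)%E.
Proof.
have [_ _ lawW indW _] := hw.
have iX : mutually_independent P X.
  apply: (indW N (grid R N)).
  - by rewrite grid0.
  - by move=> i iN; apply: ltW; exact: grid_lt.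
  - by rewrite gridN.
pose c (i : 'I_N) := s * (N%:R * incr N h i).
have -> : (fun om => (expR (s * energy N h (w ^~ om)))%:E) =
    (fun om => (\prod_i (fun i x => expR (c i * x)) i (X i om))%:E : \bar R).
  apply/funext => om; rewrite -expR_sum; congr (expR _)%:E.
  by rewrite /energy mulrA mulr_sumr; apply: eq_bigr => i _; rewrite /c !mulrA.
have s2 : Num.sqrt N%:R^-1 ^+ 2 = N%:R^-1 :> R by rewrite sqr_sqrtr.
have := ge0_expectation_prod mX iX (f := fun i x => expR (c i * x))
  (e := fun i => expR (c i ^+ 2 * N%:R^-1 / 2)).
move=> ->.
- rewrite -expR_sum; congr (expR _)%:E.
  rewrite /energy mulrA mulr_sumr mulr_suml; apply: eq_bigr => i _; rewrite /c.
  by field; rewrite pnatr_eq0 -lt0n.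
- by move=> i; apply: measurableT_comp => //; exact: measurable_funM.
- by move=> i x; exact: expR_ge0.
- move=> i; rewrite -s2; apply: (gaussian_mgf (mX i)).
    by rewrite gt_eqF// sqrtr_gt0 invr_gt0 ltr0n.
  move=> B mB; rewrite -(gridS R N i); apply: lawW => //.
  + by have /andP[] := @grid01 R N i N0 (ltnW (ltn_ord i)).
  + exact: grid_lt.
  + by have /andP[] := @grid01 R N i.+1 N0 (ltn_ord i).
Qed.

(** Absolute moments from exponential ones, by [|z| <= (e^(s z) + e^(- s z)) / s]. *)
Lemma energy_noise_abs h (s : R) : 0 < s ->
  (\int[P]_om `|energy N h (w ^~ om)|%:E <= (2 * expR (s ^+ 2 * energy N h h / 2) / s)%:E)%E.
Proof.
move=> s0; pose Z om := energy N h (w ^~ om).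
have mZ : measurable_fun setT Z by exact: measurable_energy_noise.
have mE (t : R) : measurable_fun setT (fun om => (expR (t * Z om))%:E).
  by apply/measurable_EFinP; apply: measurableT_comp => //; exact: measurable_funM.
apply: (@le_trans _ _ (\int[P]_om (s^-1%:E * ((expR (s * Z om))%:E + (expR (- s * Z om))%:E)))%E).
  apply: ge0_le_integral => //.
  - by apply/measurable_EFinP; exact: measurableT_comp.
  - by apply: emeasurable_funM => //; exact: emeasurable_funD.
  - move=> om _; rewrite -EFinD -EFinM lee_fin mulrC ler_pdivlMr// -/(Z om).
    have := expR_ge1Dx (s * Z om); have := expR_ge1Dx (- s * Z om).
    have := expR_gt0 (s * Z om); have := expR_gt0 (- s * Z om).
    case: (lerP 0 (Z om)) => z0.
      by rewrite ger0_norm//; lra.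
    by rewrite ltr0_norm//; lra.
rewrite ge0_integralZl_EFin//; last 3 first.
- by move=> om _; rewrite adde_ge0// lee_fin expR_ge0.
- exact: emeasurable_funD.
- by rewrite invr_ge0 ltW.
rewrite ge0_integralD//.
rewrite !energy_noise_mgf sqrrN -EFinD -EFinM lee_fin.
by rewrite le_eqVlt; apply/orP; left; apply/eqP; ring.
Qed.

End grid_noise.

Lemma measurable_path_coord (t : {t : R | t \in `]0, 1[}) :
  measurable_fun setT (fun y : obs_space R => y t).
Proof.
move=> _ B mB; rewrite setTI; apply: sub_sigma_algebra.
by exists t => //; exists B.
Qed.

Lemma measurable_to_obs d' (T : measurableType d') (Y : T -> obs_space R) :
  (forall t, measurable_fun setT (fun x => Y x t)) -> measurable_fun setT Y.
Proof.
move=> mY; apply: (@measurability _ _ T (obs_space R) setT _ (@cylinders R)) => //.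
move=> _ [_ [t _ [B mB <-]] <-].
by apply: mY.
Qed.

Lemma measurable_observation eps (S : L2 R) : measurable_fun setT (observation w eps S).
Proof.
apply: measurable_to_obs => t.
apply: measurable_funD => //; apply: measurable_funM => //; apply: mw.
by have := svalP t; rewrite in_itv/= => /andP[/ltW -> /ltW].
Qed.

(** Grids contain the endpoints of the unit interval, which are not observed:
    at 0 the path vanishes, at 1 it is recovered by continuity. *)
Definition path_ext (y : obs_space R) (t : R) : R :=
  if t <= 0 then 0 else
  let v s : R := if insub s is Some u then (y : path01 R) u else 0 in
  if t < 1 then v t else rlim (fun n => v (1 - n.+2%:R^-1)).

Lemma measurable_path_ext t : measurable_fun setT (path_ext ^~ t).
Proof.
have mv s : measurable_fun setT (fun y : obs_space R =>
    if insub s is Some u then (y : path01 R) u else 0 : R).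
  by case: insubP => [u _ _|_]; [exact: measurable_path_coord|exact: measurable_cst].
rewrite /path_ext; case: (t <= 0); first exact: measurable_cst.
case: (t < 1); first exact: mv.
by apply: measurable_rlim => n; exact: mv.
Qed.

Lemma primitive0 (S : R -> R) : primitive S 0 = 0.
Proof.
rewrite /primitive /ip (_ : (fun x => _) = cst 0).
  by rewrite /Rintegral integral0.
by apply/funext => x; rewrite /heav set_itv_ge ?bnd_simp ?ltxx// indic0 mulr0.
Qed.

Lemma primitive_cvg1 (S : L2 R) : primitive S (1 - n.+2%:R^-1) @[n --> \oo] --> primitive S 1.
Proof.
have sS := sqint_L2 S.
have u01 n : 0 <= 1 - (n.+2%:R^-1 : R) <= 1.
  by rewrite subr_ge0 invf_le1// ler1n/= lerBlDr lerDl invr_ge0.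
apply/cvgrPdist_le => e e0.
have c : Num.sqrt (n.+2%:R^-1) * L2norm S @[n --> \oo] --> 0.
  rewrite -(mul0r (L2norm S)); apply: cvgMl; rewrite -(@sqrtr0 R).
  apply: continuous_cvg; first exact: sqrt_continuous.
  by have := @cvg_harmonic R; rewrite -(cvg_shiftS) /=; exact.
have /cvgr_le/(_ _ e0) := c; apply: filterS => n; apply: le_trans.
have -> : primitive S 1 - primitive S (1 - n.+2%:R^-1) =
    ip S (fun x => heav 1 x - heav (1 - n.+2%:R^-1) x).
  by rewrite ipBr//; exact: sqint_heav.
apply: le_trans (ip_le_L2norm _ _) _; first by apply: sqintB; exact: sqint_heav.
rewrite le_eqVlt; apply/orP; left; apply/eqP; congr (Num.sqrt _ * _).
have one : 0 <= (1 : R) <= 1 by rewrite ler01 lexx.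
rewrite ip_sqrB; try exact: sqint_heav.
rewrite !ip_heav// !minxx min_r; last by case/andP: (u01 n).
by ring.
Qed.

Lemma path_ext_observation : {ae P, forall om, forall (eps : R) (S : L2 R) t, 0 <= t <= 1 ->
  path_ext (observation w eps S om) t = primitive S t + eps * w t om}.
Proof.
have [_ w0 _ _ wc] := hw.
apply: filterS2 w0 wc => om w0 wc eps S.
have inner t : 0 < t < 1 -> (if insub t is Some u then (observation w eps S om : path01 R) u else 0 : R) =
    primitive S t + eps * w t om.
  move=> t01; case: insubP => [u _ ut|].
    by rewrite /observation ut -primitiveE.
  by rewrite in_itv/= t01.
move=> t /andP[t0 t1]; rewrite /path_ext.
have [t0'|t0'] := leP t 0.
  have -> : t = 0 by apply/eqP; rewrite eq_le t0 t0'.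
  by rewrite w0 primitive0 mulr0 addr0.
have [t1'|t1'] := ltP t 1; first by rewrite inner// t0' t1'.
have -> : t = 1 by apply/eqP; rewrite eq_le t1 t1'.
have u01 n : 0 < 1 - (n.+2%:R^-1 : R) < 1.
  by rewrite subr_gt0 invf_lt1 ?ltr1n//= ltrBlDr ltrDl invr_gt0.
apply: rlim_cvg; under eq_fun do rewrite inner//.
apply: cvgD; first exact: primitive_cvg1.
apply: cvgMr.
have [_ _ wl] := (continuous_within_itvP _ ltr01).1 wc.
apply: (cvg_at_leftP _ _ _).1 wl _ _; split.
  by move=> n; have /andP[] := u01 n.
rewrite -[X in _ --> X]subr0; apply: cvgB; first exact: cvg_cst.
by have := @cvg_harmonic R; rewrite -(cvg_shiftS) /=; exact.
Qed.

Lemma energy_lin N (f g h k : R -> R) (c : R) : (0 < N)%N ->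
  (forall t, 0 <= t <= 1 -> g t = h t + c * k t) ->
  energy N f g = energy N f h + c * energy N f k.
Proof.
move=> N0 H; rewrite /energy mulrCA -mulrDr; congr (_ * _).
rewrite mulr_sumr -big_split/=; apply: eq_bigr => i _; rewrite /incr.
by rewrite !H ?grid01//; [ring|exact: ltnW].
Qed.

(** A bounded linear functional of the signal is estimated at rate [eps]: along
    a sparse sequence of grids the noise in the energies is a sum of Gaussian
    terms whose standard deviations decrease geometrically. *)
Lemma linear_functional_estimator (l : L2dual R) :
  exists hat : obs_space R -> R, measurable_fun setT hat /\
  exists2 C : R, 0 <= C & forall (eps : R) (S : L2 R), 0 < eps ->
    (\int[P]_om `|hat (observation w eps S om) - sval l S|%:E <= (eps * C)%:E)%E.
Proof.
pose lam := dual_primitive l.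
have [A HA] := energy_dual_bounded l.
have [nk [nkk hnk Hnk]] := @fast_subsequence R (fun n => energy (2 ^ n) lam lam) A
  (fun k => 4^-1 ^+ k.+1) (energy_dyadic_nondecreasing lam) HA
  (fun k => exprn_gt0 k.+1 (ltac:(by rewrite invr_gt0) : 0 < 4^-1 :> R)).
have N0 n : (0 < 2 ^ n)%N by rewrite expn_gt0.
pose W k om := energy (2 ^ nk k) lam (w ^~ om).
have mW k : measurable_fun setT (W k) by exact: measurable_energy_noise.
pose Z k om := W k.+1 om - W k om.
have mZ k : measurable_fun setT (Z k) by exact: measurable_funB.
pose c : R := 2 * expR (2^-1).
have c0 : 0 <= c by rewrite mulr_ge0// expR_ge0.
have Zc k : (\int[P]_om `|Z k om|%:E <= (c / (2 ^ k.+1)%:R)%:E)%E.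
  have nn := hnk _ _ (leqnSn k).
  have [h [Hh hh]] := @energy_refine_sub R (2 ^ nk k) (2 ^ (nk k.+1 - nk k)) lam (N0 _) (N0 _).
  rewrite -dyadic_split// in Hh hh.
  have -> : (fun om => `|Z k om|%:E) = (fun om => `|energy (2 ^ nk k.+1) h (w ^~ om)|%:E).
    by apply/funext => om; rewrite /Z /W Hh.
  (* the variance of [Z k] is at most [4^-(k+1)], which this exponent balances *)
  have s0 : 0 < (2 ^ k.+1)%:R :> R by rewrite ltr0n.
  apply: le_trans (energy_noise_abs (N0 _) h s0) _.
  rewrite lee_fin ler_pM2r ?invr_gt0// ler_pM2l// ler_expR hh.
  rewrite -[leRHS]mul1r ler_pM2r ?invr_gt0//.
  have e1 : (2 ^ k.+1)%:R ^+ 2 * 4^-1 ^+ k.+1 = 1 :> R.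
    rewrite natrX -exprM mulnC exprM -exprMn.
    by rewrite -[RHS](expr1n _ k.+1); congr (_ ^+ _); lra.
  by rewrite -[leRHS]e1 ler_wpM2l ?sqr_ge0//; exact: Hnk.
have [C0 C00 HC0] : exists2 C0 : R, 0 <= C0 & (\int[P]_om `|W 0 om|%:E <= C0%:E)%E.
  exists (2 * expR (1 ^+ 2 * energy (2 ^ nk 0) lam lam / 2) / 1); last exact: energy_noise_abs.
  by rewrite divr1 mulr_ge0// expR_ge0.
pose V om := (\sum_(0 <= k <oo) `|Z k om|%:E)%E.
have mV : measurable_fun setT V by exact: measurable_abs_sum.
have V0 om : (0 <= V om)%E by apply: nneseries_ge0 => k _ _; rewrite lee_fin.
pose hat (y : obs_space R) := rlim (fun k => energy (2 ^ nk k) lam (path_ext y)).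
have mhat : measurable_fun setT hat.
  apply: measurable_rlim => k; apply: measurable_funM => //; apply: measurable_sum => i.
  by apply: measurable_funM => //; apply: measurable_funB; exact: measurable_path_ext.
exists hat; split => //; exists (C0 + c); first exact: addr_ge0.
move=> eps S e0.
have mD : measurable_fun setT (fun om => `|hat (observation w eps S om) - sval l S|%:E).
  apply/measurable_EFinP; apply: measurableT_comp; first by [].
  apply: measurable_funB; last exact: measurable_cst.
  exact: measurableT_comp mhat (measurable_observation _ _).
apply: (@le_trans _ _ (\int[P]_om (eps%:E * (`|W 0 om|%:E + V om)))%E); last first.
  have mW0 : measurable_fun setT (fun om => `|W 0 om|%:E).
    by apply/measurable_EFinP; exact: measurableT_comp.
  rewrite ge0_integralZl_EFin//; last 3 first.
  - by move=> om _; rewrite adde_ge0// lee_fin.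
  - exact: emeasurable_funD.
  - exact: ltW.
  rewrite ge0_integralD// EFinM; apply: lee_wpmul2l; first by rewrite lee_fin ltW.
  by rewrite EFinD leeD//; exact: integral_abs_sum.
apply: ae_ge0_le_integral => //.
- move=> om _; apply: mule_ge0; first by rewrite lee_fin ltW.
  by apply: adde_ge0 => //; rewrite lee_fin.
- apply: emeasurable_funM; first by [].
  by apply: emeasurable_funD => //; apply/measurable_EFinP; exact: measurableT_comp.
apply: filterS2 path_ext_observation (abs_sum_ae_fin mZ c0 Zc) => om Hext Vfin _.
have [cZ boundZ] : cvgn (series (Z ^~ om)) /\ `|limn (series (Z ^~ om))| <= fine (V om).
  by apply: abs_summable_series; rewrite fineK.
have cW : W k om @[k --> \oo] --> W 0 om + limn (series (Z ^~ om)).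
  have -> : (fun k => W k om) = (fun k => W 0 om + series (Z ^~ om) k).
    apply/funext => k; rewrite /series/= (telescope_sumr (fun k => W k om))//.
    by rewrite addrC subrK.
  by apply: cvgD => //; exact: cvg_cst.
have cS : energy (2 ^ nk k) lam (primitive S) @[k --> \oo] --> sval l S.
  move=> B /(@dual_energy_cvg R l S B)[n _ nB]; exists n => // k /= nk'.
  by apply: nB; exact: leq_trans (nkk k).
have -> : hat (observation w eps S om) = sval l S + eps * (W 0 om + limn (series (Z ^~ om))).
  apply: rlim_cvg.
  have -> : (fun k => energy (2 ^ nk k) lam (path_ext (observation w eps S om))) =
      (fun k => energy (2 ^ nk k) lam (primitive S) + eps * W k om).
    by apply/funext => k; apply: energy_lin => // t; exact: Hext.
  by apply: cvgD => //; exact: cvgMr.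
rewrite addrAC subrr add0r normrM gtr0_norm// EFinM.
apply: lee_wpmul2l; first by rewrite lee_fin ltW.
rewrite -[V om]fineK// -EFinD lee_fin; apply: le_trans (ler_normD _ _) _.
by rewrite lerD2l.
Qed.

End observation.

(** * Disjoint closures imply distinguishability *)

Section separation.
Context (R : realType).

(** A finite-dimensional projection separates the hypotheses: otherwise pairs
    of signals with nearly equal projections would have, along an ultrafilter,
    a common weak limit. *)
Lemma separating_functionals (Theta0 Theta1 : set (L2 R)) : L2bounded Theta0 ->
  weak_closure Theta0 `&` weak_closure Theta1 = set0 ->
  exists ls : seq (L2dual R), exists2 delta : R, 0 < delta & forall S0 S1,
    Theta0 S0 -> Theta1 S1 -> exists2 l, l \in ls & delta <= `|sval l S0 - sval l S1|.
Proof.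
move=> [M HM] disj; apply: contrapT => nosep.
pose T := {p : L2 R * L2 R | Theta0 p.1 /\ Theta1 p.2}.
pose B (x : seq (L2dual R) * R) : set T :=
  [set p | forall l, l \in x.1 -> `|sval l (sval p).1 - sval l (sval p).2| < x.2].
pose D : set (seq (L2dual R) * R) := [set x | 0 < x.2].
have FF : Filter (filter_from D B).
  apply: filter_from_filter; first by exists ([::], 1) => /=; exact: ltr01.
  move=> [s1 e1] [s2 e2] /= e10 e20; exists (s1 ++ s2, Num.min e1 e2).
    by rewrite /D/= lt_min e10.
  move=> p Bp; split=> l ls; have := Bp l; rewrite /= mem_cat ls ?orbT lt_min => /(_ isT)/andP[] //.
have PF : ProperFilter (filter_from D B).
  apply: filter_from_proper => -[s e] /= e0; apply: contrapT => Bn; apply: nosep.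
  exists s, e => // S0 S1 h0 h1; apply: contrapT => nl; apply: Bn.
  exists (exist _ (S0, S1) (conj h0 h1)) => l ls /=; rewrite ltNge; apply/negP => h.
  by apply: nl; exists l.
have [U [UU FU]] := ultraFilterLemma PF.
have bd (p : T) : L2norm (sval p).1 <= M by apply: HM; case: (svalP p).
have [S HS] := weak_ultra_limit UU bd.
have HS1 (l : L2dual R) : sval l (sval p).2 @[p --> U] --> sval l S.
  have -> : sval l S = sval l S - 0 by rewrite subr0.
  have -> : (fun p : T => sval l (sval p).2) =
      (fun p : T => sval l (sval p).1 - (sval l (sval p).1 - sval l (sval p).2)).
    by apply/funext => p; ring.
  apply: cvgB; first exact: HS.
  apply/cvgr0Pnorm_lt => e e0; apply: FU; exists ([:: l], e) => // p Bp.
  by apply: Bp; rewrite mem_head.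
have : (weak_closure Theta0 `&` weak_closure Theta1) S.
  split.
    by apply: (@weak_closure_cvg R T U _ (fun p => (sval p).1)) => // p; case: (svalP p).
  by apply: (@weak_closure_cvg R T U _ (fun p => (sval p).2)) => // p; case: (svalP p).
by rewrite disj.
Qed.

End separation.

Section floor_measurability.
Context (R : realType) d (T : measurableType d) (I : eqType) (f : I -> T -> R).
Hypothesis mf : forall i, measurable_fun setT (f i).

(** A set depending on finitely many measurable functions only through their
    integer parts is measurable, whatever the dependence, since only countably
    many values are involved. *)
Lemma measurable_floor_invariant (s : seq I) (A : set T) :
  (forall x y, (forall i, i \in s -> Num.floor (f i x) = Num.floor (f i y)) -> A x -> A y) ->
  measurable A.
Proof.
elim: s A => [A HA|i s IH A HA].
  have [[x Ax]|A0] := pselect (exists x, A x).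
    by rewrite (_ : A = setT)//; apply/seteqP; split=> // y _; exact: (HA x).
  by rewrite (_ : A = set0)//; apply/seteqP; split=> // y Ay; apply: A0; exists y.
pose A_ n := [set y | exists2 x, A x & Num.floor (f i x) = n /\
  forall j, j \in s -> Num.floor (f j x) = Num.floor (f j y)].
have -> : A = \bigcup_(n in [set: int]) (A_ n `&` f i @^-1` `[n%:~R, (n + 1)%:~R[).
  apply/seteqP; split=> [y Ay|y [n _ [[x Ax [xn xy]]]]].
    exists (Num.floor (f i y)) => //; split; first by exists y.
    by rewrite /= in_itv/=; exact: floor_itv.
  rewrite /= in_itv/= -floor_eq => /eqP yn.
  by apply: HA Ax => j; rewrite inE => /predU1P[->|/xy//]; rewrite xn.
apply: countable_bigcupT_measurable => [|n]; first exact: countableP.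
apply: measurableI.
  apply: IH => y z yz [x Ax [xn xy]]; exists x => //; split => // j js.
  by rewrite xy// yz.
by rewrite -[X in measurable X]setTI; apply: mf.
Qed.

End floor_measurability.

Section distinguishability.
Context (R : realType) d (Omega : measurableType d) (P : probability Omega R).
Variable w : R -> Omega -> R.
Hypothesis hw : wiener_process P w.

Lemma sup_image_bound (T : Type) (A : set T) (f : T -> R) (c : R) : 0 <= c ->
  (forall x, A x -> 0 <= f x <= c) -> 0 <= sup [set f x | x in A] <= c.
Proof.
move=> c0 H; have [[x Ax]|A0] := pselect (exists x, A x); last first.
  rewrite (_ : [set f x | x in A] = set0) ?sup0 ?lexx//.
  by apply/seteqP; split=> // r [x Ax _]; apply: A0; exists x.
have ub : ubound [set f x | x in A] c by move=> _ [y Ay <-]; have /andP[] := H _ Ay.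
apply/andP; split; last by apply: ge_sup => //; exists (f x), x.
by have /andP[fx0 _] := H _ Ax; apply: le_trans fx0 _; apply: ub_le_sup; [exists c|exists x].
Qed.

(** Markov's inequality: an error of the test costs at most the sum of the
    estimation errors in units of [eta]. *)
Let risk_bound (hat : L2dual R -> obs_space R -> R) (C : L2dual R -> R) (eta eps : R)
    (ls : seq (L2dual R)) (S : L2 R) (K : obs_space R -> R) :
  (forall l, measurable_fun setT (hat l)) ->
  (forall l, (\int[P]_om `|hat l (observation w eps S om) - sval l S|%:E <= (eps * C l)%:E)%E) ->
  0 < eta -> measurable_fun setT K ->
  (forall y, 0 <= K y <= \sum_(l <- ls) `|hat l y - sval l S| / eta) ->
  0 <= fine 'E_P[fun om => K (observation w eps S om)] <= eps * \sum_(l <- ls) (C l / eta).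
Proof.
move=> mhat hC eta0 mK HK; rewrite unlock.
have mo := measurable_observation hw eps S.
have K0 : (0 <= \int[P]_om (K (observation w eps S om))%:E)%E.
  by apply: integral_ge0 => om _; rewrite lee_fin; have /andP[] := HK (observation w eps S om).
have mterm l : measurable_fun setT (fun om => (`|hat l (observation w eps S om) - sval l S| / eta)%:E).
  apply/measurable_EFinP; apply: measurable_funM; last exact: measurable_cst.
  apply: measurableT_comp; first by [].
  apply: measurable_funB; last exact: measurable_cst.
  exact: measurableT_comp (mhat l) mo.
have Kle : (\int[P]_om (K (observation w eps S om))%:E <= (eps * \sum_(l <- ls) (C l / eta))%:E)%E.
  apply: (@le_trans _ _ (\int[P]_om (\sum_(l <- ls) (`|hat l (observation w eps S om) - sval l S| / eta)%:E))%E).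
    apply: ge0_le_integral => //.
    - by move=> om _; rewrite lee_fin; have /andP[] := HK (observation w eps S om).
    - by apply/measurable_EFinP; exact: measurableT_comp mK mo.
    - by apply: emeasurable_sum => l; exact: mterm.
    - by move=> om _; rewrite sumEFin lee_fin; have /andP[] := HK (observation w eps S om).
  rewrite ge0_integral_sum//; last first.
    by move=> l om _; rewrite lee_fin divr_ge0// ltW.
  rewrite mulr_sumr -sumEFin; apply: lee_sum => l _.
  rewrite mulrA EFinM muleC.
  under eq_integral do rewrite mulrC EFinM.
  rewrite ge0_integralZl_EFin//; last 2 first.
  - apply/measurable_EFinP; apply: measurableT_comp; first by [].
    apply: measurable_funB; last exact: measurable_cst.
    exact: measurableT_comp (mhat l) mo.
  - by rewrite invr_ge0 ltW.
  by apply: lee_wpmul2l; [rewrite lee_fin invr_ge0 ltW|exact: hC].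
have Kf : (\int[P]_om (K (observation w eps S om))%:E \is a fin_num)%E.
  by rewrite ge0_fin_numE//; apply: le_lt_trans Kle _; rewrite ltry.
by apply/andP; split; rewrite -lee_fin fineK.
Qed.

Lemma distinguishable_disjoint (Theta0 Theta1 : set (L2 R)) : L2bounded Theta0 ->
  weak_closure Theta0 `&` weak_closure Theta1 = set0 ->
  distinguishable P w Theta0 Theta1.
Proof.
move=> bd disj.
have [ls [delta d0 sep]] := separating_functionals bd disj.
have /choice[hat] := linear_functional_estimator hw.
move=> /all_and2[mhat /(_ _)/cid2-/all_sig2[C C0 HC]].
pose eta : R := delta / 8.
have eta0 : 0 < eta by rewrite divr_gt0.
pose z l y := (Num.floor (hat l y / eta))%:~R * eta.
have zhat l y : z l y <= hat l y < z l y + eta.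
  have := floor_itv (hat l y / eta).
  rewrite ler_pdivlMr// ltr_pdivrMr// intrD mulrDl mul1r//.
(* [z] rounds within [eta]: if no estimate errs by more than [eta], the true
   functionals of an accepted path are within [4 * eta], hence less than
   [delta], of those of some signal in [Theta0] *)
pose accept := [set y | exists2 S0, Theta0 S0 & forall l, l \in ls -> `|z l y - sval l S0| <= 2 * eta].
have mA : measurable accept.
  apply: (@measurable_floor_invariant R _ (obs_space R) (L2dual R) (fun l y => hat l y / eta) _ ls).
    by move=> l; apply: measurable_funM; [exact: mhat|exact: measurable_cst].
  move=> x y xy [S0 h0 H]; exists S0 => // l ll; have := H _ ll.
  by rewrite /z xy.
pose K y : R := \1_(~` accept) y.
have mK : measurable_fun setT K by apply: measurable_indic; exact: measurableC.
have mK' : measurable_fun setT (fun y => 1 - K y).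
  by apply: measurable_funB; [exact: measurable_cst|exact: mK].
have K01 y : 0 <= K y <= 1 by rewrite /K indicE; case: (_ \in _); rewrite !lexx ?ler01.
have sum_ge0 y S : 0 <= \sum_(l <- ls) `|hat l y - sval l S| / eta.
  by apply: sumr_ge0 => l _; rewrite divr_ge0// ltW.
have bad y S : (exists2 l, l \in ls & eta < `|hat l y - sval l S|) ->
    1 <= \sum_(l <- ls) `|hat l y - sval l S| / eta.
  move=> [l ll h]; rewrite (big_rem l)//=.
  rewrite -[leLHS]addr0 lerD//; first by rewrite ler_pdivlMr// mul1r ltW.
  by apply: sumr_ge0 => l' _; rewrite divr_ge0// ltW.
have err0 S : Theta0 S -> forall y, 0 <= K y <= \sum_(l <- ls) `|hat l y - sval l S| / eta.
  move=> hS y; have /andP[-> _] /= := K01 y.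
  have [ay|ny] := pselect (accept y); first by rewrite /K indicE memNset.
  rewrite /K indicE mem_set//; apply: bad; apply: contrapT => nl; apply: ny.
  exists S => // l ll; have : `|hat l y - sval l S| <= eta.
    by rewrite leNgt; apply/negP => h; apply: nl; exists l.
  by have := zhat l y; rewrite !ler_norml; lra.
have err1 S : Theta1 S -> forall y, 0 <= 1 - K y <= \sum_(l <- ls) `|hat l y - sval l S| / eta.
  move=> hS y; have /andP[k0 k1] := K01 y; rewrite subr_ge0 k1/=.
  have [ay|ny] := pselect (accept y); last by rewrite /K indicE mem_set// subrr.
  rewrite /K indicE memNset// subr0; apply: bad; apply: contrapT => nl.
  have [S0 hS0 H] := ay; have [l ll] := sep _ _ hS0 hS.
  have h2 : `|hat l y - sval l S| <= eta.
    by rewrite leNgt; apply/negP => h; apply: nl; exists l.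
  have h1 := zhat l y; have h3 := H _ ll.
  rewrite leNgt; move/negP; apply.
  by move: h1 h2 h3; rewrite ltr_norml !ler_norml /eta; lra.
pose c := \sum_(l <- ls) (C l / eta).
have c0 : 0 <= c by apply: sumr_ge0 => l _; rewrite divr_ge0// ltW.
have tends (f : R -> R) : (forall eps, 0 < eps -> 0 <= f eps <= eps * c) -> f eps @[eps --> 0^'+] --> 0.
  move=> Hf; apply: (@squeeze_cvgr _ _ _ _ (cst 0) (fun eps => eps * c)).
  - by near=> eps; apply: Hf; near: eps; exact: nbhs_right_gt.
  - exact: cvg_cst.
  - rewrite -[X in _ --> X](mul0r c); apply: cvgMl; exact: cvg_at_right_filter.
exists (fun=> K); split.
- by move=> eps _; split.
- apply: tends => eps e0; apply: sup_image_bound => [|S hS]; first by rewrite mulr_ge0// ltW.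
  apply: (risk_bound (C := C) mhat) => //; last exact: err0.
  by move=> l; exact: HC.
- apply: tends => eps e0; apply: sup_image_bound => [|S hS]; first by rewrite mulr_ge0// ltW.
  apply: (risk_bound (C := C) (K := fun y => 1 - K y) mhat) => //; last exact: err1.
  by move=> l; exact: HC.
Unshelve. all: by end_near. Qed.

End distinguishability.

(** * Domination of the laws of observations by the law of the noise *)

Lemma measure_add_fin d (T : measurableType d) (R : realType)
  (m1 m2 : {finite_measure set T -> \bar R}) : fin_num_fun (measure_add m1 m2).
Proof. by move=> A mA; rewrite measure_addE fin_numD !fin_num_measure. Qed.

HB.instance Definition _ d (T : measurableType d) (R : realType)
  (m1 m2 : {measure set T -> \bar R}) := Measure.on (measure_add m1 m2).
HB.instance Definition _ d (T : measurableType d) (R : realType)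
  (m1 m2 : {finite_measure set T -> \bar R}) :=
  @Measure_isFinite.Build _ _ _ (measure_add m1 m2) (@measure_add_fin _ _ _ m1 m2).

Section domination.
Context (R : realType) d (Omega : measurableType d) (P : probability Omega R).
Variable w : R -> Omega -> R.
Hypothesis hw : wiener_process P w.

Let mw t : 0 <= t <= 1 -> measurable_fun setT (w t).
Proof. by have [H _ _ _ _] := hw; exact: H. Qed.

Definition path_coord (t : {t : R | t \in `]0, 1[}) (y : obs_space R) : R := y t.

(** One function approximates [h] for the laws of both [Y1] and [Y2]: it does so
    for their sum. *)
Lemma cylinder_approximation2 (Y1 Y2 : Omega -> obs_space R) (h : obs_space R -> R) (e : R) :
  measurable_fun setT Y1 -> measurable_fun setT Y2 ->
  measurable_fun setT h -> (forall y, 0 <= h y <= 1) -> 0 < e ->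
  exists2 F, cylinder_fun path_coord F &
    (\int[P]_om `|h (Y1 om) - F (Y1 om)|%:E <= e%:E)%E /\
    (\int[P]_om `|h (Y2 om) - F (Y2 om)|%:E <= e%:E)%E.
Proof.
move=> mY1 mY2 mh h01 e0.
pose Z1 : {mfun Omega >-> obs_space R} := HB.pack Y1 (isMeasurableFun.Build _ _ _ _ _ mY1).
pose Z2 : {mfun Omega >-> obs_space R} := HB.pack Y2 (isMeasurableFun.Build _ _ _ _ _ mY2).
have [F cF] := @approximation_by_cylinder_fun _ _ R _ path_coord
  (measure_add (distribution P Z1) (distribution P Z2))
  (@measurable_path_coord R) (fun A mA => mA) h mh h01 e e0.
have [mF _ _] := cF.
have mhF : measurable_fun setT (fun y => `|h y - F y|%:E).
  by apply/measurable_EFinP; apply: measurableT_comp => //; exact: measurable_funB.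
rewrite ge0_integral_measure_add// !ge0_integral_distribution// => H.
exists F => //; split; apply: le_trans H.
- by apply: leeDl; apply: integral_ge0 => om _; rewrite lee_fin.
- by apply: leeDr; apply: integral_ge0 => om _; rewrite lee_fin.
Qed.

Definition noise_path (eps : R) (om : Omega) : obs_space R := fun t => eps * w (val t) om.

Lemma measurable_noise_path eps : measurable_fun setT (noise_path eps).
Proof.
apply: measurable_to_obs => t; apply: measurable_funM => //; apply: mw.
by have := svalP t; rewrite in_itv/= => /andP[/ltW -> /ltW].
Qed.

Lemma cylinder_fun_eq (F : obs_space R -> R) : cylinder_ucont path_coord F ->
  exists s : seq {t : R | t \in `]0, 1[}, forall x y,
    (forall t, t \in s -> x t = y t) -> F x = F y.
Proof.
move=> [s Hs]; exists s => x y xy; apply/eqP; rewrite -subr_eq0 -normr_le0.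
apply/ler_addgt0Pl => e e0; rewrite addr0; have [eta eta0 H] := Hs _ e0.
by apply: ltW; apply: H => t ts; rewrite /path_coord xy// subrr normr0.
Qed.

(** Adding a signal to the noise path multiplies its law by a density whose
    second moment is controlled by the norm of the signal: on finitely many
    coordinates this is the Gaussian shift of the increments, and the bound is
    uniform in the number of coordinates by Bessel's inequality. *)
Lemma shift_domination_cylinder (F : obs_space R -> R) (eps a : R) (S : L2 R) :
  cylinder_fun path_coord F -> 0 < eps -> 0 < a ->
  (\int[P]_om (F (observation w eps S om))%:E <=
   (a / 2)%:E * \int[P]_om (F (noise_path eps om))%:E +
   (expR (ip S S / eps ^+ 2) / (2 * a))%:E)%E.
Proof.
move=> [mF F01 uF] e0 a0; have [s Hs] := cylinder_fun_eq uF.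
have [_ w0 lawW indW _] := hw.
(* with 0 added, the values of the noise at the times of [s] become sums of
   independent increments *)
pose ts := sort <=%O (undup (map val s)) : seq R.
have ts01 x : x \in ts -> 0 < x < 1.
  rewrite mem_sort mem_undup => /mapP[u _ ->].
  by have := svalP u; rewrite in_itv.
have pts : path <%O 0 ts.
  rewrite path_min_sorted ?sort_lt_sorted ?undup_uniq//.
  by apply/allP => x /ts01/andP[].
pose n := size ts; pose t i := nth 0 (0 :: ts) i.
have tS i : (i < n)%N -> t i < t i.+1 by move=> iN; exact: (pathP 0 pts).
have t01 i : (i <= n)%N -> 0 <= t i <= 1.
  case: i => [|i] iN; first by rewrite /t/= lexx ler01.
  by have /andP[/ltW -> /ltW ->] : 0 < t i.+1 < 1 by apply: ts01; exact: mem_nth.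
pose X (i : 'I_n) om := w (t i.+1) om - w (t i) om.
have mX i : measurable_fun setT (X i).
  by apply: measurable_funB; apply: mw; apply: t01 => //; exact: ltnW.
have iX : mutually_independent P X.
  apply: (indW n t) => //; first by move=> i /tS/ltW.
  by have /andP[] := t01 n (leqnn n).
pose sd (i : 'I_n) := Num.sqrt (t i.+1 - t i).
have sd0 i : sd i != 0 by rewrite gt_eqF// sqrtr_gt0 subr_gt0; exact: tS.
have lawX i B : measurable B -> P (X i @^-1` B) = normal_prob 0 (sd i) B.
  move=> mB; apply: lawW => //; last 2 first.
  - exact: tS.
  - by have /andP[] := t01 _ (ltn_ord i).
  - by have /andP[] := t01 _ (ltnW (ltn_ord i)).
pose mu (i : 'I_n) := (primitive S (t i.+1) - primitive S (t i)) / eps.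
pose idx (u : {t : R | t \in `]0, 1[}) := index (val u) (0 :: ts).
(* a path that takes the partial sums of [v] at these times *)
pose rec (v : vec_space R n) : obs_space R :=
  fun u => eps * \sum_(i < n) (if (i < idx u)%N then v i else 0).
have mrec : measurable_fun setT rec.
  apply: measurable_to_obs => u; apply: measurable_funM => //.
  apply: measurable_sum => i; case: (i < idx u)%N; first exact: measurable_coord.
  exact: measurable_cst.
have recE u (f : nat -> R) : u \in s ->
    \sum_(i < n) (if (i < idx u)%N then f i.+1 - f i else 0) = f (idx u) - f 0%N /\
    t (idx u) = val u.
  move=> us; have uts : val u \in 0 :: ts.
    by rewrite inE mem_sort mem_undup map_f ?orbT.
  split; last exact: nth_index.
  have idn : (idx u <= n)%N by have := uts; rewrite -index_mem.
  rewrite -big_mkcond -(big_ord_widen _ (fun i => f i.+1 - f i))//.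
  by rewrite -(big_mkord xpredT (fun i => f i.+1 - f i)) telescope_sumr.
pose G (v : vec_space R n) := F (rec v).
have mG : measurable_fun setT G by exact: measurableT_comp mF mrec.
have H := translation_domination mu mX sd0 iX lawX mG (fun v => F01 (rec v)) a0.
have mZ : measurable_fun setT (fun om => (fun i => X i om) : vec_space R n).
  exact: measurable_vec.
have mZmu : measurable_fun setT (fun om => (fun i => X i om + mu i) : vec_space R n).
  by apply: (@measurable_vec _ _ _ _ (fun i om => X i om + mu i)) => i; exact: measurable_funD.
have F0 y : (0 <= (F y)%:E)%E by rewrite lee_fin; have /andP[] := F01 y.
have -> : (\int[P]_om (F (observation w eps S om))%:E =
    \int[P]_om (G (fun i => X i om + mu i)%R)%:E)%E.
  apply: ge0_ae_eq_integral => //.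
  - by apply/measurable_EFinP; exact: measurableT_comp mF (measurable_observation hw _ _).
  - by apply/measurable_EFinP; exact: measurableT_comp mG mZmu.
  - by move=> om _; exact: F0.
  apply: filterS w0 => om w0 _; congr EFin; apply: Hs => u us.
  have [e1 e2] := recE u (fun i => w (t i) om + primitive S (t i) / eps) us.
  rewrite /observation -primitiveE /rec.
  under eq_bigr => i _.
    rewrite (_ : X i om + mu i = (w (t i.+1) om + primitive S (t i.+1) / eps) -
      (w (t i) om + primitive S (t i) / eps)); last by rewrite /X /mu; ring.
    over.
  rewrite e1 e2 [t 0%N]/= w0 primitive0.
  by field; rewrite gt_eqF.
have -> : (\int[P]_om (F (noise_path eps om))%:E = \int[P]_om (G (fun i => X i om))%:E)%E.
  apply: ge0_ae_eq_integral => //.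
  - by apply/measurable_EFinP; exact: measurableT_comp mF (measurable_noise_path _).
  - by apply/measurable_EFinP; exact: measurableT_comp mG mZ.
  - by move=> om _; exact: F0.
  apply: filterS w0 => om w0 _; congr EFin; apply: Hs => u us.
  have [e1 e2] := recE u (fun i => w (t i) om) us.
  by rewrite /noise_path /rec e1 e2 [t 0%N]/= w0 subr0.
apply: le_trans H _; apply: leeD2l; rewrite lee_fin ler_pM2r ?invr_gt0 ?mulr_gt0//.
rewrite ler_expR.
have t0 : 0 <= t 0%N by rewrite /t/=.
have tn : t n <= 1 by have /andP[] := t01 n (leqnn n).
rewrite ler_pdivlMr ?exprn_gt0//; apply: le_trans (bessel t0 tn tS (sqint_L2 S)).
rewrite mulr_suml; apply: ler_sum => i _; rewrite le_eqVlt; apply/orP; left; apply/eqP.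
rewrite /mu /sd sqr_sqrtr; last by rewrite subr_ge0 ltW// tS.
have dt0 : t i.+1 - t i != 0 by rewrite gt_eqF// subr_gt0; exact: tS.
have en0 : eps != 0 by rewrite gt_eqF.
by field; rewrite dt0.
Qed.

(** The bound extends from cylinder functions to all test functions since both
    of its sides are continuous in [h] for the mean under the two laws. *)
Lemma shift_domination (h : obs_space R -> R) (eps a : R) (S : L2 R) :
  measurable_fun setT h -> (forall y, 0 <= h y <= 1) -> 0 < eps -> 0 < a ->
  (\int[P]_om (h (observation w eps S om))%:E <=
   (a / 2)%:E * \int[P]_om (h (noise_path eps om))%:E +
   (expR (ip S S / eps ^+ 2) / (2 * a))%:E)%E.
Proof.
move=> mh h01 e0 a0; apply/lee_addgt0Pr => e ep.
have mY := measurable_observation hw eps S; have mN := measurable_noise_path eps.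
have a20 : 0 < a / 2 by rewrite divr_gt0.
pose k := e / (1 + a / 2).
have k0 : 0 < k by rewrite divr_gt0// addr_gt0.
have [F cF [HY HN]] := cylinder_approximation2 mY mN mh h01 k0.
have [mF F01 _] := cF.
have le_int (f g : obs_space R -> R) (Y : Omega -> obs_space R) :
    measurable_fun setT Y -> measurable_fun setT f -> measurable_fun setT g ->
    (forall y, 0 <= f y <= 1) -> (forall y, 0 <= g y <= 1) ->
    (\int[P]_om (f (Y om))%:E <= \int[P]_om (g (Y om))%:E + \int[P]_om `|f (Y om) - g (Y om)|%:E)%E.
  move=> mY' mf mg f01 g01.
  have mfY : measurable_fun setT (fun om => f (Y om)) by exact: measurableT_comp mf mY'.
  have mgY : measurable_fun setT (fun om => g (Y om)) by exact: measurableT_comp mg mY'.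
  have md : measurable_fun setT (fun om => `|f (Y om) - g (Y om)|%:E).
    by apply/measurable_EFinP; apply: measurableT_comp => //; exact: measurable_funB.
  have g0 om : (0 <= (g (Y om))%:E)%E by rewrite lee_fin; have /andP[] := g01 (Y om).
  rewrite -ge0_integralD//; last by apply/measurable_EFinP.
  apply: ge0_le_integral => //.
  - by move=> om _; rewrite lee_fin; have /andP[] := f01 (Y om).
  - exact/measurable_EFinP.
  - by apply: emeasurable_funD => //; exact/measurable_EFinP.
  - by move=> om _; rewrite -EFinD lee_fin -lerBlDl ler_norm.
apply: le_trans (le_int h F _ mY mh mF h01 F01) _.
apply: le_trans (leeD (shift_domination_cylinder S cF e0 a0) HY) _.
have HN' : (\int[P]_om `|F (noise_path eps om) - h (noise_path eps om)|%:E <= k%:E)%E.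
  by under eq_integral do rewrite distrC.
have := le_int F h _ mN mF mh F01 h01 => /le_trans/(_ (leeD2l _ HN')) H1.
apply: (@le_trans _ _ ((a / 2)%:E * (\int[P]_om (h (noise_path eps om))%:E + k%:E) +
  (expR (ip S S / eps ^+ 2) / (2 * a))%:E + k%:E)%E).
  by rewrite leeD2r// leeD2r// lee_wpmul2l// lee_fin ltW.
have I0 : (0 <= \int[P]_om (h (noise_path eps om))%:E)%E.
  by apply: integral_ge0 => om _; rewrite lee_fin; have /andP[] := h01 (noise_path eps om).
have k0' : (0 <= k%:E)%E by rewrite lee_fin ltW.
rewrite ge0_muleDr// -!addeA leeD2l// addeCA leeD2l//.
rewrite -EFinM -EFinD lee_fin /k le_eqVlt; apply/orP; left; apply/eqP.
by field; rewrite gt_eqF// addr_gt0.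
Qed.

End domination.

(** * Distinguishability implies disjoint closures *)

Section converse.
Context (R : realType) d (Omega : measurableType d) (P : probability Omega R).
Variable w : R -> Omega -> R.
Hypothesis hw : wiener_process P w.

(** On a bounded set of signals every test has, up to a small error, the power
    of a cylinder function; the latter depends on the signal through finitely
    many values of its primitive, in a uniformly continuous way. *)
Lemma power_weakly_close (K : obs_space R -> R) (eps M e : R) :
  is_test K -> 0 < eps -> 0 < e -> exists s : seq R, exists2 eta : R, 0 < eta &
  forall S0 S1 : L2 R, L2norm S0 <= M -> L2norm S1 <= M ->
    (forall t, t \in s -> `|primitive S1 t - primitive S0 t| < eta) ->
    (\int[P]_om (K (observation w eps S1 om))%:E <=
     \int[P]_om (K (observation w eps S0 om))%:E + e%:E)%E.
Proof.
move=> [mK K01] eps0 e0.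
pose C := expR (M ^+ 2 / eps ^+ 2); have C0 : 0 < C by exact: expR_gt0.
(* [a / 2 * k + C / (2 * a) = e / 3] *)
pose a := 3 * C / e; have a0 : 0 < a by rewrite divr_gt0// mulr_gt0.
pose k := e / (3 * a); have k0 : 0 < k by rewrite divr_gt0// mulr_gt0.
have mN := measurable_noise_path hw eps.
have [F [mF F01 [s Hs]] [HN _]] := @cylinder_approximation2 R _ Omega P _ _ K k mN mN mK K01 k0.
have e30 : 0 < e / 3 by rewrite divr_gt0.
have [eta eta0 HF] := Hs _ e30.
exists (map val s), eta => // S0 S1 S0M S1M close.
have mh : measurable_fun setT (fun y => `|K y - F y|).
  by apply: measurableT_comp => //; exact: measurable_funB.
have h01 y : 0 <= `|K y - F y| <= 1.
  by rewrite normr_ge0/= ler_norml; have := K01 y; have := F01 y; lra.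
have err S : L2norm S <= M -> (\int[P]_om `|K (observation w eps S om) - F (observation w eps S om)|%:E <= (e / 3)%:E)%E.
  move=> SM.
  apply: le_trans (shift_domination hw S mh h01 eps0 a0) _.
  apply: (@le_trans _ _ ((a / 2)%:E * k%:E + (C / (2 * a))%:E)%E).
    apply: leeD; first by apply: lee_wpmul2l => //; rewrite lee_fin divr_ge0// ltW.
    have a2 : 0 < (2 * a)^-1 by rewrite invr_gt0 mulr_gt0.
    have ie : 0 < (eps ^+ 2)^-1 by rewrite invr_gt0 exprn_gt0.
    rewrite lee_fin (ler_pM2r a2) ler_expR (ler_pM2r ie).
    by rewrite -L2norm_sqr ler_pXn2r ?nnegrE ?L2norm_ge0//; exact: le_trans (L2norm_ge0 S) SM.
  rewrite -EFinM -EFinD lee_fin le_eqVlt; apply/orP; left; apply/eqP.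
  have en0 : e != 0 by rewrite gt_eqF.
  have Cn0 : C != 0 by rewrite gt_eqF.
  by rewrite /k /a; field; rewrite en0 Cn0.
have mY S := measurable_observation hw eps S.
have mKY S : measurable_fun setT (fun om => (K (observation w eps S om))%:E).
  by apply/measurable_EFinP; exact: measurableT_comp mK (mY S).
have mhY S : measurable_fun setT (fun om => `|K (observation w eps S om) - F (observation w eps S om)|%:E).
  by apply/measurable_EFinP; exact: measurableT_comp mh (mY S).
have K0 y : (0 <= (K y)%:E)%E by rewrite lee_fin; have /andP[] := K01 y.
apply: (@le_trans _ _ (\int[P]_om ((K (observation w eps S0 om))%:E +
   (`|K (observation w eps S0 om) - F (observation w eps S0 om)|%:E +
   (`|K (observation w eps S1 om) - F (observation w eps S1 om)|%:E + cst (e / 3)%:E om))))%E).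
  apply: ge0_le_integral => //.
  - by apply: emeasurable_funD => //; apply: emeasurable_funD => //; exact: emeasurable_funD.
  - move=> om _; rewrite -!EFinD lee_fin.
    have : `|F (observation w eps S1 om) - F (observation w eps S0 om)| < e / 3.
      apply: HF => t ts; rewrite /path_coord /observation -!primitiveE.
      by rewrite opprD addrACA subrr addr0; apply: close; exact: map_f.
    rewrite ltr_norml => /andP[_ h3].
    have h1 := ler_norm (K (observation w eps S1 om) - F (observation w eps S1 om)).
    have h2 := ler_norm (- (K (observation w eps S0 om) - F (observation w eps S0 om))).
    by rewrite normrN in h2; lra.
have e3e : (0 <= (e / 3)%:E)%E by rewrite lee_fin ltW.
rewrite ge0_integralD//; last 2 first.
- by move=> om _; rewrite !adde_ge0.
- by apply: emeasurable_funD => //; exact: emeasurable_funD.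
rewrite ge0_integralD//; last 2 first.
- by move=> om _; rewrite adde_ge0.
- exact: emeasurable_funD.
have cstE : (\int[P]_om cst (e / 3)%:E om = (e / 3)%:E)%E.
  by rewrite integral_cst// -[RHS]mule1; congr (_ * _)%E; exact: probability_setT.
rewrite ge0_integralD// cstE; apply: leeD2l.
rewrite (_ : e%:E = (e / 3)%:E + ((e / 3)%:E + (e / 3)%:E))%E; last by rewrite -!EFinD; congr EFin; field.
by apply: leeD; [exact: err|apply: leeD2r; exact: err].
Qed.

Lemma weak_nbhs_primitives (S : L2 R) (s : seq R) (eta : R) : 0 < eta ->
  nbhs (S : weakL2 R) [set S' : L2 R |
    forall t, t \in s -> `|primitive S' t - primitive S t| < eta].
Proof.
move=> eta0; elim: s => [|t s IH]; first exact: (@filterS (weakL2 R) (nbhs (S : weakL2 R)) _ setT _ _ filterT).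
apply: (@filterS2 (weakL2 R) (nbhs (S : weakL2 R)) _ _ _ _ _ (weak_nbhs_primitive S t eta0) IH) => S' h1 h2 u.
by rewrite inE => /predU1P[->//|]; exact: h2.
Qed.

(** With both errors below 1/4, a common point of the closures would have nearby
    signals in both hypotheses whose powers differ by at most 1/4, whereas
    they should differ by more than 1/2. *)
Lemma disjoint_of_distinguishable (Theta0 Theta1 : set (L2 R)) :
  L2bounded Theta0 -> L2bounded Theta1 -> distinguishable P w Theta0 Theta1 ->
  weak_closure Theta0 `&` weak_closure Theta1 = set0.
Proof.
move=> [M0 HM0] [M1 HM1] [K [tK c0 c1]].
apply/seteqP; split => // S [S0c S1c].
have q0 : 0 < 4^-1 :> R by rewrite invr_gt0.
have [eps [[r0 r1] eps0]] : exists eps, (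
    sup [set fine 'E_P[fun om => K eps (observation w eps S om)] | S in Theta0] < 4^-1 /\
    sup [set fine 'E_P[fun om => 1 - K eps (observation w eps S om)] | S in Theta1] < 4^-1) /\ 0 < eps.
  apply: (@filter_ex _ (0:R)^'+); near=> eps; split; last by near: eps; exact: nbhs_right_gt.
  split; near: eps.
  - by move: c0 => /cvgr_lt/(_ _ q0).
  - by move: c1 => /cvgr_lt/(_ _ q0).
have [mK K01] := tK _ eps0.
have K01' y : 0 <= 1 - K eps y <= 1 by have := K01 y; lra.
have mK' : measurable_fun setT (fun y => 1 - K eps y) by apply: measurable_funB.
have mH (H : obs_space R -> R) S' : measurable_fun setT H ->
    measurable_fun setT (fun om => (H (observation w eps S' om))%:E).
  by move=> mH; apply/measurable_EFinP; exact: measurableT_comp mH (measurable_observation hw _ _).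
have int1 (H : obs_space R -> R) S' : measurable_fun setT H -> (forall y, 0 <= H y <= 1) ->
    exists2 x : R, 0 <= x <= 1 & (\int[P]_om (H (observation w eps S' om))%:E = x%:E)%E.
  move=> mH' H01.
  have I0 : (0 <= \int[P]_om (H (observation w eps S' om))%:E)%E.
    by apply: integral_ge0 => om _; rewrite lee_fin; have /andP[] := H01 (observation w eps S' om).
  have I1 : (\int[P]_om (H (observation w eps S' om))%:E <= 1)%E.
    have : (\int[P]_om (cst 1%E om) = 1%:E :> \bar R)%E.
      by rewrite integral_cst// mul1e; exact: probability_setT.
    move=> <-; apply: ge0_le_integral => //.
    - by move=> om _; rewrite lee_fin; have /andP[] := H01 (observation w eps S' om).
    - exact: mH.
    - by move=> om _; rewrite lee_fin; have /andP[] := H01 (observation w eps S' om).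
  have If : (\int[P]_om (H (observation w eps S' om))%:E)%E \is a fin_num.
    by rewrite ge0_fin_numE//; apply: le_lt_trans I1 _; rewrite ltry.
  exists (fine (\int[P]_om (H (observation w eps S' om))%:E)); last by rewrite fineK.
  by apply/andP; split; rewrite -lee_fin fineK.
have le_sup (H : obs_space R -> R) (Theta : set (L2 R)) S' : measurable_fun setT H ->
    (forall y, 0 <= H y <= 1) -> Theta S' ->
    sup [set fine 'E_P[fun om => H (observation w eps S om)] | S in Theta] < 4^-1 ->
    (\int[P]_om (H (observation w eps S' om))%:E <= (4^-1)%:E)%E.
  move=> mH' H01 TS' sl; have [x x01 xE] := int1 H S' mH' H01.
  rewrite xE lee_fin; apply: le_trans (ltW sl); apply: ub_le_sup.
    exists 1 => _ [S2 _ <-]; rewrite unlock.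
    by have [x2 /andP[_ x21] ->] := int1 H S2 mH' H01.
  by exists S' => //; rewrite unlock xE.
have [s [eta eta0 close]] := @power_weakly_close (K eps) eps (Num.max M0 M1) 4^-1 (tK _ eps0) eps0 q0.
have e20 : 0 < eta / 2 by rewrite divr_gt0.
have nS := weak_nbhs_primitives S s e20.
have [S0 [T0 N0]] := S0c _ nS; have [S1 [T1 N1]] := S1c _ nS.
have L0 : L2norm S0 <= Num.max M0 M1 by rewrite le_max HM0.
have L1 : L2norm S1 <= Num.max M0 M1 by rewrite le_max (HM1 _ T1) orbT.
have : (\int[P]_om (K eps (observation w eps S1 om))%:E <=
     \int[P]_om (K eps (observation w eps S0 om))%:E + 4^-1%:E)%E.
  apply: close => // t ts; have := N0 t ts; have := N1 t ts.
  by rewrite !ltr_norml; lra.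
have h0 := le_sup _ _ _ mK K01 T0 r0; have h1 := le_sup _ _ _ mK' K01' T1 r1.
have : (\int[P]_om (K eps (observation w eps S1 om))%:E +
        \int[P]_om (1 - K eps (observation w eps S1 om))%:E = 1%:E :> \bar R)%E.
  rewrite -ge0_integralD//; last 4 first.
  - by move=> om _; rewrite lee_fin; have /andP[] := K01 (observation w eps S1 om).
  - exact: mH.
  - by move=> om _; rewrite lee_fin; have /andP[] := K01' (observation w eps S1 om).
  - exact: (mH (fun y => 1 - K eps y)).
  under eq_integral do rewrite -EFinD addrC subrK.
  by rewrite integral_cst// mul1e; exact: probability_setT.
have [x0 _ E0] := int1 _ S0 mK K01; have [x1 _ E1] := int1 _ S1 mK K01.
have [x2 _ E2] := int1 _ S1 mK' K01'.
move: h0 h1; rewrite E0 E1 E2 -!EFinD !lee_fin => h0 h1 [h2] h3.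
by lra.
Unshelve. all: by end_near. Qed.

End converse.

Theorem theorem5p3 (R : realType) (d : measure_display)
    (Omega : measurableType d) (P : probability Omega R) (w : R -> Omega -> R)
    (hw : wiener_process P w) (Theta0 Theta1 : set (L2 R)) :
  (L2bounded Theta0 ->
   weak_closure Theta0 `&` weak_closure Theta1 = set0 ->
   distinguishable P w Theta0 Theta1) /\
  (L2bounded Theta0 -> L2bounded Theta1 ->
   distinguishable P w Theta0 Theta1 ->
   weak_closure Theta0 `&` weak_closure Theta1 = set0).
Proof.
by split; [exact: distinguishable_disjoint|exact: disjoint_of_distinguishable].
Qed.
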